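(* Let $\mathbb{F}$ be a field and let $\mathcal{M}$ be a conditional oriented matroid on a finite ground set $\mathcal{I}$. Assume that $\#\mathrm{Aut}(\mathcal{M}) \in \mathbb{F}^\times$. There is an isomorphism of graded $\mathrm{Aut}(\mathcal{M})$-modules $$\mathbf{R}(\mathcal{Z}_{\mathcal{M}}) \cong \bigoplus_{[F] \in \mathcal{L}(\mathcal{M})/\mathrm{Aut}(\mathcal{M})} \mathrm{Ind}_{\mathrm{Aut}(\mathcal{M})_F}^{\mathrm{Aut}(\mathcal{M})}\, \mathbf{R}(\mathcal{Y}_{\mathcal{M}^F})(-\mathrm{codim}(F)),$$ where the sum is over $\mathrm{Aut}(\mathcal{M})$-orbits $[F]$ of flats (one representative $F$ per orbit), $\mathrm{Ind}$ is induction of group representations, and $(-\mathrm{codim}(F))$ shifts degree up by $\mathrm{codim}(F)$.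
   Context: **Conditional oriented matroids.** Let $\mathcal{I}$ be a finite set. A signed subset of $\mathcal{I}$ is a function $X : \mathcal{I} \to \{+,-,0\}$; $-X$ is obtained by exchanging $+$ and $-$. For signed subsets $X, Y$: $\mathrm{Sep}(X,Y) = \{i : X(i) = -Y(i) \neq 0\}$, and $(X \circ Y)(i) = X(i)$ if $X(i) \neq 0$, $(X\circ Y)(i) = Y(i)$ otherwise. A conditional oriented matroid on $\mathcal{I}$ is a family $\mathcal{M}$ of signed subsets of $\mathcal{I}$ (called covectors) such that (Face Symmetry) $X, Y \in \mathcal{M}$ implies $X \circ (-Y) \in \mathcal{M}$; and (Strong Elimination) if $X,Y \in \mathcal{M}$ and $i \in \mathrm{Sep}(X,Y)$, there is $Z \in \mathcal{M}$ with $Z(i) = 0$ and $Z(j) = (X\circ Y)(j)$ for all $j \in \mathcal{I} - \mathrm{Sep}(X,Y)$. A tope is a covector $X$ with $X(i) \neq 0$ for all $i$; $\mathcal{T}(\mathcal{M})$ is the set of topes. **Flats, contraction, codimension.** For $X \in \mathcal{M}$, $\mathrm{Flat}(X) = \{i : X(i) = 0\}$, and $\mathcal{L}(\mathcal{M}) = \{\mathrm{Flat}(X) : X \in \mathcal{M}\}$ is the poset of flats, ordered by containment; it is closed under intersection. For $F \in \mathcal{L}(\mathcal{M})$, the contraction $\mathcal{M}^F = \{X|_{\mathcal{I}-F} : X \in \mathcal{M},\ X(i) = 0 \text{ for all } i \in F\}$ is a conditional oriented matroid on $\mathcal{I} - F$. If $C \subseteq \mathcal{I}$ is contained in at least one flat,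 $\overline{C}$ denotes the containment-minimal flat containing $C$. A subset $B \subseteq F$ is basic for the flat $F$ if $\overline{B} = F$, and $C \subseteq B$ with $\overline{C} = F$ implies $C = B$. Every flat $F$ has a basic set, and all basic sets of $F$ have the same cardinality, denoted $\mathrm{codim}(F)$. **Orbit harmonics and loci.** For a finite set $\mathcal{Z} \subseteq \mathbb{F}^N$ with coordinate ring $R$, $\mathbf{I}(\mathcal{Z}) \subseteq R$ is the ideal of polynomials vanishing on $\mathcal{Z}$; $\mathrm{gr}\,\mathbf{I}(\mathcal{Z})$ is the ideal generated by the top-degree homogeneous components of nonzero $f \in \mathbf{I}(\mathcal{Z})$; and $\mathbf{R}(\mathcal{Z}) = R/\mathrm{gr}\,\mathbf{I}(\mathcal{Z})$, a graded algebra. The big locus is $\mathcal{Z}_{\mathcal{M}} = \{\mathbf{z}_X : X \in \mathcal{M}\} \subseteq \mathbb{F}^{\mathcal{I} \times \{+,-,0\}}$, where $(\mathbf{z}_X)_{i,s} = 1$ if $X(i) = s$ and $0$ otherwise; its ambient coordinate ring is $\widehat{S} = \mathbb{F}[y_i^+,y_i^-,z_i : i \in \mathcal{I}]$ with $y_i^+, y_i^-, z_i$ the coordinates indexed by $(i,+),(i,-),(i,0)$. The small locus is $\mathcal{Y}_{\mathcal{M}} = \{\mathbf{y}_X : X \in \mathcal{T}(\mathcal{M})\} \subseteq \mathbb{F}^{\mathcal{I} \times \{+,-\}}$, where $(\mathbf{y}_X)_{i,s} = 1$ if $X(i)=s$ and $0$ otherwise. For a flat $F$, $\mathcal{Y}_{\mathcal{M}^F}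 \subseteq \mathbb{F}^{(\mathcal{I}-F)\times\{+,-\}}$ has ambient coordinate ring $S_F = \mathbb{F}[y_i^+,y_i^- : i \in \mathcal{I}-F]$. **Group actions.** The group $\mathfrak{S}_{\pm\mathcal{I}}$ of signed permutations of $\mathcal{I}$ consists of pairs $w = (\sigma,\varepsilon)$ with $\sigma$ a permutation of $\mathcal{I}$ and $\varepsilon : \mathcal{I} \to \{\pm 1\}$; it acts on signed subsets by $(w\cdot X)(\sigma(i)) = \varepsilon_i X(i)$. $\mathrm{Aut}(\mathcal{M})$ is the subgroup of $w$ with $w \cdot X \in \mathcal{M}$ for all $X \in \mathcal{M}$. It acts on $\widehat{S}$ by permuting variables, $y_i^{s} \mapsto y_{\sigma(i)}^{\varepsilon_i s}$, $z_i \mapsto z_{\sigma(i)}$; this preserves $\mathrm{gr}\,\mathbf{I}(\mathcal{Z}_{\mathcal{M}})$ and so gives $\mathbf{R}(\mathcal{Z}_{\mathcal{M}})$ a graded $\mathrm{Aut}(\mathcal{M})$-module structure. $\mathrm{Aut}(\mathcal{M})$ acts on $\mathcal{L}(\mathcal{M})$ by $w \cdot F = \sigma(F)$; $\mathrm{Aut}(\mathcal{M})_F = \{w : w\cdot F = F\}$ is the stabilizer. Each $w \in \mathrm{Aut}(\mathcal{M})_F$ acts on $S_F$ by $y_i^s \mapsto y_{\sigma(i)}^{\varepsilon_i s}$ for $i \in \mathcal{I}-F$ (signed permutation of $F$ acts trivially); this preserves $\mathrm{gr}\,\mathbf{I}(\mathcal{Y}_{\mathcal{M}^F})$ and makes $\mathbf{R}(\mathcal{Y}_{\mathcal{M}^F})$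 a graded $\mathrm{Aut}(\mathcal{M})_F$-module. *)

(* Defs.v *)
From HB Require Import structures.
From mathcomp Require Import all_boot all_order all_fingroup all_algebra.
From mathcomp Require Import generic_quotient ring_quotient finmap boolp.
From mathcomp Require Import mpoly.

Set Implicit Arguments.
Unset Strict Implicit.
Unset Printing Implicit Defensive.

Import GRing.Theory.
Local Open Scope ring_scope.

(* {+, -, 0} is encoded as option bool: Some true is +, Some false is -, and
   None is 0. Likewise bool alone is {+, -}. *)
Notation sign := (option bool).
Notation signed_subset I := {ffun I -> sign}.

Section ConditionalOrientedMatroid.
Variable I : finType.
Implicit Types (X Y Z : signed_subset I) (M : {set signed_subset I}).
Implicit Types (B C F G : {set I}).

Definition sopp X : signed_subset I := [ffun i => omap negb (X i)].

Definition Sep X Y : {set I} := [set i | (X i == sopp Y i) && (X i != None)].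

Definition scomp X Y : signed_subset I :=
  [ffun i => if X i == None then Y i else X i].

Definition face_symmetry M :=
  forall X Y, X \in M -> Y \in M -> scomp X (sopp Y) \in M.

Definition strong_elimination M :=
  forall X Y i, X \in M -> Y \in M -> i \in Sep X Y ->
  exists Z, [/\ Z \in M, Z i = None &
    forall j, j \notin Sep X Y -> Z j = scomp X Y j].

Definition cond_oriented_matroid M := face_symmetry M /\ strong_elimination M.

Definition topes M : {set signed_subset I} :=
  [set X in M | [forall i, X i != None]].

Definition Flat X : {set I} := [set i | X i == None].

Definition flats M : {set {set I}} := [set Flat X | X in M].

Definition restrict F X : signed_subset {i | i \notin F} :=
  [ffun i => X (val i)].

Lemma restrictE F X j : restrict F X j = X (val j).
Proof. exact: ffunE. Qed.

Definition contraction M F : {set signed_subset {i | i \notin F}} :=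
  [set restrict F X | X in [set X in M | F \subset Flat X]].

(* G is a containment-minimal flat containing C *)
Definition is_closure M C G : bool :=
  minset (fun G' : {set I} => (G' \in flats M) && (C \subset G')) G.

Definition basic M F B : bool :=
  (B \subset F) && minset (fun C : {set I} => is_closure M C F) B.

(* All basic sets of a flat of a conditional oriented matroid have the same
   cardinality, so the choice made by pick is immaterial. *)
Definition codim M F : nat := #|odflt set0 [pick B | basic M F B]|.

End ConditionalOrientedMatroid.

(* The pair (sigma, eps), where eps i = true stands for the sign -1. The
   product is the one for which (w1 * w2) . X = w1 . (w2 . X); recall that
   (s * t) i = t (s i) for s, t : {perm I}. *)
Definition signed_perm (I : finType) := ({perm I} * {ffun I -> bool})%type.

Section SignedPermutations.
Variable I : finType.
Local Notation SP := (signed_perm I).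

HB.instance Definition _ := Finite.on SP.

Definition sp_mul (w1 w2 : SP) : SP :=
  (w2.1 * w1.1, [ffun i => w1.2 (w2.1 i) (+) w2.2 i])%g.
Definition sp_one : SP := (1%g, [ffun=> false]).
Definition sp_inv (w : SP) : SP := (w.1^-1, [ffun i => w.2 (w.1^-1 i)])%g.

Lemma sp_mulA : associative sp_mul.
Proof.
move=> w1 w2 w3; congr pair; first by rewrite /= mulgA.
by apply/ffunP=> i; rewrite !ffunE /= ?ffunE permM addbA.
Qed.

Lemma sp_mul1 : left_id sp_one sp_mul.
Proof.
case=> s e; congr pair; first by rewrite /= mulg1.
by apply/ffunP=> i; rewrite !ffunE.
Qed.

Lemma sp_mulV : left_inverse sp_one sp_inv sp_mul.
Proof.
case=> s e; congr pair; first by rewrite /= mulgV.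
by apply/ffunP=> i; rewrite !ffunE /= permK addbb.
Qed.

HB.instance Definition _ := Finite_isGroup.Build SP sp_mulA sp_mul1 sp_mulV.

Definition sign_mul (e : bool) (s : sign) : sign := omap (addb e) s.

(* (w . X) (sigma i) = eps i * X i *)
Definition sp_act (w : SP) (X : signed_subset I) : signed_subset I :=
  [ffun j => sign_mul (w.2 ((w.1^-1)%g j)) (X ((w.1^-1)%g j))].

Lemma sp_actE (w : SP) X i : sp_act w X (w.1 i) = sign_mul (w.2 i) (X i).
Proof. by rewrite ffunE permK. Qed.

Lemma sp_act1 X : sp_act 1%g X = X.
Proof.
apply/ffunP=> i; have := sp_actE 1%g X i; rewrite /= perm1 => ->.
by rewrite ffunE; case: (X i).
Qed.

Lemma sp_actM (w1 w2 : SP) X : sp_act (w1 * w2)%g X = sp_act w1 (sp_act w2 X).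
Proof.
apply/ffunP=> j; rewrite -[j](permKV (w1 * w2)%g.1); set i := (_ j).
by rewrite sp_actE /= permM !sp_actE ffunE; case: (X i) => //= b; rewrite addbA.
Qed.

Variable M : {set signed_subset I}.

Definition sAut : {set SP} := [set w | [forall X in M, sp_act w X \in M]].

Lemma sAutP w : reflect {in M, forall X, sp_act w X \in M} (w \in sAut).
Proof. by rewrite inE; apply: forall_inP. Qed.

Lemma sAut_group_set : group_set sAut.
Proof.
apply/group_setP; split; first by apply/sAutP=> X; rewrite sp_act1.
move=> v w /sAutP hv /sAutP hw; apply/sAutP=> X /hw /hv.
by rewrite sp_actM.
Qed.
Canonical sAut_group := Group sAut_group_set.

Definition sAut_stab (F : {set I}) : {set SP} :=
  [set w in sAut | w.1 @: F == F].

Lemma sAut_stab_group_set F : group_set (sAut_stab F).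
Proof.
apply/group_setP; split.
  rewrite inE group1 /=; apply/eqP/setP=> i; apply/imsetP/idP.
    by case=> j Fj ->; rewrite perm1.
  by exists i; rewrite // perm1.
move=> v w /setIdP[Av /eqP Fv] /setIdP[Aw /eqP Fw]; rewrite inE groupM //=.
apply/eqP; rewrite -[RHS]Fv -[in RHS]Fw -imset_comp.
by apply: eq_imset => i; rewrite /= permM.
Qed.
Canonical sAut_stab_group F := Group (sAut_stab_group_set F).

Lemma sAut_stab_sub F : sAut_stab F \subset sAut.
Proof. by apply/subsetP=> w /setIdP[]. Qed.

Definition flat_orbits : {set {set {set I}}} :=
  [set [set w.1 @: F | w : SP in sAut] | F : {set I} in flats M].

Lemma sAut_flat (w : SP) (F : {set I}) : w \in sAut -> F \in flats M -> w.1 @: F \in flats M.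
Proof.
move=> /sAutP Aw /imsetP[X MX ->]; apply/imsetP; exists (sp_act w X).
  exact: Aw.
apply/setP=> j; rewrite -[j](permKV w.1); set i := (_ j).
rewrite mem_imset; last exact: perm_inj.
by rewrite !inE sp_actE; case: (X i).
Qed.

(* Hence is_transversal _ flat_orbits (flats M) says exactly that the first
   argument contains one representative of each orbit of flats. *)
Lemma flat_orbits_partition : partition flat_orbits (flats M).
Proof.
have orb1 (F : {set I}) : F \in [set w.1 @: F | w : SP in sAut].
  apply/imsetP; exists 1%g; first exact: group1.
  by apply/setP=> i; rewrite -[i in RHS]perm1 mem_imset //; apply: perm_inj.
have orbM (F : {set I}) (w v : SP) : (w * v)%g.1 @: F = w.1 @: (v.1 @: F).
  by rewrite -imset_comp; apply: eq_imset => i; rewrite /= permM.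
have sub (F : {set I}) (v : SP) : v \in sAut ->
    [set w.1 @: (v.1 @: F) | w : SP in sAut] \subset [set w.1 @: F | w : SP in sAut].
  move=> Av; apply/subsetP=> G /imsetP[w Aw ->]; rewrite -orbM.
  by apply: imset_f (groupM Aw Av).
have eqo (F : {set I}) (v : SP) : v \in sAut ->
    [set w.1 @: (v.1 @: F) | w : SP in sAut] = [set w.1 @: F | w : SP in sAut].
  move=> Av; apply/eqP; rewrite eqEsubset sub //=.
  have := sub (v.1 @: F) (v^-1)%g; rewrite -orbM mulVg groupV.
  suff -> : (1%g : SP).1 @: F = F by apply.
  by apply/setP=> i; rewrite -[i in LHS]perm1 mem_imset //; apply: perm_inj.
apply/and3P; split.
- apply/eqP/setP=> G; apply/bigcupP/idP.
    by case=> _ /imsetP[F LF ->] /imsetP[w Aw ->]; apply: sAut_flat.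
  by move=> LG; exists [set w.1 @: G | w : SP in sAut] => //; apply: imset_f.
- apply/trivIsetP=> _ _ /imsetP[F LF ->] /imsetP[G LG ->]; apply: contraNT.
  case/pred0Pn=> _ /andP[/imsetP[v Av ->] /imsetP[w Aw e]].
  by rewrite -(eqo F v Av) e eqo.
- apply/imsetP=> -[F _ /setP/(_ F)]; rewrite inE => /esym.
  by rewrite orb1.
Qed.

End SignedPermutations.

(* A graded representation of G over K: the grading V = \bigoplus_d V_d is
   given by the projections gcomp d : V -> V onto the graded pieces. *)
Record gradedModule (K : fieldType) (G : finGroupType) := GradedModule {
  gsort :> lmodType K;
  gact : G -> {linear gsort -> gsort};
  gcomp : nat -> {linear gsort -> gsort};
  gact1 : forall v, gact 1%g v = v;
  gactM : forall g h v, gact (g * h)%g v = gact g (gact h v);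
  gcompE : forall d e v, gcomp d (gcomp e v) = if d == e then gcomp e v else 0;
  gcomp_sum : forall v, exists n, v = \sum_(d < n) gcomp d v;
  gcomp_act : forall d g v, gcomp d (gact g v) = gact g (gcomp d v)
}.

Definition homogeneous (K : fieldType) (G : finGroupType)
    (V : gradedModule K G) (d : nat) (v : V) : Prop := gcomp V d v = v.

Definition graded_iso (K : fieldType) (G : finGroupType)
    (V W : gradedModule K G) : Prop :=
  exists f : {linear V -> W}, [/\ bijective f,
    forall g v, f (gact V g v) = gact W g (f v) &
    forall d v, homogeneous d v -> homogeneous d (f v)].

Section GradedModuleTheory.
Variables (K : fieldType) (G : finGroupType) (V : gradedModule K G).

Lemma gcomp_large v : exists n, forall d, (n <= d)%N -> gcomp V d v = 0.
Proof.
have [n vE] := gcomp_sum v; exists n => d led.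
rewrite vE linear_sum big1 // => e _; rewrite gcompE; case: eqP => // de.
by have := ltn_ord e; rewrite -de ltnNge led.
Qed.

Lemma gcomp_sum_large v n : (forall d, (n <= d)%N -> gcomp V d v = 0) ->
  v = \sum_(d < n) gcomp V d v.
Proof.
move=> vn; have [m vE] := gcomp_sum v; have [lemn|/ltnW lenm] := leqP m n.
  rewrite [LHS]vE (big_ord_widen _ (fun d => gcomp V d v) lemn) big_mkcond.
  apply: eq_bigr => d _; case: ltnP => // lemd.
  rewrite vE linear_sum big1 // => e _; rewrite gcompE; case: eqP => // de.
  by have := ltn_ord e; rewrite -de ltnNge lemd.
rewrite [LHS]vE (big_ord_widen _ (fun d => gcomp V d v) lenm) big_mkcond.
rewrite [RHS]big_mkcond; apply: eq_bigr => d _.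
by case: ltnP => // /vn.
Qed.

End GradedModuleTheory.

(* V(-c) *)
Section Shift.
Variables (K : fieldType) (G : finGroupType) (V : gradedModule K G) (c : nat).

Definition shift_comp d : {linear V -> V} :=
  if (d < c)%N then (\0 : {linear V -> V}) else gcomp V (d - c).

Fact shift_compE d e v : shift_comp d (shift_comp e v) =
  if d == e then shift_comp e v else 0.
Proof.
rewrite /shift_comp; have [ltdc|lecd] := ltnP d c.
  by case: eqP => //= <-; rewrite ltdc.
have [ltec|lece] := ltnP e c; first by rewrite linear0 /= if_same.
by rewrite gcompE -(eqn_add2r c) !subnK.
Qed.

Fact shift_comp_sum v : exists n, v = \sum_(d < n) shift_comp d v.
Proof.
have [n vE] := gcomp_sum v; exists (c + n)%N.
rewrite big_split_ord /= big1 ?add0r; last first.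
  by move=> i _; rewrite /shift_comp ltn_ord.
rewrite {1}vE; apply: eq_bigr => i _.
by rewrite /shift_comp ltnNge leq_addr /= addKn.
Qed.

Fact shift_comp_act d g v : shift_comp d (gact V g v) = gact V g (shift_comp d v).
Proof.
by rewrite /shift_comp; case: ifP => _; rewrite /= ?linear0 // gcomp_act.
Qed.

Definition gshift : gradedModule K G :=
  GradedModule (@gact1 _ _ V) (@gactM _ _ V)
    shift_compE shift_comp_sum shift_comp_act.

End Shift.

Definition dsum_type (K : fieldType) (J : finType) (V : J -> lmodType K) :=
  {dffun forall j, V j}.

Section DirectSumLmod.
Variables (K : fieldType) (J : finType) (V : J -> lmodType K).
Local Notation W := (dsum_type V).
Implicit Types (a b : K) (u v w : W).

HB.instance Definition _ := Choice.on W.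

Definition dsum_zero : W := [ffun j => 0].
Definition dsum_opp v : W := [ffun j => - v j].
Definition dsum_add u v : W := [ffun j => u j + v j].
Definition dsum_scale a v : W := [ffun j => a *: v j].

Fact dsum_addA : associative dsum_add.
Proof. by move=> u v w; apply/ffunP=> j; rewrite !ffunE addrA. Qed.
Fact dsum_addC : commutative dsum_add.
Proof. by move=> u v; apply/ffunP=> j; rewrite !ffunE addrC. Qed.
Fact dsum_add0 : left_id dsum_zero dsum_add.
Proof. by move=> v; apply/ffunP=> j; rewrite !ffunE add0r. Qed.
Fact dsum_addN : left_inverse dsum_zero dsum_opp dsum_add.
Proof. by move=> v; apply/ffunP=> j; rewrite !ffunE addNr. Qed.

HB.instance Definition _ :=
  GRing.isZmodule.Build W dsum_addA dsum_addC dsum_add0 dsum_addN.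

Fact dsum_scaleA a b v : dsum_scale a (dsum_scale b v) = dsum_scale (a * b) v.
Proof. by apply/ffunP=> j; rewrite !ffunE scalerA. Qed.
Fact dsum_scale1 : left_id 1 dsum_scale.
Proof. by move=> v; apply/ffunP=> j; rewrite !ffunE scale1r. Qed.
Fact dsum_scaleDr : right_distributive dsum_scale +%R.
Proof. by move=> a u v; apply/ffunP=> j; rewrite !ffunE scalerDr. Qed.
Fact dsum_scaleDl v : {morph dsum_scale^~ v : a b / a + b}.
Proof. by move=> a b; apply/ffunP=> j; rewrite !ffunE scalerDl. Qed.

HB.instance Definition _ := GRing.Zmodule_isLmodule.Build K W
  dsum_scaleA dsum_scale1 dsum_scaleDr dsum_scaleDl.

Lemma dsum_sumE (S : Type) (r : seq S) P (f : S -> W) j :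
  (\sum_(s <- r | P s) f s) j = \sum_(s <- r | P s) f s j.
Proof.
by elim/big_rec2: _ => [|s u v _ <-]; rewrite ffunE.
Qed.

Definition dsum_map (f : forall j, {linear V j -> V j}) v : W :=
  [ffun j => f j (v j)].

Fact dsum_map_linear f : linear (dsum_map f).
Proof. by move=> a u v; apply/ffunP=> j; rewrite !ffunE linearP. Qed.

HB.instance Definition _ f :=
  GRing.isLinear.Build K W W _ (dsum_map f) (@dsum_map_linear f).

End DirectSumLmod.

Section DirectSum.
Variables (K : fieldType) (G : finGroupType) (J : finType).
Variable V : J -> gradedModule K G.
Local Notation W := (dsum_type (fun j => gsort (V j))).

Definition dsum_act g : {linear W -> W} := dsum_map (fun j => gact (V j) g).
Definition dsum_comp d : {linear W -> W} := dsum_map (fun j => gcomp (V j) d).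

Fact dsum_act1 v : dsum_act 1%g v = v.
Proof. by apply/ffunP=> j; rewrite ffunE gact1. Qed.
Fact dsum_actM g h v : dsum_act (g * h)%g v = dsum_act g (dsum_act h v).
Proof. by apply/ffunP=> j; rewrite !ffunE gactM. Qed.
Fact dsum_compE d e v : dsum_comp d (dsum_comp e v) =
  if d == e then dsum_comp e v else 0.
Proof.
by apply/ffunP=> j; rewrite !ffunE gcompE; case: eqP; rewrite !ffunE.
Qed.
Fact dsum_comp_sum v : exists n, v = \sum_(d < n) dsum_comp d v.
Proof.
have ex j : {n | forall d, (n <= d)%N -> gcomp (V j) d (v j) = 0}.
  exact/cid/gcomp_large.
exists (\max_j sval (ex j))%N; apply/ffunP=> j; rewrite dsum_sumE.
rewrite [LHS](@gcomp_sum_large _ _ _ _ (\max_j sval (ex j))%N).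
  by apply: eq_bigr => d _; rewrite ffunE.
move=> d led; apply: (svalP (ex j)); apply: leq_trans led.
exact: (leq_bigmax j).
Qed.
Fact dsum_comp_act d g v : dsum_comp d (dsum_act g v) = dsum_act g (dsum_comp d v).
Proof. by apply/ffunP=> j; rewrite !ffunE gcomp_act. Qed.

Definition gdsum : gradedModule K G :=
  GradedModule dsum_act1 dsum_actM dsum_compE dsum_comp_sum dsum_comp_act.

End DirectSum.

Section QuotientLmod.
Variables (K : fieldType) (V : lmodType K) (S : {pred V}).
Hypothesis S_closed : submod_closed S.

Definition submod_of (_ : submod_closed S) : {pred V} := S.
HB.instance Definition _ := GRing.isZmodClosed.Build V (submod_of S_closed)
  (GRing.submod_closedB S_closed).

Local Notation Q := (Quotient.quot (submod_of S_closed)).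
Local Open Scope quotient_scope.

Lemma quot_eqP (u v : V) : reflect (\pi_Q u = \pi_Q v) (u - v \in S).
Proof.
rewrite (_ : (_ \in S) = (u - v \in submod_of S_closed)) //.
by rewrite Quotient.idealrBE; apply: eqP.
Qed.

Lemma repr_quot (v : V) : repr (\pi_Q v) - v \in S.
Proof. by apply/quot_eqP; rewrite reprK. Qed.

Definition quot_scale (a : K) (q : Q) : Q := \pi_Q (a *: repr q).

Fact quot_scaleE a v : quot_scale a (\pi_Q v) = \pi_Q (a *: v).
Proof.
apply/quot_eqP; rewrite -scalerBr.
exact: (GRing.subsemimod_closedZ (GRing.submod_closed_semi S_closed)) (repr_quot v).
Qed.

Fact quot_scaleA a b q : quot_scale a (quot_scale b q) = quot_scale (a * b) q.
Proof. by elim/quotW: q => v; rewrite (quot_scaleE b) !quot_scaleE scalerA. Qed.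
Fact quot_scale1 : left_id 1 quot_scale.
Proof. by elim/quotW=> v; rewrite quot_scaleE scale1r. Qed.
Fact quot_scaleDr : right_distributive quot_scale +%R.
Proof.
move=> a; elim/quotW=> u; elim/quotW=> v; rewrite -raddfD !quot_scaleE.
by rewrite scalerDr raddfD.
Qed.
Fact quot_scaleDl q : {morph quot_scale^~ q : a b / a + b}.
Proof. by move=> a b; elim/quotW: q => v; rewrite !quot_scaleE scalerDl raddfD. Qed.

HB.instance Definition _ := GRing.Zmodule_isLmodule.Build K Q
  quot_scaleA quot_scale1 quot_scaleDr quot_scaleDl.

Fact pi_quot_scalable : scalable (\pi_Q : V -> Q).
Proof. by move=> a v; rewrite -quot_scaleE. Qed.

HB.instance Definition _ :=
  GRing.isScalable.Build K V Q _ (\pi_Q : V -> Q) pi_quot_scalable.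

Definition quot_map (f : {linear V -> V})
    (_ : forall v, v \in S -> f v \in S) (q : Q) : Q := \pi_Q (f (repr q)).

Lemma quot_mapE f Sf v : @quot_map f Sf (\pi_Q v) = \pi_Q (f v).
Proof. by apply/quot_eqP; rewrite -linearB Sf ?repr_quot. Qed.

Fact quot_map_linear f Sf : linear (@quot_map f Sf).
Proof.
move=> a; elim/quotW=> u; elim/quotW=> v; rewrite -linearP !quot_mapE.
by rewrite linearP [LHS]linearP.
Qed.

HB.instance Definition _ f Sf :=
  GRing.isLinear.Build K Q Q _ (@quot_map f Sf) (@quot_map_linear f Sf).

End QuotientLmod.

Section Quotient.
Local Open Scope quotient_scope.
Variables (K : fieldType) (G : finGroupType) (V : gradedModule K G).
Variables (S : {pred V}) (S_closed : submod_closed S).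
Hypothesis Sact : forall g v, v \in S -> gact V g v \in S.
Hypothesis Scomp : forall d v, v \in S -> gcomp V d v \in S.
Local Notation Q := (Quotient.quot (submod_of S_closed)).

Definition quot_act g : {linear Q -> Q} := @quot_map _ _ _ S_closed _ (Sact g).
Definition quot_comp d : {linear Q -> Q} := @quot_map _ _ _ S_closed _ (Scomp d).

Fact quot_act_pi g v : quot_act g (\pi_Q v) = \pi_Q (gact V g v).
Proof. exact: quot_mapE. Qed.
Fact quot_comp_pi d v : quot_comp d (\pi_Q v) = \pi_Q (gcomp V d v).
Proof. exact: quot_mapE. Qed.

Fact quot_act1 q : quot_act 1%g q = q.
Proof. by elim/quotW: q => v; rewrite quot_act_pi gact1. Qed.
Fact quot_actM g h q : quot_act (g * h)%g q = quot_act g (quot_act h q).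
Proof.
by elim/quotW: q => v; rewrite (quot_act_pi h) !quot_act_pi gactM.
Qed.
Fact quot_compE d e q : quot_comp d (quot_comp e q) =
  if d == e then quot_comp e q else 0.
Proof.
elim/quotW: q => v; rewrite (quot_comp_pi e) quot_comp_pi gcompE.
by case: eqP; rewrite ?linear0.
Qed.
Fact quot_comp_sum q : exists n, q = \sum_(d < n) quot_comp d q.
Proof.
elim/quotW: q => v; have [n vE] := gcomp_sum v; exists n.
by rewrite {1}vE linear_sum; apply: eq_bigr => d _; rewrite quot_comp_pi.
Qed.
Fact quot_comp_act d g q :
  quot_comp d (quot_act g q) = quot_act g (quot_comp d q).
Proof.
elim/quotW: q => v; rewrite quot_act_pi (quot_comp_pi d v).
by rewrite quot_comp_pi quot_act_pi gcomp_act.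
Qed.

Definition gquot : gradedModule K G :=
  GradedModule quot_act1 quot_actM quot_compE quot_comp_sum quot_comp_act.

End Quotient.

Section Span.
Variables (K : fieldType) (V : lmodType K) (A : V -> Prop).

Definition in_span (v : V) : Prop :=
  exists n (a : 'I_n -> K) (x : 'I_n -> V),
    (forall i, A (x i)) /\ v = \sum_(i < n) a i *: x i.

Definition span : {pred V} := fun v => `[< in_span v >].

Fact span_submod_closed : submod_closed span.
Proof.
split.
  apply/asboolP; exists 0%N, (fun=> 0), (fun=> 0); split; first by case.
  by rewrite big_ord0.
move=> c _ _ /asboolP[m [a [x [Ax ->]]]] /asboolP[n [b [y [Ay ->]]]].
apply/asboolP; exists (m + n)%N.
exists (fun i => match split i with inl j => c * a j | inr k => b k end).
exists (fun i => match split i with inl j => x j | inr k => y k end).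
split; first by move=> i; case: (split i).
rewrite big_split_ord scaler_sumr; congr (_ + _); apply: eq_bigr => i _.
  by rewrite (unsplitK (inl i)) scalerA.
by rewrite (unsplitK (inr i)).
Qed.

HB.instance Definition _ := GRing.isSubmodClosed.Build K V span
  (GRing.submod_closed_semi span_submod_closed).

Lemma span_stable (f : {linear V -> V}) :
  (forall x, A x -> f x \in span) -> forall v, v \in span -> f v \in span.
Proof.
move=> Af _ /asboolP[n [a [x [Ax ->]]]]; rewrite linear_sum rpred_sum // => i _.
by rewrite linearZ rpredZ // Af.
Qed.

Lemma mem_span x : A x -> x \in span.
Proof.
move=> Ax; apply/asboolP; exists 1%N, (fun=> 1), (fun=> x); split => //.
by rewrite big_ord1 scale1r.
Qed.

End Span.

(* For H a subgroup of G, the induced module K[G] (x)_{K[H]} V, as the quotient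
   of K[G] (x)_K V = {ffun G -> V} by the relations gh (x) v = g (x) hv. *)
Section Induction.
Variables (K : fieldType) (gT : finGroupType) (G H : {group gT}).
Variable V : gradedModule K (subg_of H).
Local Notation sG := (subg_of G).
Local Notation W := {ffun sG -> gsort V}.

Definition tens (g : sG) (v : V) : W := [ffun x => if x == g then v else 0].

Definition ind_rel (w : W) : Prop := exists (g : sG) (h : subg_of H) (v : V),
  w = tens (g * subg G (sgval h))%g v - tens g (gact V h v).

Definition regular_act_fun (g : sG) (w : W) : W := [ffun x => w (g^-1 * x)%g].
Fact regular_act_linear g : linear (regular_act_fun g).
Proof. by move=> a u v; apply/ffunP=> x; rewrite !ffunE. Qed.
HB.instance Definition _ g :=
  GRing.isLinear.Build K W W _ (regular_act_fun g) (regular_act_linear g).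
Definition regular_act g : {linear W -> W} := regular_act_fun g.

Definition regular_comp_fun d (w : W) : W := [ffun x => gcomp V d (w x)].
Fact regular_comp_linear d : linear (regular_comp_fun d).
Proof. by move=> a u v; apply/ffunP=> x; rewrite !ffunE linearP. Qed.
HB.instance Definition _ d :=
  GRing.isLinear.Build K W W _ (regular_comp_fun d) (regular_comp_linear d).
Definition regular_comp d : {linear W -> W} := regular_comp_fun d.

Lemma regular_act_tens g x v : regular_act g (tens x v) = tens (g * x)%g v.
Proof. by apply/ffunP=> y; rewrite !ffunE (canF_eq (mulKVg g)). Qed.

Lemma regular_comp_tens d x v : regular_comp d (tens x v) = tens x (gcomp V d v).
Proof. by apply/ffunP=> y; rewrite !ffunE; case: eqP; rewrite ?linear0. Qed.

Fact regular_act1 w : regular_act 1%g w = w.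
Proof. by apply/ffunP=> x; rewrite ffunE invg1 mul1g. Qed.
Fact regular_actM g h w :
  regular_act (g * h)%g w = regular_act g (regular_act h w).
Proof. by apply/ffunP=> x; rewrite !ffunE invMg mulgA. Qed.
Fact regular_compE d e w : regular_comp d (regular_comp e w) =
  if d == e then regular_comp e w else 0.
Proof.
by apply/ffunP=> x; rewrite !ffunE gcompE; case: eqP; rewrite !ffunE.
Qed.
Fact regular_comp_sum w : exists n, w = \sum_(d < n) regular_comp d w.
Proof.
have ex x : {n | forall d, (n <= d)%N -> gcomp V d (w x) = 0}.
  exact/cid/gcomp_large.
exists (\max_x sval (ex x))%N; apply/ffunP=> x; rewrite sum_ffunE.
rewrite [LHS](@gcomp_sum_large _ _ _ _ (\max_x sval (ex x))%N).
  by apply: eq_bigr => d _; rewrite ffunE.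
move=> d led; apply: (svalP (ex x)); apply: leq_trans led.
exact: (leq_bigmax x).
Qed.
Fact regular_comp_act d g w :
  regular_comp d (regular_act g w) = regular_act g (regular_comp d w).
Proof. by apply/ffunP=> x; rewrite !ffunE. Qed.

Definition gregular : gradedModule K sG :=
  GradedModule regular_act1 regular_actM regular_compE regular_comp_sum
    regular_comp_act.

Definition ind_span : {pred gregular} := span ind_rel.

Fact ind_act_stable g w : w \in ind_span -> gact gregular g w \in ind_span.
Proof.
apply: span_stable => {w} _ [x [h [v ->]]]; apply: mem_span.
by exists (g * x)%g, h, v; rewrite linearB !regular_act_tens mulgA.
Qed.

Fact ind_comp_stable d w : w \in ind_span -> gcomp gregular d w \in ind_span.
Proof.
apply: span_stable => {w} _ [x [h [v ->]]]; apply: mem_span.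
exists x, h, (gcomp V d v).
by rewrite linearB !regular_comp_tens gcomp_act.
Qed.

Definition gInd : gradedModule K sG := 
  gquot (V := gregular) (span_submod_closed ind_rel) ind_act_stable ind_comp_stable.

End Induction.

(* Polynomials in variables indexed by a finite type T; the variable of index t
   is 'X_(enum_rank t), and points of affine space are functions T -> K. *)
Section OrbitHarmonics.
Variables (K : fieldType) (T : finType).
Local Notation S := {mpoly K[#|T|]}.

Definition var (t : T) : S := 'X_(enum_rank t).

Definition eval_at (z : {ffun T -> K}) (p : S) : K := p.@[fun k => z (enum_val k)].

Definition top_component (p : S) : S := pihomog mdeg (msize p).-1 p.

Variable Z : {fset {ffun T -> K}}.

Definition vanishes_on (p : S) : Prop := forall z, z \in Z -> eval_at z p = 0.

Definition is_top_component (q : S) : Prop :=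
  exists p, [/\ p != 0, vanishes_on p & q = top_component p].

Definition in_gr_ideal (f : S) : Prop :=
  exists n (a q : 'I_n -> S),
    (forall i, is_top_component (q i)) /\ f = \sum_(i < n) a i * q i.

Definition gr_ideal : {pred S} := fun f => `[< in_gr_ideal f >].

Fact gr_ideal_submod_closed : submod_closed gr_ideal.
Proof.
split.
  apply/asboolP; exists 0%N, (fun=> 0), (fun=> 0); split; first by case.
  by rewrite big_ord0.
move=> c _ _ /asboolP[m [a [x [Ax ->]]]] /asboolP[n [b [y [Ay ->]]]].
apply/asboolP; exists (m + n)%N.
exists (fun i => match split i with inl j => c *: a j | inr k => b k end).
exists (fun i => match split i with inl j => x j | inr k => y k end).
split; first by move=> i; case: (split i).
rewrite big_split_ord scaler_sumr; congr (_ + _); apply: eq_bigr => i _.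
  by rewrite (unsplitK (inl i)) scalerAl.
by rewrite (unsplitK (inr i)).
Qed.

HB.instance Definition _ := GRing.isSubmodClosed.Build K S gr_ideal
  (GRing.submod_closed_semi gr_ideal_submod_closed).

Lemma gr_ideal_gen a q : is_top_component q -> a * q \in gr_ideal.
Proof.
move=> hq; apply/asboolP; exists 1%N, (fun=> a), (fun=> q); split => //.
by rewrite big_ord1.
Qed.

Definition rename_fun (f : T -> T) (p : S) : S :=
  p \mPo [tuple var (f (enum_val k)) | k < #|T|].
Fact rename_linear f : linear (rename_fun f).
Proof. by move=> a p q; rewrite /rename_fun linearP. Qed.
HB.instance Definition _ f :=
  GRing.isLinear.Build K S S _ (rename_fun f) (rename_linear f).
(* The substitution sending the variable of index t to that of index f t *)
Definition rename f : {linear S -> S} := rename_fun f.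

Lemma rename_var f t : rename f (var t) = var (f t).
Proof.
by rewrite /rename /= /rename_fun comp_mpolyXU -tnth_nth tnth_mktuple enum_rankK.
Qed.

Lemma renameM f p q : rename f (p * q) = rename f p * rename f q.
Proof. exact: rmorphM. Qed.

Lemma rename_homog f d p : p \is d.-homog for mdeg -> rename f p \is d.-homog for mdeg.
Proof.
move=> /dhomogP hp; rewrite /rename /= /rename_fun comp_mpolyEX big_seq rpred_sum //.
move=> m mp; have <- : (\sum_(k < #|T|) m k)%N = d.
  by rewrite -(hp _ mp); apply/esym/mdegE.
apply: rpredZ; rewrite comp_mpolyX.
elim/big_rec2: _ => [|k e q _ hq]; first exact: dhomog1.
apply: dhomogM => //; rewrite tnth_mktuple -[X in ishomog1 X]mul1n.
by apply: dhomogMn; rewrite dhomogX /= mdeg1.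
Qed.

Lemma rename_pihomog f d p :
  pihomog mdeg d (rename f p) = rename f (pihomog mdeg d p).
Proof.
have hom e : rename f (pihomog mdeg e p) \is e.-homog for mdeg.
  exact/rename_homog/pihomogP.
rewrite [in LHS](pihomog_partitionE (leqnn (msize p))).
rewrite (linear_sum (rename f)) (linear_sum (pihomog mdeg d)).
have [ltd|led] := ltnP d (msize p).
  rewrite (bigD1 (Ordinal ltd)) //= big1 ?addr0; first exact: (pihomog_dE (hom d)).
  move=> e ned; apply: (@pihomog_ne0 _ _ _ e); last exact: hom.
  by apply: contraNneq ned => ed; apply/eqP/val_inj.
rewrite big1 => [|e _]; last first.
  apply: (@pihomog_ne0 _ _ _ e); last exact: hom.
  by apply: contraTneq (ltn_ord e) => ->; rewrite -leqNgt.
rewrite (_ : pihomog mdeg d p = 0) ?linear0 //.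
rewrite pihomogE big_seq_cond big_pred0 // => m; apply/andP=> -[mp /eqP md].
by have := msize_mdeg_lt mp; rewrite md ltnNge led.
Qed.

Lemma rename_msize_le f p : (msize (rename f p) <= msize p)%N.
Proof.
rewrite {1}(pihomog_partitionE (leqnn (msize p))) linear_sum.
apply: leq_trans (mmeasure_sum _ _ _ _) _; apply/bigmax_leqP=> d _.
apply: leq_trans (ltn_ord d); rewrite msizeE; apply/bigmax_leqP_seq=> m mp _.
by rewrite (dhomog_mf (rename_homog f (pihomogP _ d p)) mp).
Qed.

Lemma eq_rename f g p : f =1 g -> rename f p = rename g p.
Proof.
move=> fg; rewrite /rename /= /rename_fun; congr (_ \mPo _).
by apply: eq_from_tnth => k; rewrite !tnth_mktuple fg.
Qed.

Lemma rename_id p : rename id p = p.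
Proof.
rewrite -[RHS]comp_mpoly_id /rename /= /rename_fun; congr (_ \mPo _).
by apply: eq_from_tnth => k; rewrite !tnth_mktuple /var enum_valK.
Qed.

Lemma rename_comp f g p : rename (f \o g) p = rename f (rename g p).
Proof.
have rZ h a q : rename h (a *: q) = a *: rename h q by exact: linearZ.
rewrite (mpolyE p) (linear_sum (rename g)) (linear_sum (rename f)) linear_sum.
apply: eq_bigr => m _; rewrite !rZ; congr (_ *: _).
rewrite /rename /= /rename_fun !comp_mpolyX rmorph_prod /=.
apply: eq_bigr => k _; rewrite rmorphXn /=; congr (_ ^+ _).
by have := rename_var f (g (enum_val k)); rewrite !tnth_mktuple => <-.
Qed.

Lemma renameK f g : cancel f g -> cancel (rename f) (rename g).
Proof.
by move=> fK p; rewrite -rename_comp -[RHS]rename_id; apply: eq_rename.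
Qed.

Lemma rename_top f g p : cancel f g ->
  top_component (rename f p) = rename f (top_component p).
Proof.
move=> fK; rewrite /top_component rename_pihomog.
suff -> : msize (rename f p) = msize p by [].
apply/eqP; rewrite eqn_leq rename_msize_le /=.
by rewrite -{1}(renameK fK p) rename_msize_le.
Qed.

Lemma eval_rename f z p : eval_at z (rename f p) = eval_at [ffun t => z (f t)] p.
Proof.
rewrite /eval_at comp_mpoly_meval; apply: meval_eq => k.
by rewrite tnth_mktuple mevalXU enum_rankK ffunE.
Qed.

Variables (G : finGroupType) (rho : G -> T -> T).
Hypothesis rho1 : forall t, rho 1%g t = t.
Hypothesis rhoM : forall g h t, rho (g * h)%g t = rho g (rho h t).

Definition poly_act g : {linear S -> S} := rename (rho g).
Definition poly_comp d : {linear S -> S} := pihomog mdeg d.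

Fact poly_act1 p : poly_act 1%g p = p.
Proof. by rewrite -[RHS]rename_id; apply: eq_rename. Qed.
Fact poly_actM g h p : poly_act (g * h)%g p = poly_act g (poly_act h p).
Proof. by rewrite -rename_comp; apply: eq_rename => t; apply: rhoM. Qed.
Fact poly_compE d e p : poly_comp d (poly_comp e p) =
  if d == e then poly_comp e p else 0.
Proof.
rewrite /poly_comp /=; case: eqP => [->|/eqP de]; first exact: pihomog_id.
by apply: (@pihomog_ne0 _ _ _ e); rewrite ?pihomogP // eq_sym.
Qed.
Fact poly_comp_sum p : exists n, p = \sum_(d < n) poly_comp d p.
Proof. by exists (msize p); apply: pihomog_partitionE. Qed.
Fact poly_comp_act d g p : poly_comp d (poly_act g p) = poly_act g (poly_comp d p).
Proof. exact: rename_pihomog. Qed.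

Definition gpoly : gradedModule K G :=
  GradedModule poly_act1 poly_actM poly_compE poly_comp_sum poly_comp_act.

Hypothesis Z_stable : forall g (z : {ffun T -> K}),
  z \in Z -> [ffun t => z (rho g t)] \in Z.

Fact gr_ideal_act g (p : gpoly) : p \in gr_ideal -> gact gpoly g p \in gr_ideal.
Proof.
case/asboolP=> n [a [q [top_q ->]]]; rewrite linear_sum rpred_sum // => i _.
rewrite [gact _ _ _]renameM; apply: gr_ideal_gen.
have [r [nz_r Zr ->]] := top_q i.
have rhoK : cancel (rho g) (rho g^-1%g) by move=> t; rewrite -rhoM mulVg rho1.
exists (rename (rho g) r); split; last by rewrite (rename_top _ rhoK).
  by apply: contraNneq nz_r => r0; rewrite -(renameK rhoK r) r0 linear0.
by move=> z Zz; rewrite eval_rename Zr ?Z_stable.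
Qed.

Fact gr_ideal_comp d (p : gpoly) : p \in gr_ideal -> gcomp gpoly d p \in gr_ideal.
Proof.
case/asboolP=> n [a [q [top_q ->]]]; rewrite linear_sum rpred_sum // => i _ /=.
rewrite /poly_comp [a i](pihomog_partitionE (leqnn (msize (a i)))).
rewrite mulr_suml linear_sum rpred_sum // => e _ /=.
have [r [_ _ qE]] := top_q i.
have hom : pihomog mdeg e (a i) * q i \is (e + (msize r).-1).-homog for mdeg.
  by rewrite qE; apply: dhomogM; apply: pihomogP.
have [de|nde] := eqVneq (e + (msize r).-1)%N d.
  by rewrite -de pihomog_dE //; apply: gr_ideal_gen.
by rewrite (pihomog_ne0 nde hom) rpred0.
Qed.

(* R(Z) = S / gr I(Z), kept as a graded representation only: {ideal_quot _}
   does not apply, since gr I(Z) is all of S when Z is empty. *)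
Definition orbit_harmonics : gradedModule K G :=
  gquot (V := gpoly) gr_ideal_submod_closed gr_ideal_act gr_ideal_comp.

End OrbitHarmonics.

Section Loci.
Variables (K : fieldType) (I : finType).
Implicit Types (M : {set signed_subset I}) (X : signed_subset I).

Definition zpoint X : {ffun I * sign -> K} := [ffun t => (X t.1 == t.2)%:R].
Definition ypoint X : {ffun I * bool -> K} := [ffun t => (X t.1 == Some t.2)%:R].

Lemma zpointE X t : zpoint X t = (X t.1 == t.2)%:R.
Proof. exact: ffunE. Qed.
Lemma ypointE X t : ypoint X t = (X t.1 == Some t.2)%:R.
Proof. exact: ffunE. Qed.

Definition big_locus M : {fset {ffun I * sign -> K}} :=
  [fset zpoint X | X in M]%fset.
Definition small_locus M : {fset {ffun I * bool -> K}} :=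
  [fset ypoint X | X in topes M]%fset.

End Loci.

Section BigLocusModule.
Variables (K : fieldType) (I : finType) (M : {set signed_subset I}).
Local Notation G := (subg_of (sAut_group M)).

(* y_i^s |-> y_(sigma i)^(eps_i s), z_i |-> z_(sigma i) *)
Definition big_var_act (w : G) (t : I * sign) : I * sign :=
  ((sgval w).1 t.1, sign_mul ((sgval w).2 t.1) t.2).

Fact big_var_act1 t : big_var_act 1%g t = t.
Proof.
by case: t => i [s|]; rewrite /big_var_act /= perm1 // ffunE.
Qed.
Fact big_var_actM v w t :
  big_var_act (v * w)%g t = big_var_act v (big_var_act w t).
Proof.
by case: t => i [s|]; rewrite /big_var_act /= permM // ffunE addbA.
Qed.

Fact big_locus_stable (w : G) (z : {ffun I * sign -> K}) :
  z \in big_locus K M -> [ffun t => z (big_var_act w t)] \in big_locus K M.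
Proof.
case/imfsetP=> X /= MX ->; apply/imfsetP.
have [Y MY ->] : exists2 Y, Y \in M & X = sp_act (sgval w) Y.
  exists (sp_act (sgval w)^-1%g X); last by rewrite -sp_actM mulgV sp_act1.
  by have /groupVr/sAutP := subgP w; apply.
exists Y => //; apply/ffunP=> -[i s]; rewrite [LHS]ffunE !zpointE /=.
congr (nat_of_bool _)%:R; rewrite sp_actE; case: (Y i) s => [a|] [b|] //=.
by apply/eqP/eqP => [[/addbI ->]|[->]].
Qed.

Definition RZ : gradedModule K G :=
  orbit_harmonics (Z := big_locus K M) big_var_act1 big_var_actM
    big_locus_stable.

End BigLocusModule.

Section SmallLocusModule.
Variables (K : fieldType) (I : finType) (M : {set signed_subset I}).
Variable F : {set I}.
Local Notation G := (subg_of (sAut_stab_group M F)).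
Local Notation J := {i | i \notin F}.

Lemma sAut_stab_notin (w : G) (i : I) : ((sgval w).1 i \notin F) = (i \notin F).
Proof.
have /setIdP[_ /eqP wF] := subgP w.
by have := mem_imset F i (@perm_inj _ (sgval w).1); rewrite wF => ->.
Qed.

Definition compl_act (w : G) (j : J) : J :=
  exist _ ((sgval w).1 (val j)) (etrans (sAut_stab_notin w (val j)) (valP j)).

(* y_i^s |-> y_(sigma i)^(eps_i s) for i outside F *)
Definition small_var_act (w : G) (t : J * bool) : J * bool :=
  (compl_act w t.1, (sgval w).2 (val t.1) (+) t.2).

Fact small_var_act1 t : small_var_act 1%g t = t.
Proof.
case: t => j s; congr pair; last by rewrite /= ffunE.
by apply: val_inj; rewrite /= perm1.
Qed.
Fact small_var_actM v w t :
  small_var_act (v * w)%g t = small_var_act v (small_var_act w t).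
Proof.
case: t => j s; congr pair; last by rewrite /= ffunE addbA.
by apply: val_inj; rewrite /= permM.
Qed.

Fact small_locus_stable (w : G) (z : {ffun J * bool -> K}) :
  z \in small_locus K (contraction M F) ->
  [ffun t => z (small_var_act w t)] \in small_locus K (contraction M F).
Proof.
case/imfsetP=> _ /= /setIdP[/imsetP[X /setIdP[MX FX] ->] /forallP nzX] ->.
apply/imfsetP.
have [Y [MY FY XE]] : exists Y,
    [/\ Y \in M, F \subset Flat Y & X = sp_act (sgval w) Y].
  have /groupVr := subgP w; set w' := (_^-1)%g => /setIdP[/sAutP Aw /eqP Fw].
  exists (sp_act w' X); split; first exact: Aw.
    apply/subsetP=> i; rewrite -Fw => /imsetP[k Fk ->]; rewrite inE sp_actE.
    by move/subsetP/(_ k Fk): FX; rewrite inE => /eqP ->.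
  by rewrite -sp_actM mulgV sp_act1.
exists (restrict F Y) => /=.
  rewrite inE; apply/andP; split.
    by apply/imsetP; exists Y => //; rewrite inE MY.
  apply/forallP=> j; have := nzX (compl_act w j).
  by rewrite !restrictE XE sp_actE; case: (Y (val j)).
apply/ffunP=> -[j s]; rewrite [LHS]ffunE !ypointE !restrictE /=.
congr (nat_of_bool _)%:R; rewrite XE sp_actE; case: (Y (val j)) => [a|] //=.
by apply/eqP/eqP => [[/addbI ->]|[->]].
Qed.

Definition RY : gradedModule K G :=
  orbit_harmonics (Z := small_locus K (contraction M F)) small_var_act1
    small_var_actM small_locus_stable.

End SmallLocusModule.

(* Main.v *)
From HB Require Import structures.
From mathcomp Require Import all_boot all_order all_fingroup all_algebra.
From mathcomp Require Import generic_quotient ring_quotient finmap boolp.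
From mathcomp Require Import mpoly.
Require Import Defs.


(** In degree d, the quotient R(Z) of the big locus Z consists of the functions on
    covectors that are polynomials of degree at most d, modulo those of smaller
    degree. For a flat G, the product z_G of the zero coordinates over a basic set
    of G has degree codim G, and as a function on covectors it is the indicator of
    those whose flat contains G. So every polynomial function is a sum over flats
    of z_G times a polynomial in the sign coordinates outside G, and filtering by
    the codimension of G one expects the graded pieces to be the quotients of the
    small loci of the contractions, with degrees shifted by the codimension.

    The point is that degrees are controlled: a function of degree at most d that
    vanishes on all covectors of codimension less than k is a sum, over flats G of
    codimension at least k, of z_G times functions of degree at most d - codim G
    (normal_coeffs). To see this, call a set C nbc for G when no broken circuit of
    the contraction by G occurs in it, and let y_C be the product over C of the
    coordinates of sign plus. The products z_G y_C with C nbc for G span without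
    raising degrees (cube_normal_flat, cube_normal, poly_normal), because a
    circuit, or a set without common zero, forbids a sign pattern
    (circuit_pattern, zero_of_all_patterns), and the vanishing of the
    corresponding product of sign conditions is a straightening relation. For a
    fixed G the y_C are linearly independent on the covectors with flat G
    (nbc_independent); hence normal forms are unique, and a vanishing condition
    kills their coefficients from small flats upwards (normal_support).

    As for the group, let P be the sum, over representatives F of the orbits of
    flats, of the functions from the automorphism group to the polynomials of the
    contraction by F. It maps onto the sum of induced modules, and also onto R(Z),
    by multiplying with z_F and translating. Both maps are equivariant and
    graded, and normal_coeffs implies that each kernel is contained in the other
    one up to elements of larger codimension (ker_to_sum, ker_to_big). The small
    quotients have graded linear sections given by the nbc sets (piY_section).
    Since the order of the group is invertible, such sections can be averaged, and
    an averaged section followed by the map onto R(Z) is an isomorphism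
    (graded_iso_of_presentation). *)

Set Implicit Arguments.
Unset Strict Implicit.
Unset Printing Implicit Defensive.

Import GRing.Theory.
Local Open Scope ring_scope.

(** * Closure, exchange and codimension *)

Section Closure.
Variables (I : finType) (M : {set signed_subset I}).
Hypothesis comM : cond_oriented_matroid M.
Implicit Types (X Y Z W : signed_subset I) (A B C D F G : {set I}) (i j : I).

Lemma FlatP A X : reflect (forall i, i \in A -> X i = None) (A \subset Flat X).
Proof.
apply: (iffP subsetP) => [sAX i /sAX|AX i /AX Xi]; last by rewrite inE Xi.
by rewrite inE => /eqP.
Qed.

Lemma scomp_zero A X Y :
  A \subset Flat X -> A \subset Flat Y -> A \subset Flat (scomp X Y).
Proof. by move=> /FlatP AX /FlatP AY; apply/FlatP=> i Ai; rewrite ffunE AX ?AY. Qed.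

Lemma sopp_zero A X : A \subset Flat X -> A \subset Flat (sopp X).
Proof. by move=> /FlatP AX; apply/FlatP=> i Ai; rewrite ffunE AX. Qed.

(** Face symmetry applied twice: the sign of the second factor flips back. *)
Lemma scomp_in X Y : X \in M -> Y \in M -> scomp X Y \in M.
Proof.
move=> MX MY; have [sym _] := comM; have := sym _ _ MX (sym _ _ MX MY).
congr (_ \in M); apply/ffunP=> i; rewrite !ffunE.
by case: (X i) (Y i) => [[]|] // [[]|].
Qed.

Lemma scompN_in X Y : X \in M -> Y \in M -> scomp X (sopp Y) \in M.
Proof. by case: comM => sym _; apply: sym. Qed.

(** Composition keeps the nonzero signs of its first factor, so covectors that
    each avoid one zero compose to a covector avoiding all of them. *)
Lemma common_nonzero A D W : W \in M -> A \subset Flat W ->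
    (forall j, j \in D -> exists X, [/\ X \in M, A \subset Flat X & X j != None]) ->
  exists X, [/\ X \in M, A \subset Flat X & forall j, j \in D -> X j != None].
Proof.
move=> MW AW hD.
suff: forall s : seq I, {subset s <= D} -> exists X,
    [/\ X \in M, A \subset Flat X & forall j, j \in s -> X j != None].
  case/(_ (enum D)) => [j|X [MX AX nzX]]; first by rewrite mem_enum.
  by exists X; split=> // j Dj; apply: nzX; rewrite mem_enum.
elim=> [|j s IHs] sD; first by exists W.
have [|X [MX AX nzX]] := IHs; first by move=> k sk; rewrite sD // inE sk orbT.
have [|Y [MY AY nzY]] := hD j; first by rewrite sD ?mem_head.
exists (scomp X Y); split; [exact: scomp_in | exact: scomp_zero |] => k.
rewrite inE ffunE; case: ifP => [/eqP Xk|/negbT //].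
by case/predU1P=> [-> // | /nzX]; rewrite Xk.
Qed.

Definition cl A : {set I} :=
  [set i | [forall X in M, (A \subset Flat X) ==> (X i == None)]].

Lemma clP A i :
  reflect (forall X, X \in M -> A \subset Flat X -> X i = None) (i \in cl A).
Proof.
rewrite inE; apply: (iffP forall_inP) => [h X MX AX|h X MX].
  by have /implyP/(_ AX)/eqP := h X MX.
by apply/implyP=> AX; rewrite h.
Qed.

Lemma clPn A i :
  reflect (exists X, [/\ X \in M, A \subset Flat X & X i != None]) (i \notin cl A).
Proof.
rewrite inE negb_forall_in; apply: (iffP exists_inP) => [[X MX]|[X [MX AX Xi]]].
  by rewrite negb_imply => /andP[AX Xi]; exists X.
by exists X => //; rewrite negb_imply AX.
Qed.

Lemma sub_cl A : A \subset cl A.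
Proof. by apply/subsetP=> i Ai; apply/clP=> X _ /FlatP; apply. Qed.

Lemma cl_min A X : X \in M -> A \subset Flat X -> cl A \subset Flat X.
Proof. by move=> MX AX; apply/FlatP=> i /clP; apply. Qed.

Lemma clS A B : A \subset B -> cl A \subset cl B.
Proof.
move=> sAB; apply/subsetP=> i /clP h; apply/clP=> X MX BX.
by apply: h => //; apply: subset_trans BX.
Qed.

Lemma cl_cl_sub A B : A \subset cl B -> cl A \subset cl B.
Proof.
move=> sAB; apply/subsetP=> i /clP h; apply/clP=> X MX BX.
by apply: h => //; apply: subset_trans sAB (cl_min _ _).
Qed.

Lemma cl_is_flat A W : W \in M -> A \subset Flat W -> cl A \in flats M.
Proof.
move=> MW AW; have [|X [MX AX nzX]] := @common_nonzero A (~: cl A) W MW AW.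
  by move=> j; rewrite inE => /clPn.
apply/imsetP; exists X => //; apply/eqP; rewrite eqEsubset cl_min //=.
by apply/subsetP=> i; rewrite inE => Xi; apply: contraLR Xi => nAi; rewrite nzX // inE.
Qed.

Lemma cl_flat F : F \in flats M -> cl F = F.
Proof.
by case/imsetP=> X MX ->; apply/eqP; rewrite eqEsubset sub_cl cl_min.
Qed.

Lemma cl_sub_flat A F : F \in flats M -> A \subset F -> cl A \subset F.
Proof. by case/imsetP=> X MX ->; apply: cl_min. Qed.

Lemma flat_covector F : F \in flats M -> exists2 W, W \in M & F = Flat W.
Proof. by case/imsetP=> W; exists W. Qed.


(** If Y vanished on j |: A but not at i, one of the compositions of W with Y and
    with the opposite of Y would have at i the sign opposite to that of X;
    eliminating i between X and that covector keeps the nonzero sign of X at j and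
    the zeros on A, which is absurd. *)
Lemma exchange A i j W : W \in M -> i |: A \subset Flat W ->
  j \in cl (i |: A) -> j \notin cl A -> i \in cl (j |: A).
Proof.
move=> MW iAW /clP clj /clPn[X [MX AX Xj]]; apply/clP=> Y MY jAY.
apply/eqP/contraT=> Yi.
have Xi : X i != None.
  apply: contra Xj => /eqP Xi; apply/eqP/clj => //.
  by apply/FlatP=> k /setU1P[->|] //; move/FlatP: AX; apply.
have /FlatP Yz := jAY; have /FlatP Wz := iAW; have /FlatP Xz := AX.
have Wi : W i = None by apply: Wz; rewrite setU11.
have Wj : W j = None by apply: clj.
have [Y' [MY' Y'i Y'j Y'A]] : exists Y', [/\ Y' \in M, i \in Sep X Y', Y' j = None &
    forall k, k \in A -> Y' k = None].
  have [Xe|Xne] := eqVneq (X i) (Y i).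
    exists (scomp W (sopp Y)); rewrite scompN_in //; split=> //.
    - by rewrite inE !ffunE Wi /= Xi andbT Xe; case: (Y i) => [[]|].
    - by rewrite !ffunE Wj Yz ?setU11.
    - by move=> k Ak; rewrite !ffunE Wz ?Yz ?setU1r.
  exists (scomp W Y); rewrite scomp_in //; split=> //.
  - rewrite inE !ffunE Wi /= Xi andbT.
    by case: (X i) (Y i) Xi Yi Xne => [[]|] // [[]|].
  - by rewrite !ffunE Wj Yz ?setU11.
  - by move=> k Ak; rewrite !ffunE Wz ?Yz ?setU1r.
have [_ elim] := comM; have [Z [MZ Zi Zo]] := elim _ _ _ MX MY' Y'i.
have nsep k : Y' k = None -> k \notin Sep X Y'.
  by move=> Y'k; rewrite inE ffunE Y'k /=; case: (X k).
have := Zo j (nsep j Y'j); rewrite ffunE (negPf Xj) clj.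
- by move=> h; rewrite -h in Xj.
- by [].
apply/FlatP=> k /setU1P[->//|Ak].
by rewrite Zo ?nsep ?Y'A // ffunE Xz // Y'A.
Qed.

Definition indep A := [forall a in A, a \notin cl (A :\ a)].

Lemma indepP A : reflect (forall a, a \in A -> a \notin cl (A :\ a)) (indep A).
Proof. exact: forall_inP. Qed.

Lemma indepS A B : A \subset B -> indep B -> indep A.
Proof.
move=> sAB /indepP iB; apply/indepP=> a Aa.
by apply: contra (iB a (subsetP sAB a Aa)); apply/subsetP/clS/setSD.
Qed.

Lemma indepU1 A b F : F \in flats M -> b |: A \subset F ->
  indep A -> b \notin cl A -> indep (b |: A).
Proof.
move=> flF sF /indepP iA nb; apply/indepP=> a.
have nAb : b \notin A by apply: contra nb => /(subsetP (sub_cl A)).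
case/setU1P=> [->|Aa]; first by rewrite setU1K.
apply: contra nb => cla.
have ab : b != a by apply: contraNneq nAb => ->.
have E : (b |: A) :\ a = b |: (A :\ a).
  by rewrite setDUl; congr (_ :|: _); apply/setDidPl; rewrite disjoints1 inE.
have [W MW FW] := flat_covector flF.
have := @exchange (A :\ a) b a W MW; rewrite -E setD1K // => -> //.
  by rewrite -FW; apply: subset_trans sF; apply: subsetDl.
exact: iA.
Qed.

(** Steinitz: elements of A outside B are replaced one at a time by elements of
    the spanning set B. *)
Lemma indep_card A B F : F \in flats M -> A \subset F -> indep A ->
  B \subset F -> cl B = F -> (#|A| <= #|B|)%N.
Proof.
move=> flF sAF iA sBF clB; have [n] := ubnP #|A :\: B|.
elim: n A sAF iA => // n IHn A sAF iA ltn.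
have [sAB|/subsetPn[a Aa nBa]] := boolP (A \subset B); first exact: subset_leq_card.
have nla : a \notin cl (A :\ a) by apply: (indepP _ iA).
have [b Bb nlb] : exists2 b, b \in B & b \notin cl (A :\ a).
  apply/subsetPn; apply: contra nla => sB.
  by apply: (subsetP (cl_cl_sub sB)); rewrite clB (subsetP sAF).
have sF' : b |: A :\ a \subset F.
  apply/subsetP=> i /setU1P[->|/setD1P[_ /(subsetP sAF)] //].
  exact: (subsetP sBF).
have nAab : b \notin A :\ a by apply: contra nlb => /(subsetP (sub_cl _)).
have <- : #|b |: A :\ a| = #|A| by rewrite cardsU1 nAab (cardsD1 a A) Aa.
apply: IHn => //.
  by apply: indepU1 flF sF' _ nlb; apply: indepS (subsetDl _ _) iA.
rewrite -ltnS; apply: leq_trans ltn; rewrite ltnS; apply: proper_card.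
apply/properP; split.
  by apply/subsetP=> i /setDP[/setU1P[->|/setD1P[_ Ai]] nBi];
    [rewrite Bb in nBi | rewrite inE Ai nBi].
exists a; first by rewrite inE Aa nBa.
rewrite !inE eqxx /= orbF negb_and; apply/orP; right.
by apply: contraNneq nBa => ->.
Qed.

Lemma is_closureP C F : F \in flats M -> C \subset F ->
  is_closure M C F = (cl C == F).
Proof.
move=> flF sCF; have [W MW FW] := flat_covector flF.
have flC : cl C \in flats M by apply: (cl_is_flat MW); rewrite -FW.
apply/minsetP/eqP => [[_ minF]|<-].
  by apply: minF; rewrite ?flC ?sub_cl ?cl_sub_flat.
split=> [|G /andP[flG sCG] sG]; first by rewrite flC sub_cl.
by apply/eqP; rewrite eqEsubset sG cl_sub_flat.
Qed.

(** An element in the closure of the others could be dropped, against the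
    minimality of B. *)
Lemma basicP F B : F \in flats M -> basic M F B ->
  [/\ B \subset F, cl B = F & indep B].
Proof.
move=> flF /andP[sBF /minsetP[clB minB]]; split=> //.
  by apply/eqP; rewrite -is_closureP.
move: (clB); rewrite is_closureP // => /eqP clBF.
apply/indepP=> b Bb; apply/negP=> clb.
have sF : B :\ b \subset F by apply: subset_trans (subsetDl _ _) sBF.
have /(minB _)/(_ (subsetDl _ _)) E : is_closure M (B :\ b) F.
  have sB : B \subset cl (B :\ b).
    by apply/subsetP=> i Bi; have [->//|ne] := eqVneq i b;
       apply: (subsetP (sub_cl _)); rewrite !inE ne.
  by rewrite is_closureP // eqEsubset cl_sub_flat //= -{1}clBF cl_cl_sub.
by have := setD11 b B; rewrite E Bb.
Qed.

Lemma basic_sub C F : F \in flats M -> C \subset F -> cl C = F ->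
  exists2 B, basic M F B & B \subset C.
Proof.
move=> flF sCF clC; have [|B minB sBC] := @minset_exists _ (fun A => is_closure M A F) C.
  by rewrite is_closureP ?clC.
by exists B => //; apply/andP; split=> //; apply: subset_trans sBC sCF.
Qed.

(** The basic set whose cardinality is codim M F, so that the degree of the
    product of the zero coordinates over it is the codimension. *)
Definition zbasis F : {set I} := odflt set0 [pick B | basic M F B].

Lemma zbasis_basic F : F \in flats M -> basic M F (zbasis F).
Proof.
move=> flF; have [B bB _] := basic_sub flF (subxx F) (cl_flat flF).
by rewrite /zbasis; case: pickP => [//|/(_ B)]; rewrite bB.
Qed.

Lemma codim_indep A F : F \in flats M -> A \subset F -> indep A -> (#|A| <= codim M F)%N.
Proof.
move=> flF sAF iA; have [sB clB _] := basicP flF (zbasis_basic flF).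
exact: indep_card flF sAF iA sB clB.
Qed.

Lemma codim_span C F : F \in flats M -> C \subset F -> cl C = F -> (codim M F <= #|C|)%N.
Proof.
move=> flF sCF clC; have [sB _ iB] := basicP flF (zbasis_basic flF).
exact: indep_card flF sB iB sCF clC.
Qed.

Lemma codim_proper F G : F \in flats M -> G \in flats M -> F \proper G ->
  (codim M F < codim M G)%N.
Proof.
move=> flF flG /properP[sFG [i Gi nFi]].
have [sB clB iB] := basicP flF (zbasis_basic flF).
have nBi : i \notin zbasis F by apply: contra nFi => /(subsetP sB).
have sG : i |: zbasis F \subset G by rewrite subUset sub1set Gi (subset_trans sB).
have := @codim_indep (i |: zbasis F) G flG sG.
by rewrite cardsU1 nBi add1n; apply; apply: indepU1 flG sG iB _; rewrite clB.
Qed.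

Lemma codim_mono F G : F \in flats M -> G \in flats M -> F \subset G ->
  (codim M F <= codim M G)%N.
Proof.
move=> flF flG; rewrite subEproper => /predU1P[-> //|/codim_proper-/(_ flF flG)].
exact: ltnW.
Qed.

Lemma zbasis_sub F X : F \in flats M -> X \in M ->
  (zbasis F \subset Flat X) = (F \subset Flat X).
Proof.
move=> flF MX; have [sB clB _] := basicP flF (zbasis_basic flF).
apply/idP/idP => [sBX|]; last exact: subset_trans sB.
by have := cl_min MX sBX; rewrite clB.
Qed.

End Closure.

(** * Forbidden sign patterns *)

Section Patterns.
Variables (I : finType) (M : {set signed_subset I}).
Hypothesis comM : cond_oriented_matroid M.
Implicit Types (X Y Z W : signed_subset I) (A B C D F G : {set I}) (i j : I).

(** Two covectors that differ only in the sign at i eliminate to one vanishing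
    at i, so zeros can be created one element at a time. *)
Lemma zero_of_all_patterns G A :
    (forall s : I -> bool, exists X,
      [/\ X \in M, G \subset Flat X & forall i, i \in A -> X i = Some (s i)]) ->
  exists2 X, X \in M & G :|: A \subset Flat X.
Proof.
move=> hA; suff: forall n B, B \subset A -> #|A :\: B| = n -> forall s : I -> bool,
    exists X, [/\ X \in M, G \subset Flat X, forall i, i \in B -> X i = Some (s i) &
                  forall i, i \in A :\: B -> X i = None].
  case/(_ #|A| set0 (sub0set _) _ (fun=> true)) => [|X [MX GX _ AX]]; first by rewrite setD0.
  by exists X; rewrite // subUset GX /=; apply/FlatP=> i Ai; apply: AX; rewrite setD0.
elim=> [|n IHn] B sBA cB s.
  have sAB : A \subset B by rewrite -setD_eq0 -cards_eq0 cB.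
  have [X [MX GX AX]] := hA s; exists X; split=> // i; last first.
    by rewrite inE => /andP[/negP-nBi /(subsetP sAB)].
  by move/(subsetP sBA)/AX.
have [i ABi] : exists i, i \in A :\: B by apply/card_gt0P; rewrite cB.
have /setDP[Ai nBi] := ABi.
have sB' : i |: B \subset A by rewrite subUset sub1set Ai.
have cB' : #|A :\: (i |: B)| = n.
  by move: cB; rewrite setUC -setDDl (cardsD1 i) ABi => -[].
have ext (b : bool) := IHn _ sB' cB' (fun k => if k == i then b else s k).
have [X [MX GX BX AX]] := ext true; have [Y [MY GY BY AY]] := ext false.
have Xi : X i = Some true by rewrite BX ?setU11 ?eqxx.
have Yi : Y i = Some false by rewrite BY ?setU11 ?eqxx.
have [_ elim] := comM; have [|Z [MZ Zi ZE]] := elim X Y i MX MY.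
  by rewrite inE ffunE Xi Yi.
have ZX k : X k = Y k -> Z k = X k.
  by move=> e; rewrite ZE ?inE ffunE -e; case: (X k) => [[]|].
exists Z; split=> //.
- by apply/FlatP=> k Gk; rewrite ZX (FlatP _ _ GX) ?(FlatP _ _ GY).
- move=> k Bk; have ki : k != i by apply: contraNneq nBi => <-.
  by rewrite ZX BX ?BY ?setU1r // (negPf ki).
move=> k /setDP[Ak nBk]; have [->//|ki] := eqVneq k i.
have kAB : k \in A :\: (i |: B) by rewrite !inE negb_or ki nBk.
by rewrite ZX AX ?AY.
Qed.

(** A minimal set A forcing a zero at j, in the presence of a common zero W of
    G :|: A, is a signed circuit together with j: some sign pattern on j |: A is
    compatible with no covector other than those vanishing on it. For a in A the
    sign of a is that of a covector vanishing on A :\ a and positive at j, while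
    j itself gets the opposite sign; eliminating the elements of A one by one
    with such covectors would otherwise isolate a nonzero sign at j. *)
Lemma circuit_pattern G A j W : W \in M -> G :|: A \subset Flat W ->
    j \notin A -> j \in cl M (G :|: A) ->
    (forall a, a \in A -> j \notin cl M (G :|: (A :\ a))) ->
  exists s : I -> bool, forall X, X \in M -> G \subset Flat X ->
    (forall i, i \in j |: A -> X i != Some (~~ s i)) ->
    forall i, i \in j |: A -> X i = None.
Proof.
move=> MW /FlatP GAW nAj /clP clj minA.
have Wj : W j = None by apply: clj => //; apply/FlatP.
pose E a b := exists Y, [/\ Y \in M, G :|: (A :\ a) \subset Flat Y,
                           Y j = Some false & Y a = Some b].
have exE a : a \in A -> exists b, E a b.
  move=> Aa; have /clPn[Y [MY AY Yj]] := minA a Aa.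
  have Ya : Y a != None.
    apply: contra Yj => /eqP Ya; apply/eqP/clj => //; apply/FlatP=> i.
    have [->//|ia] := eqVneq i a.
    by rewrite inE => Ai; move/FlatP: AY => -> //; rewrite !inE ia.
  have WA i : i \in G :|: (A :\ a) -> W i = None.
    move=> Ai; apply: GAW; move: Ai.
    by rewrite !inE => /orP[->|/andP[_ ->]] //; rewrite orbT.
  have Wa : W a = None by apply: GAW; rewrite inE Aa orbT.
  case Yj': (Y j) Yj => [[]|] // _.
    (* The opposite of Y need not be a covector, but its composition with W is. *)
    exists (if Y a is Some true then false else true), (scomp W (sopp Y)); split.
    - exact: scompN_in.
    - apply: scomp_zero; last exact: sopp_zero.
      exact/FlatP.
    - by rewrite !ffunE Wj Yj'.
    - by rewrite !ffunE Wa; case: (Y a) Ya => [[]|].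
  exists (if Y a is Some true then true else false), Y; split=> //.
  by case: (Y a) Ya => [[]|].
pose s i := if i == j then false else `[< ~ E i true >].
have sE a : a \in A -> E a (~~ s a).
  move=> Aa; rewrite /s; have [aj|_] := eqVneq a j; first by rewrite aj (negPf nAj) in Aa.
  case: asboolP => [nE|/contrapT //]; have [[] //] := exE a Aa.
exists s => X MX GX; have [n] := ubnP #|[set a in A | X a != None]|.
elim: n X MX GX => // n IHn X MX GX ltn Xs.
have [A0|[a /setIdP[Aa Xa]]] := set_0Vmem [set a in A | X a != None].
  have AX i : i \in A -> X i = None.
    by move=> Ai; apply/eqP; apply: contraFT (in_set0 i) => Xi; rewrite -A0 inE Ai.
  move=> i /setU1P[->|//]; last exact: AX.
  by apply: clj => //; apply/FlatP=> k /setUP[/(FlatP _ _ GX)|/AX].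
have [Y [MY /FlatP GAY Yj Ya]] := sE a Aa.
have Xa' : X a = Some (s a).
  by have := Xs a; rewrite setU1r // => /(_ isT); case: (X a) (s a) Xa => [[]|] [].
have Xj : X j != Some true by have := Xs j (setU11 _ _); rewrite /s eqxx.
have [_ elim] := comM; have [|Z [MZ Za ZE]] := elim X Y a MX MY.
  by rewrite inE ffunE Xa' Ya /= negbK eqxx.
have Zj : Z j = Some false.
  by rewrite ZE ?inE ffunE Yj; case: (X j) Xj => [[]|].
have ZX k : Y k = None -> Z k = X k.
  by move=> e; rewrite ZE ?inE ffunE e; case: (X k) => [[]|].
(* Z vanishes at a and is still compatible with s, hence Z j = None by induction,
   although Y brought the sign at j into Z. *)
suff: Z j = None by rewrite Zj.
have YA k : k \in A -> k != a -> Y k = None.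
  by move=> Ak ka; apply: GAY; rewrite !inE ka Ak orbT.
apply: (IHn Z) => //; last exact: setU11.
- by apply/FlatP=> k Gk; rewrite ZX ?(FlatP _ _ GX) // GAY // inE Gk.
- rewrite -ltnS; apply: leq_trans ltn; rewrite ltnS; apply: proper_card.
  apply/properP; split; last by exists a; rewrite !inE ?Aa ?Xa // Za.
  apply/subsetP=> k; rewrite !inE => /andP[Ak Zk]; rewrite Ak /=.
  have [ka|ka] := eqVneq k a; first by rewrite ka.
  by rewrite -ZX // YA.
- move=> i /setU1P[->|Ai]; first by rewrite Zj /s eqxx.
  have [->|ia] := eqVneq i a; first by rewrite Za.
  by rewrite ZX ?YA // Xs // setU1r.
Qed.

End Patterns.

Lemma sum_sign_subsets (R : pzRingType) (T : finType) (V : {set T}) :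
  \sum_(D : {set T} | D \subset V) (-1) ^+ #|D| = (V == set0)%:R :> R.
Proof.
have [->|[u Vu]] := set_0Vmem V.
  rewrite eqxx (bigD1 set0) ?sub0set //= cards0 big1 ?addr0 // => D.
  by rewrite subset0 => /andP[->].
rewrite (_ : (V == set0) = false); last by apply/set0Pn; exists u.
rewrite (bigID (fun D : {set T} => u \in D)) /=.
rewrite (reindex_onto (fun D : {set T} => u |: D) (fun D => D :\ u)) /=; last first.
  by move=> D /andP[_ uD]; rewrite setD1K.
rewrite (eq_bigl (fun D : {set T} => (D \subset V) && (u \notin D))); last first.
  move=> D; rewrite subUset sub1set Vu setU11 /= andbT; congr (_ && _).
  apply/eqP/idP => [<-|nD]; first by rewrite !inE eqxx.
  by rewrite setU1K.
rewrite -big_split big1 //= => D /andP[_ nD].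
by rewrite cardsU1 nD exprS mulN1r addNr.
Qed.

(** * Normal forms of functions on covectors *)

Lemma disjointsU (T : finType) (A B C : {set T}) :
  [disjoint A :|: B & C] = [disjoint A & C] && [disjoint B & C].
Proof. by rewrite !disjoints_subset subUset. Qed.

Section NormalForms.
Variables (K : fieldType) (I : finType) (M : {set signed_subset I}).
Hypothesis comM : cond_oriented_matroid M.
Implicit Types (X Y Z W : signed_subset I) (A B C D F G P N : {set I}) (i j : I).
Implicit Types (u v : signed_subset I -> K) (d : nat).

Definition Pos X : {set I} := [set i | X i == Some true].
Definition Neg X : {set I} := [set i | X i == Some false].

Definition precedes (i j : I) : bool := (enum_rank i < enum_rank j)%N.

(** No-broken-circuit sets of the contraction by G, phrased through covectors:
    the tail of C starting at any of its elements b spans, together with G,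
    nothing new before b. *)
Definition nbc G C : bool :=
  [disjoint C & G] &&
  [forall b in C, [exists X in M,
     (G :|: [set c in C | ~~ precedes c b] \subset Flat X) &&
     [forall j, (j \notin G) && precedes j b ==> (X j != None)]]].

Definition mon G C X : K := ((G \subset Flat X) && (C \subset Pos X))%:R.

(** Sums of nbc monomials, each attached to a flat G and multiplied by the
    indicator of G, whose degree is the codimension of G. The bound d on the total
    degree is strict, so that normal_form 0 v forces v = 0 on M. *)
Definition normal_form d v : Prop := exists c : {set I} -> {set I} -> K,
  (forall G C, c G C != 0 -> [/\ G \in flats M, nbc G C & (codim M G + #|C| < d)%N]) /\
  forall X, X \in M -> v X = \sum_G \sum_C c G C * mon G C X.

Lemma eq_normal d u v : (forall X, X \in M -> u X = v X) -> normal_form d u -> normal_form d v.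
Proof. by move=> uv [c [hc cE]]; exists c; split=> // X MX; rewrite -uv // cE. Qed.

Lemma normal0 d : normal_form d (fun=> 0).
Proof.
exists (fun _ _ => 0); split=> [G C|X _]; first by rewrite eqxx.
by rewrite big1 // => G _; rewrite big1 // => C _; rewrite mul0r.
Qed.

Lemma normalD d u v : normal_form d u -> normal_form d v -> normal_form d (fun X => u X + v X).
Proof.
move=> [b [hb bE]] [c [hc cE]]; exists (fun G C => b G C + c G C); split=> [G C|X MX].
  have [->|/hb //] := eqVneq (b G C) 0; rewrite add0r; exact: hc.
rewrite bE // cE // -big_split; apply: eq_bigr => G _.
by rewrite -big_split; apply: eq_bigr => C _; rewrite mulrDl.
Qed.

Lemma normalZ d a v : normal_form d v -> normal_form d (fun X => a * v X).
Proof.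
move=> [c [hc cE]]; exists (fun G C => a * c G C); split=> [G C|X MX].
  by rewrite mulf_eq0 negb_or => /andP[_ /hc].
rewrite cE // mulr_sumr; apply: eq_bigr => G _.
by rewrite mulr_sumr; apply: eq_bigr => C _; rewrite mulrA.
Qed.

Lemma normal_sum d (J : Type) (r : seq J) (Q : pred J) (v : J -> signed_subset I -> K) :
  (forall k, Q k -> normal_form d (v k)) -> normal_form d (fun X => \sum_(k <- r | Q k) v k X).
Proof.
move=> hv; elim: r => [|k r IHr].
  by apply: eq_normal (normal0 d) => X _; rewrite big_nil.
have [Qk|nQk] := boolP (Q k).
  by apply: eq_normal (normalD (hv k Qk) IHr) => X _; rewrite big_cons Qk.
by apply: eq_normal IHr => X _; rewrite big_cons (negPf nQk).
Qed.

Definition cube G P N X : K :=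
  [&& G \subset Flat X, P \subset Pos X & N \subset Neg X]%:R.

(** Straightening needs a quantity that drops both when an element is removed and
    when an element is replaced by an earlier one. *)
Definition wt C := (\sum_(i in C) (enum_rank i).+1)%N.

Lemma wtU1 i C : i \notin C -> wt (i |: C) = ((enum_rank i).+1 + wt C)%N.
Proof. exact: big_setU1. Qed.

Lemma wtD1 i C : i \in C -> wt C = ((enum_rank i).+1 + wt (C :\ i))%N.
Proof. exact: big_setD1. Qed.

Lemma wtID A C : wt C = (wt (C :&: A) + wt (C :\: A))%N.
Proof. exact: big_setID. Qed.

Lemma wtS C D : C \subset D -> (wt C <= wt D)%N.
Proof. by move=> sCD; rewrite (wtID C D) (setIidPr sCD) leq_addr. Qed.

Lemma wt_proper C D : C \proper D -> (wt C < wt D)%N.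
Proof.
case/properP=> sCD [i Di nCi]; rewrite (wtD1 Di) addSn ltnS.
apply: leq_trans (leq_addl _ _); apply: wtS; apply/subsetP=> k Ck.
by rewrite !inE (subsetP sCD) // andbT; apply: contraNneq nCi => <-.
Qed.

Lemma wt_exchange A D j : j \notin A -> (forall a, a \in A -> precedes j a) ->
  D \proper j |: A -> D != A -> (wt D < wt A)%N.
Proof.
move=> nAj lt_j pD neD; have [jD|nDj] := boolP (j \in D); last first.
  apply: wt_proper; rewrite properEneq neD; apply/subsetP=> i Di.
  have /setU1P[ij|//] := subsetP (proper_sub pD) i Di.
  by rewrite -ij Di in nDj.
have [sD [a /setU1P[aj|Aa] nDa]] := properP pD; first by rewrite aj jD in nDa.
rewrite (wtD1 jD) (wtD1 Aa) -addSn; apply: leq_add; first exact: lt_j.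
apply: wtS; apply/subsetP=> i /setD1P[ij Di].
have /setU1P[/eqP|Ai] := subsetP sD i Di; first by rewrite (negPf ij).
by rewrite !inE Ai andbT; apply: contraNneq nDa => <-.
Qed.

Lemma cube_zero G P N d : (forall X, X \in M -> cube G P N X = 0) -> normal_form d (cube G P N).
Proof. by move=> c0; apply: eq_normal (normal0 d) => X MX; rewrite c0. Qed.

Lemma cube_overlap G P N d i : i \in P -> i \in N -> normal_form d (cube G P N).
Proof.
move=> Pi Ni; apply: cube_zero => X _; rewrite /cube; case: and3P => // -[_ sP sN].
by have := subsetP sP i Pi; have := subsetP sN i Ni; rewrite !inE => /eqP ->.
Qed.

Lemma cube_zeroP G P N d i : i \in G -> i \in P -> normal_form d (cube G P N).
Proof.
move=> Gi Pi; apply: cube_zero => X _; rewrite /cube; case: and3P => // -[sG sP _].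
by have := subsetP sG i Gi; have := subsetP sP i Pi; rewrite !inE => /eqP ->.
Qed.

Lemma cube_zeroN G P N d i : i \in G -> i \in N -> normal_form d (cube G P N).
Proof.
move=> Gi Ni; apply: cube_zero => X _; rewrite /cube; case: and3P => // -[sG _ sN].
by have := subsetP sG i Gi; have := subsetP sN i Ni; rewrite !inE => /eqP ->.
Qed.

(** The values of the three indicators at i add up to 1. *)
Lemma cube_split G P N i X : i \in N ->
  cube G P (N :\ i) X =
    cube G P N X + cube G (i |: P) (N :\ i) X + cube (i |: G) P (N :\ i) X.
Proof.
move=> Ni; rewrite /cube -{2}(setD1K Ni) !subUset !sub1set !inE.
case: (G \subset _) (P \subset _) (N :\ i \subset _) => [] [] [];
  rewrite ?andbF ?addr0 //=.
by case: (X i) => [[]|]; rewrite ?(addr0, add0r).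
Qed.

(** When the nbc condition fails at b, the tail of C at b either has no common zero
    with G, or has an element j before b in its closure; otherwise common_nonzero
    would produce the missing covector. In the second case a minimal part of the
    tail with j in its closure is a circuit deprived of its least element j. *)
Lemma not_nbc G C : G \in flats M -> [disjoint C & G] -> ~~ nbc G C ->
  (exists2 A : {set I}, A \subset C &
     forall X, X \in M -> ~~ (G :|: A \subset Flat X)) \/
  (exists (A : {set I}) (j : I) (W : signed_subset I),
     [/\ [/\ A \subset C, A != set0 & j \notin A :|: G],
         forall a, a \in A -> precedes j a,
         W \in M /\ G :|: A \subset Flat W,
         j \in cl M (G :|: A) &
         forall a, a \in A -> j \notin cl M (G :|: (A :\ a))]).
Proof.
move=> flG dCG; rewrite /nbc dCG /= negb_forall_in => /exists_inP[b Cb].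
rewrite negb_exists_in => /forall_inP nX.
pose A := [set c in C | ~~ precedes c b]; have sAC : A \subset C.
  by apply/subsetP=> c /setIdP[].
have [/exists_inP[W MW GAW]|] := boolP [exists W in M, G :|: A \subset Flat W]; last first.
  by rewrite negb_exists_in => /forall_inP nW; left; exists A.
right; have [j [nGj jb clj]] : exists j, [/\ j \notin G, precedes j b & j \in cl M (G :|: A)].
  apply: contrapT => /forallNP nj.
  pose D := [set j | (j \notin G) && precedes j b].
  have [|X [MX GAX nzX]] := @common_nonzero _ _ comM (G :|: A) D W MW GAW.
    move=> j; rewrite inE => /andP[nGj jb]; apply/clPn/negP=> clj.
    by apply: (nj j).
  have := nX X MX; rewrite GAX /= negb_forall => /existsP[j].
  by rewrite negb_imply => /andP[h]; rewrite nzX ?inE.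
have [|A' minA' sA'A] := @minset_exists _ (fun B => j \in cl M (G :|: B)) A; first by [].
have [clA' mA'] := minsetP minA'.
have GA'W : G :|: A' \subset Flat W by apply: subset_trans GAW; apply: setUS.
exists A', j, W; split=> //; first split.
- exact: subset_trans sA'A sAC.
- by apply: contraNneq nGj => A'0; rewrite A'0 setU0 (cl_flat flG) in clA'.
- rewrite inE negb_or nGj andbT; apply: contraTN jb => /(subsetP sA'A).
  by rewrite inE => /andP[].
- move=> a /(subsetP sA'A); rewrite inE /precedes -leqNgt => /andP[_]; exact: leq_trans.
- move=> a Aa; apply/negP=> /mA' /(_ (subsetDl _ _)) E.
  by have := setD11 a A'; rewrite E Aa.
Qed.

Section OneFlat.
Variables (G : {set I}) (d : nat).
Hypothesis flG : G \in flats M.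
Hypothesis bigger : forall D P N, D != set0 -> [disjoint D & G] ->
  (codim M G + #|D| + #|P| + #|N| < d)%N -> normal_form d (cube (G :|: D) P N).

(** Replacing negative conditions by positive ones costs a sign, terms of
    smaller weight, and terms supported on larger flats. *)
Lemma flip_normal n P N :
  (forall P' N', (wt P' + wt N' < n)%N -> (codim M G + #|P'| + #|N'| < d)%N ->
     normal_form d (cube G P' N')) ->
  [disjoint N & P] -> [disjoint N & G] -> (wt P + wt N <= n)%N ->
  (codim M G + #|P| + #|N| < d)%N ->
  normal_form d (cube G P N) <-> normal_form d (cube G (P :|: N) set0).
Proof.
move=> lower; have [m] := ubnP #|N|; elim: m P N => // m IHm P N ltm dNP dNG wPN lt_d.
have [->|[i Ni]] := set_0Vmem N; first by rewrite setU0.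
have nPi : i \notin P by rewrite (disjointFr dNP).
have nGi : i \notin G by rewrite (disjointFr dNG).
have cN : #|N| = (#|N :\ i|).+1 by rewrite (cardsD1 i) Ni.
have -> : P :|: N = (i |: P) :|: (N :\ i).
  by rewrite -[in LHS](setD1K Ni) setUCA setUA.
have sN : N :\ i \subset N by apply: subsetDl.
rewrite -IHm; first last.
- by rewrite cardsU1 nPi; move: lt_d; rewrite cN; congr (_ < d)%N; rewrite add1n !(addnS, addSn).
- rewrite wtU1 //; move: wPN; rewrite (wtD1 Ni) addnA; congr (_ + _ <= n)%N; exact: addnC.
- exact: disjointWl sN dNG.
- rewrite disjoint_sym disjointsU disjoints1 !inE eqxx /= disjoint_sym; exact: disjointWl sN dNP.
- by move: ltm; rewrite cN.
have low : normal_form d (cube G P (N :\ i)).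
  apply: lower; last by apply: leq_ltn_trans lt_d; rewrite leq_add2l subset_leq_card.
  by apply: leq_trans wPN; rewrite ltn_add2l wt_proper // properD1.
have big : normal_form d (cube (i |: G) P (N :\ i)).
  rewrite setUC; apply: bigger; first by apply/set0Pn; exists i; rewrite set11.
    by rewrite disjoints1.
  by rewrite cards1; move: lt_d; rewrite cN; congr (_ < d)%N; rewrite addn1 !(addnS, addSn).
split=> h.
  apply: eq_normal (normalD (normalD low (normalZ (-1) big)) (normalZ (-1) h)) => X _.
  by rewrite (cube_split G P X Ni) !mulN1r addrK addrC addKr.
apply: eq_normal (normalD (normalD low (normalZ (-1) big)) (normalZ (-1) h)) => X _.
by rewrite (cube_split G P X Ni) !mulN1r !addrK.
Qed.

(** Straightening: a forbidden pattern gives a relation that rewrites a monomial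
    that is not nbc into monomials of smaller weight. If the tail A has no common
    zero with G, some product of sign conditions over A vanishes. If A is a circuit
    deprived of j, inclusion and exclusion over j |: A expresses the indicator of
    the common zeros of A, of degree at most #|A| and supported on larger flats,
    by products over the proper subsets of j |: A; the one over A has the largest
    weight. *)
Lemma cube_normal_flat P N : (codim M G + #|P| + #|N| < d)%N -> normal_form d (cube G P N).
Proof.
have [n] := ubnP (wt P + wt N); elim: n P N => // n IHn P N; rewrite ltnS => wPN lt_d.
have [dNP|] := boolP [disjoint N & P]; last first.
  by case/pred0Pn=> i /andP[Ni Pi]; apply: cube_overlap Pi Ni.
have [dNG|] := boolP [disjoint N & G]; last first.
  by case/pred0Pn=> i /andP[Ni Gi]; apply: cube_zeroN Gi Ni.
have [dPG|] := boolP [disjoint P & G]; last first.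
  by case/pred0Pn=> i /andP[Pi Gi]; apply: cube_zeroP Gi Pi.
apply: (iffRL (flip_normal IHn _ _ _ _)) => //; set C := P :|: N.
have wC : (wt C <= n)%N.
  rewrite (wtID P) setUK setDUl setDv set0U; apply: leq_trans wPN.
  by rewrite leq_add2l wtS // subsetDl.
have cC : (codim M G + #|C| < d)%N.
  by apply: leq_ltn_trans lt_d; rewrite -addnA leq_add2l cardsU leq_subr.
have dCG : [disjoint C & G] by rewrite disjointsU dPG.
(* Any partition of C into positive and negative conditions will do. *)
have part (s : I -> bool) A R : A \subset C -> R = C :\: A ->
    normal_form d (cube G ([set i in A | s i] :|: R) [set i in A | ~~ s i]) ->
    normal_form d (cube G C set0).
  move=> sAC -> h; set Q := [set i in A | s i] in h *; set O := [set i in A | _] in h *.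
  have E : C = (Q :|: (C :\: A)) :|: O.
    apply/setP=> i; rewrite !inE; have := subsetP sAC i; rewrite inE.
    by case: (i \in A) (s i) (_ || _) => [] [] [] //= ->.
  have dO : [disjoint O & Q :|: C :\: A].
    by apply/pred0P=> i; rewrite /= !inE; case: (i \in A) (s i) => [] [].
  have sOC : O \subset C by rewrite E subsetUr.
  rewrite E; apply: (iffLR (flip_normal IHn dO _ _ _)) h.
  - exact: disjointWl sOC dCG.
  - apply: leq_trans wC; rewrite [in leqRHS]E (wtID O (_ :|: O)) addnC; apply: leq_add.
      by apply: wtS; rewrite setIUl setIid subsetUr.
    apply: wtS; rewrite setDUl setDv setU0; apply/subsetP=> i hi.
    by rewrite in_setD hi andbT (disjointFl dO).
  - apply: leq_ltn_trans cC; rewrite -addnA leq_add2l [in leqRHS]E [in leqRHS]cardsU.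
    by move: dO; rewrite disjoint_sym -setI_eq0 => /eqP ->; rewrite cards0 subn0.
have [nbcC|nnbc] := boolP (nbc G C).
  exists (fun G' C' => ((G' == G) && (C' == C))%:R); split=> [G' C'|X MX].
    by case: andP => [[/eqP-> /eqP->]|]; rewrite ?eqxx.
  rewrite (bigD1 G) //= [X in _ + X]big1 ?addr0 => [|G' /negPf nG]; last first.
    by rewrite big1 // => C' _; rewrite nG mul0r.
  rewrite (bigD1 C) //= [X in _ + X]big1 ?addr0 => [|C' /negPf nC]; last first.
    by rewrite nC andbF mul0r.
  by rewrite !eqxx mul1r /cube /mon sub0set andbT.
have [[A sAC nA]|[A [j [W [[sAC A0 njAG] jA [MW GAW] clj minA]]]]] := not_nbc flG dCG nnbc.
  have [s ns] : exists s : I -> bool, forall X, X \in M -> G \subset Flat X ->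
      exists2 i, i \in A & X i != Some (s i).
    apply: contrapT => /forallNP h.
    have [s|X MX GAX] := @zero_of_all_patterns _ _ comM G A; last first.
      by have := nA X MX; rewrite GAX.
    have /existsNP[X /not_implyP[MX /not_implyP[GX nX]]] := h s.
    exists X; split=> // i Ai; apply/eqP/contraT => Xi; case: nX; exists i => //.
  apply: (part s A _ sAC erefl); apply: cube_zero => X MX; rewrite /cube.
  case: and3P => // -[GX /subsetP PX /subsetP NX]; have [i Ai] := ns X MX GX.
  have := PX i; have := NX i; rewrite !inE Ai /=.
  by case: (s i) => /= [_ /(_ isT) /eqP->|/(_ isT) /eqP->]; rewrite eqxx.
have [nAj nGj] : j \notin A /\ j \notin G by move: njAG; rewrite inE negb_or => /andP.
have [s sP] := circuit_pattern comM MW GAW nAj clj minA.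
pose R := C :\: A; pose J := j |: A.
pose term D := cube G ([set i in D | s i] :|: R) [set i in D | ~~ s i].
have termE D X : G \subset Flat X -> term D X =
    ((D \subset [set i in J | X i == Some (s i)]) && (R \subset Pos X))%:R
    \/ ~~ (D \subset J).
  move=> GX; have [sDJ|] := boolP (D \subset J); [left | by right].
  rewrite /term /cube GX subUset /= andbAC; congr ((_ && _)%:R).
  apply/andP/subsetP => [[/subsetP PX /subsetP NX] i Di|h].
    have := PX i; have := NX i; rewrite !inE Di -in_setU1 (subsetP sDJ) //=.
    by case: (s i) => /= [_ /(_ isT)|/(_ isT)].
  split; apply/subsetP=> i; rewrite inE => /andP[/h]; rewrite !inE.
    by move=> /andP[_ /eqP->] ->.
  by move=> /andP[_ /eqP->] /negPf->.
have rel X : X \in M -> \sum_(D : {set I} | D \subset J) (-1) ^+ #|D| * term D X =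
    cube (G :|: A) R set0 X.
  move=> MX; have [GX|nGX] := boolP (G \subset Flat X); last first.
    rewrite /cube subUset (negPf nGX) big1 // => D _.
    by rewrite /term /cube (negPf nGX) mulr0.
  set U := [set i in J | X i == Some (s i)].
  transitivity ((R \subset Pos X)%:R * \sum_(D : {set I} | D \subset U) (-1) ^+ #|D| : K).
    have sUJ : U \subset J by apply/subsetP=> i /setIdP[].
    rewrite big_mkcond [in RHS]big_mkcond mulr_sumr; apply: eq_bigr => D _.
    have [sDJ|nDJ] := boolP (D \subset J); last first.
      have -> : (D \subset U) = false by apply: contraNF nDJ => /subset_trans; apply.
      by rewrite mulr0.
    have [->|] := termE D X GX; last by rewrite sDJ.
    rewrite -/U; case: (D \subset U); case: (R \subset _);
      by rewrite /= ?(mulr0, mul0r, mulr1, mul1r).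
  rewrite sum_sign_subsets /cube subUset GX sub0set andbT /= -natrM mulnb andbC.
  congr ((_ && _)%:R); apply/eqP/FlatP => [U0 i Ai|AX].
    (* The opposite pattern is excluded through W composed with -X. *)
    have := sP (scomp W (sopp X)) (scompN_in comM MW MX).
    have Wz k : k \in G :|: A -> W k = None by move/FlatP: GAW; apply.
    have Wj : W j = None by move/clP: clj; apply.
    have WJ k : k \in J -> W k = None.
      by case/setU1P=> [->|Ak] //; apply: Wz; rewrite inE Ak orbT.
    have -> : G \subset Flat (scomp W (sopp X)).
      by apply: scomp_zero; rewrite ?sopp_zero //; apply: subset_trans GAW; apply: subsetUl.
    move=> /(_ isT) h; have Ji : i \in J by apply: setU1r.
    have := h _ i Ji; rewrite !ffunE WJ //= => e.
    have {e} : omap negb (X i) = None.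
      apply: e => k Jk; rewrite !ffunE WJ //=; apply: contraFneq (in_set0 k) => Xk.
      by rewrite -U0 inE Jk; case: (X k) (s k) Xk => [[]|] [].
    by case: (X i).
  apply/setP=> i; rewrite !inE; apply/negP=> /andP[Ji /eqP Xi].
  suff: X i = None by rewrite Xi.
  case/orP: Ji => [/eqP->|/AX//]; move/clP: clj; apply=> //.
  by rewrite subUset GX; apply/FlatP.
have JX X : X \in M -> term J X = 0.
  move=> MX; rewrite /term /cube; case: and3P => // -[GX /subsetP PX /subsetP NX].
  have XJ i : i \in J -> X i = Some (s i).
    move=> Ji; have := PX i; have := NX i; rewrite !inE -in_setU1 Ji /=.
    by case: (s i) => /= [_ /(_ isT) /eqP|/(_ isT) /eqP].
  have : X j = None.
    by apply: (sP X) => // [i Ji|]; rewrite ?setU11 // XJ //; case: (s i).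
  by rewrite XJ ?setU11.
apply: (part s A R sAC erefl); rewrite -/(term A).
have neJA : J != A by apply: contraNneq nAj => <-; apply: setU11.
have low D : D \subset J -> D != A -> D != J -> normal_form d (term D).
  move=> sDJ neA neJ; have pD : D \proper J by rewrite properEneq neJ.
  have wD : (wt D < wt A)%N by apply: wt_exchange nAj jA pD neA.
  have cD : (#|D| <= #|A|)%N by have := proper_card pD; rewrite cardsU1 nAj add1n ltnS.
  have wI (Q O R' : {set I}) : (wt (Q :|: R') + wt O <= wt Q + wt O + wt R')%N.
    rewrite addnAC leq_add2r (wtID Q) setUK leq_add2l setDUl setDv set0U; exact/wtS/subsetDl.
  have ws (D' : {set I}) : wt D' = (wt [set i in D' | s i] + wt [set i in D' | ~~ s i])%N.
    rewrite (wtID [set i | s i]); congr (wt _ + wt _)%N; apply/setP=> i; rewrite !inE //.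
    by rewrite andbC.
  have cs (D' : {set I}) : #|D'| = (#|[set i in D' | s i]| + #|[set i in D' | ~~ s i]|)%N.
    rewrite -(cardsID [set i | s i] D'); congr addn; apply: eq_card => i.
      by rewrite !inE.
    by rewrite !inE andbC.
  apply: IHn.
    apply: leq_ltn_trans (wI _ _ _) _; rewrite -ws; apply: leq_trans wC.
    by rewrite (wtID A C) (setIidPr sAC) ltn_add2r.
  apply: leq_ltn_trans cC; rewrite -addnA leq_add2l.
  rewrite -(cardsID A C) (setIidPr sAC) -/R.
  apply: leq_trans (_ : #|D| + #|R| <= _)%N; last by rewrite leq_add2r.
  by rewrite [#|D|]cs addnAC leq_add2r cardsU leq_subr.
have big : normal_form d (cube (G :|: A) R set0).
  apply: bigger A0 (disjointWl sAC dCG) _; rewrite cards0 addn0.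
  by rewrite -addnA -(setIidPr sAC) cardsID.
have rest : normal_form d (fun X => \sum_(D : {set I} | (D \subset J) && (D != J) && (D != A))
    (-1) ^+ #|D| * term D X).
  by apply: normal_sum => D /andP[/andP[sDJ neJ] neA]; apply/normalZ/low.
apply: eq_normal (normalZ ((-1) ^+ #|A|) (normalD big (normalZ (-1) rest))) => X MX.
rewrite -rel // (bigD1 J) //= JX // mulr0 add0r (bigD1 A) /=; last first.
  by rewrite subsetUr eq_sym.
by rewrite mulN1r addrK mulrA -signr_odd -signr_addb addbb mul1r.
Qed.

End OneFlat.

(** Larger flats first: a product of further zero conditions closes up to a
    larger flat whose codimension is at most the number of conditions. *)
Lemma cube_normal A P N d : (#|A| + #|P| + #|N| < d)%N -> normal_form d (cube A P N).
Proof.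
have close_up (B Q O : {set I}) : (forall F, F \in flats M -> B \subset F ->
    (codim M F <= #|B|)%N -> cl M B = F -> normal_form d (cube F Q O)) ->
    normal_form d (cube B Q O).
  move=> h; have [/exists_inP[W MW BW]|] := boolP [exists W in M, B \subset Flat W]; last first.
    rewrite negb_exists_in => /forall_inP nB; apply: cube_zero => X /nB.
    by rewrite /cube => /negPf->.
  have flB := cl_is_flat comM MW BW.
  have leB := codim_span comM flB (sub_cl M B) erefl.
  apply: (eq_normal _ (h _ flB (sub_cl _ _) leB erefl)) => X MX.
  congr ((_ && _)%:R); apply/idP/idP => [|]; last exact: cl_min.
  by apply: subset_trans; apply: sub_cl.
move=> lt_d; apply: (close_up A P N) => F flF _ cF _.
have {lt_d cF} : (codim M F + #|P| + #|N| < d)%N.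
  by apply: leq_ltn_trans lt_d; rewrite !leq_add2r.
have [n] := ubnP (#|I| - #|F|); elim: n F flF P N => // n IHn F flF P N; rewrite ltnS => ltn lt_d.
apply: cube_normal_flat => // D Q O D0 dDF lt_d'; apply: close_up => F' flF' sF' cF' clF'.
have pF : F \proper F'.
  have /set0Pn[i Di] := D0; apply/properP; split; first exact: subset_trans (subsetUl _ _) sF'.
  by exists i; [apply: (subsetP sF'); rewrite inE Di orbT | rewrite (disjointFr dDF)].
apply: IHn => //.
  have ltF := proper_card pF; have leF' : (#|F'| <= #|I|)%N by apply: max_card.
  by apply: leq_trans ltn; apply: ltn_sub2l => //; apply: leq_trans leF'.
apply: leq_ltn_trans lt_d'; rewrite !leq_add2r.
have [sZ clZ _] := basicP comM flF (zbasis_basic comM flF).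
apply: leq_trans (_ : #|zbasis M F :|: D| <= _)%N; last by rewrite cardsU leq_subr.
have sZD : zbasis M F :|: D \subset F' by apply: subset_trans sF'; apply: setSU.
apply: codim_span => //; apply/eqP; rewrite eqEsubset cl_sub_flat //= -clF'.
apply: cl_cl_sub; rewrite subUset; apply/andP; split.
  by have := clS M (subsetUl (zbasis M F) D); rewrite clZ.
by apply: subset_trans (sub_cl M _); apply: subsetUr.
Qed.

End NormalForms.

(** * Linear independence of nbc monomials *)

Section Independence.
Variables (K : fieldType) (I : finType) (M : {set signed_subset I}).
Hypothesis comM : cond_oriented_matroid M.
Implicit Types (X Y Z W : signed_subset I) (A B C D F G P N : {set I}) (i j : I).

Local Notation rk i := (nat_of_ord (enum_rank i)).

(** Deletion and contraction of the largest remaining element i, in the form of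
    an induction on the bound m: covectors vanishing at i extend with both signs
    at i, which isolates the monomials involving i. *)
Lemma nbc_independent_below G m A X0 (c : {set I} -> K) :
    X0 \in M -> G :|: A \subset Flat X0 ->
    (forall j, j \notin G -> (rk j < m)%N -> X0 j != None) ->
    (forall C, c C != 0 -> [/\ [disjoint C & G], forall i, i \in C -> (rk i < m)%N &
       forall b, b \in C -> exists X, [/\ X \in M,
         G :|: A :|: [set a in C | ~~ precedes a b] \subset Flat X &
         forall j, j \notin G -> precedes j b -> X j != None]]) ->
    (forall X, X \in M -> G :|: A \subset Flat X ->
       (forall j, j \notin G -> (rk j < m)%N -> X j != None) ->
       \sum_C c C * (C \subset Pos X)%:R = 0) ->
  forall C, c C = 0.
Proof.
elim: m A X0 c => [|m IHm] A X0 c MX0 AX0 nzX0 supp van.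
  have c0 C : C != set0 -> c C = 0.
    case/set0Pn=> i Ci; apply/eqP/contraT => /supp[_ /(_ i Ci)].
    by rewrite ltn0.
  move=> C; have [->|] := eqVneq C set0; last exact: c0.
  have := van X0 MX0 AX0; rewrite (bigD1 set0) //=.
  rewrite big1 ?addr0 => [|B /c0->]; last by rewrite mul0r.
  by rewrite sub0set mulr1 => ->.
have [/existsP[i /andP[nGi /eqP rki]]|] :=
  boolP [exists i, (i \notin G) && (rk i == m)]; last first.
  rewrite negb_exists => /forallP nG.
  have lt_m j : j \notin G -> (rk j < m.+1)%N -> (rk j < m)%N.
    by move=> nGj; rewrite ltnS leq_eqVlt => /predU1P[rkj|//]; have := nG j; rewrite nGj rkj eqxx.
  apply: (IHm A X0) => // [j nGj ltj|C /supp[dCG ltC wit]|X MX AX nzX].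
  - by apply: nzX0 => //; apply: ltnW.
  - split=> // j Cj; apply: lt_m; [by rewrite (disjointFr dCG) | exact: ltC].
  - by apply: van => // j nGj /(lt_m j nGj); apply: nzX.
have X0i : X0 i != None by apply: nzX0; rewrite ?rki.
have lt_m j : j != i -> (rk j < m.+1)%N -> (rk j < m)%N.
  move=> ji; rewrite ltnS leq_eqVlt => /predU1P[rkj|//]; case/eqP: ji.
  by apply/enum_rank_inj/val_inj; rewrite /= rki.
(* Any Y that is nonzero at i makes X admissible for the bound m.+1. *)
have comp X Y : X \in M -> Y \in M -> G :|: A \subset Flat X -> G :|: A \subset Flat Y ->
    (forall j, j \notin G -> (rk j < m)%N -> X j != None) -> Y i != None ->
    \sum_C c C * (C \subset Pos (scomp X Y))%:R = 0.
  move=> MX MY AX AY nzX Yi; apply: van; [exact: scomp_in | exact: scomp_zero |] => j nGj ltj.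
  rewrite ffunE; case: ifP => [/eqP Xj|/negbT //].
  have [-> //|ji] := eqVneq j i.
  by have := nzX j nGj (lt_m j ji ltj); rewrite Xj.
have ci C : i \in C -> c C = 0.
  move=> Ci; pose c1 B := if i \in B then 0 else c (i |: B).
  suff: c1 (C :\ i) = 0 by rewrite /c1 !inE eqxx /= setD1K.
  apply/eqP/contraT; rewrite /c1 !inE eqxx /= setD1K // => nzC.
  have [_ _ /(_ i Ci)[X1 [MX1 AX1 nzX1]]] := supp C nzC.
  case/negP: nzC; apply/eqP; rewrite -[C](setD1K Ci).
  have -> : c (i |: C :\ i) = c1 (C :\ i) by rewrite /c1 !inE eqxx.
  have precE j : precedes j i = (rk j < m)%N by rewrite /precedes rki.
  apply: (IHm (i |: A) X1) => //.
  - apply: subset_trans AX1; rewrite setUCA setUC; apply: setUS.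
    by apply/subsetP=> k /set1P->; rewrite inE Ci /precedes ltnn.
  - by move=> j nGj; rewrite -precE; apply: nzX1.
  - move=> B; rewrite /c1; case: ifP => [_|/negbT nBi]; first by rewrite eqxx.
    case/supp=> dBG ltB wit; move: dBG; rewrite disjointsU => /andP[_ dBG]; split=> // [j Bj|b Bb].
      by apply: lt_m; [apply: contraNneq nBi => <- | apply: ltB; rewrite inE Bj orbT].
    have [|X [MX AX nzX]] := wit b; first by rewrite inE Bb orbT.
    exists X; split=> //; apply: subset_trans AX; apply/subsetP=> k.
    have := ltB b; rewrite !inE Bb orbT => /(_ isT); rewrite ltnS -rki leqNgt.
    have [->|_ _] := eqVneq k i; first by rewrite /precedes => ->; rewrite !orbT.
    by rewrite /= ?orbF.
  move=> X MX AX nzX; have iAX := AX.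
  have Xi : X i = None by apply: (FlatP _ _ AX); rewrite !inE eqxx orbT.
  have AX' : G :|: A \subset Flat X.
    by apply: subset_trans AX; apply: setUS; apply: subsetUr.
  have AN : G :|: A \subset Flat (sopp X0) by apply: sopp_zero.
  have MN : scomp X (sopp X0) \in M by apply: scompN_in.
  have eqX Y C' : (forall j, X j != None -> Y j = X j) -> c C' != 0 ->
      (C' :\ i \subset Pos Y) = (C' :\ i \subset Pos X).
    move=> YX nzC'; have [dC' ltC' _] := supp C' nzC'.
    have YXC j : j \in C' :\ i -> Y j = X j.
      case/setD1P=> ji C'j; apply/YX/nzX; first by rewrite (disjointFr dC').
      exact/lt_m/ltC'.
    by apply/subsetP/subsetP => h j C'j; have := h j C'j; rewrite !inE YXC.
  have split_i Y C' : C' \subset Pos Y =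
      (C' :\ i \subset Pos Y) && ((i \in C') ==> (Y i == Some true)).
    have [C'i|nC'i] := boolP (i \in C'); last first.
      by rewrite andbT (setDidPl _) // disjoint_sym disjoints1.
    by rewrite -[in LHS](setD1K C'i) subUset sub1set inE andbC.
  pose S1 := scomp X X0; pose S2 := scomp X (sopp X0).
  have S1X j : X j != None -> S1 j = X j by move=> Xj; rewrite ffunE (negPf Xj).
  have S2X j : X j != None -> S2 j = X j by move=> Xj; rewrite ffunE (negPf Xj).
  have van1 : \sum_C' c C' * (C' \subset Pos S1)%:R = 0 by apply: comp.
  have van2 : \sum_C' c C' * (C' \subset Pos S2)%:R = 0.
    (* S2 is a covector although the opposite of X0 need not be one. *)
    have -> : S2 = scomp X S2.
      by apply/ffunP=> j; rewrite !ffunE; case: (X j).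
    apply: comp => //; first by apply: scomp_zero.
    by rewrite !ffunE Xi /=; case: (X0 i) X0i.
  have dif : \sum_(C' : {set I} | i \in C') c C' * (C' :\ i \subset Pos X)%:R = 0.
    pose e : K := if X0 i == Some true then 1 else -1.
    have e0 : e != 0 by rewrite /e; case: ifP; rewrite ?oppr_eq0 oner_eq0.
    apply: (mulfI e0); rewrite mulr0.
    transitivity (\sum_C' c C' * (C' \subset Pos S1)%:R - \sum_C' c C' * (C' \subset Pos S2)%:R);
      last by rewrite van1 van2 subrr.
    rewrite -sumrB mulr_sumr big_mkcond; apply: eq_bigr => C' _.
    have [->|nzC'] := eqVneq (c C') 0; first by rewrite !mul0r mulr0 subrr if_same.
    rewrite (split_i S1) (split_i S2) (eqX S1 C' S1X nzC') (eqX S2 C' S2X nzC').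
    rewrite !ffunE Xi /= /e.
    have [_|_] := boolP (i \in C'); last by rewrite /= !andbT subrr.
    case: (_ \subset _); last by rewrite /= !mulr0 subrr.
    by case: (X0 i) X0i => [[]|] //= _; rewrite ?mulr0 ?subr0 ?sub0r ?mul1r ?mulN1r.
  rewrite -[RHS]dif.
  rewrite [RHS](reindex_onto (fun B : {set I} => i |: B) (fun B => B :\ i)) /=; last first.
    by move=> B iB; rewrite setD1K.
  rewrite [RHS]big_mkcond; apply: eq_bigr => B _.
  rewrite setU11 /= /c1; have [Bi|nBi] := boolP (i \in B).
    rewrite mul0r; case: eqP => // E; by have := setD11 i (i |: B); rewrite E Bi.
  by rewrite setU1K // eqxx.
apply: (IHm A X0) => //.
- by move=> j nGj ltj; apply: nzX0 => //; apply: ltnW.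
- move=> C nzC; have [dCG ltC wit] := supp C nzC; split=> // j Cj.
  by apply: lt_m; [apply: contraNneq nzC => ji; rewrite ci // -ji | apply: ltC].
move=> X MX AX nzX; rewrite -[RHS](comp X X0) //; apply: eq_bigr => C _.
have [->|nzC] := eqVneq (c C) 0; first by rewrite !mul0r.
have [dCG ltC _] := supp C nzC; congr (_ * (nat_of_bool _)%:R).
have nCi : i \notin C by apply: contraNN nzC => /ci->.
have XC j : j \in C -> scomp X X0 j = X j.
  move=> Cj; rewrite ffunE ifN //; apply: nzX; first by rewrite (disjointFr dCG).
  by apply: lt_m; [apply: contraNneq nCi => <- | apply: ltC].
by apply/subsetP/subsetP => h j Cj; have := h j Cj; rewrite !inE XC.
Qed.

Lemma nbc_independent G (c : {set I} -> K) : G \in flats M ->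
    (forall C, c C != 0 -> nbc M G C) ->
    (forall X, X \in M -> Flat X = G -> \sum_C c C * (C \subset Pos X)%:R = 0) ->
  forall C, c C = 0.
Proof.
move=> flG supp van; have [W MW GW] := flat_covector flG.
apply: (@nbc_independent_below G #|I| set0 W) => //.
- by rewrite setU0 -GW.
- by move=> j; rewrite GW inE.
- move=> C /supp/andP[dCG /forall_inP wit]; split=> // b Cb.
  have /exists_inP[X MX /andP[GX /forallP nzX]] := wit b Cb.
  exists X; split=> //; first by rewrite setU0.
  by move=> j nGj jb; have := nzX j; rewrite nGj jb.
move=> X MX; rewrite setU0 => GX nzX; apply: van => //.
apply/eqP; rewrite eqEsubset GX andbT; apply/subsetP=> j; rewrite inE.
by apply: contraLR => nGj; apply: nzX => //; apply: ltn_ord.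
Qed.

(** On the covectors whose flat is a minimal flat G of the support, only the
    monomials attached to G survive, and these are linearly independent there; so
    G cannot be the flat of covectors on which v vanishes. *)
Lemma normal_support d k (v : signed_subset I -> K) (c : {set I} -> {set I} -> K) :
    (forall G C, c G C != 0 -> [/\ G \in flats M, nbc M G C & (codim M G + #|C| < d)%N]) ->
    (forall X, X \in M -> v X = \sum_G \sum_C c G C * mon K G C X) ->
    (forall X, X \in M -> (codim M (Flat X) < k)%N -> v X = 0) ->
  forall G C, c G C != 0 -> (k <= codim M G)%N.
Proof.
move=> hc cE van; suff c0 G : G \in flats M -> (codim M G < k)%N -> forall C, c G C = 0.
  move=> G C nz; have [flG _ _] := hc G C nz.
  by rewrite leqNgt; apply: contraNN nz => lt_k; rewrite c0.
have [n] := ubnP #|G|; elim: n G => // n IHn G ltn flG lt_k.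
apply: (nbc_independent flG) => [C /hc[] //|X MX XG].
rewrite -[RHS](van X) ?XG // cE // [RHS](bigD1 G) //=.
rewrite [X in _ = _ + X]big1 ?addr0 => [|F nFG]; last first.
  rewrite big1 // => C _; rewrite /mon XG.
  have [sFG|] := boolP (F \subset G); last by rewrite mulr0.
  have [->|nz] := eqVneq (c F C) 0; first by rewrite mul0r.
  have [flF _ _] := hc F C nz; have pF : F \proper G by rewrite properEneq nFG.
  have ltF : (#|F| < n)%N by apply: leq_trans (proper_card pF) ltn.
  by rewrite (IHn F ltF flF (ltn_trans (codim_proper comM flF flG pF) lt_k)) eqxx in nz.
by apply: eq_bigr => C _; rewrite /mon XG subxx.
Qed.

End Independence.

(** * Degree and the associated graded ideal *)

Section Degree.
Variables (K : fieldType) (n : nat).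
Implicit Types (p q r : {mpoly K[n]}) (d e : nat).

Lemma pihomog_large d e p : (msize p <= d)%N -> (d <= e)%N -> pihomog mdeg e p = 0.
Proof.
move=> led lee; rewrite pihomogE big_seq_cond big_pred0 // => m; apply/andP=> -[mp /eqP md].
by have := msize_mdeg_lt mp; rewrite md ltnNge (leq_trans led).
Qed.

Lemma msize_homog d p : p \is d.-homog for mdeg -> (msize p <= d.+1)%N.
Proof.
move=> /dhomogP hp; rewrite msizeE; apply/bigmax_leqP_seq => m mp _.
by rewrite hp.
Qed.

Lemma msizeD_leq d p q : (msize p <= d)%N -> (msize q <= d)%N -> (msize (p + q) <= d)%N.
Proof. by move=> hp hq; apply: leq_trans (mmeasureD_le _ _ _) _; rewrite geq_max hp. Qed.

Lemma msizeB_leq d p q : (msize p <= d)%N -> (msize q <= d)%N -> (msize (p - q) <= d)%N.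
Proof. by move=> hp hq; apply: msizeD_leq; rewrite ?mmeasureN. Qed.

Lemma msize_sum_leq d (J : Type) (s : seq J) (Q : pred J) (f : J -> {mpoly K[n]}) :
  (forall j, Q j -> (msize (f j) <= d)%N) -> (msize (\sum_(j <- s | Q j) f j) <= d)%N.
Proof.
by move=> h; apply: (big_ind (fun p => msize p <= d)%N);
  rewrite ?msize0 //; apply: msizeD_leq.
Qed.

Lemma msize_mul_leq d e p q : (msize p <= d.+1)%N -> (msize q <= e)%N ->
  (msize (p * q) <= d + e)%N.
Proof.
have [->|p0] := eqVneq p 0; first by rewrite mul0r msize0.
have [->|q0] := eqVneq q 0; first by rewrite mulr0 msize0.
move=> hp hq; rewrite msizeM //; case: (msize p) hp => [|a] ha; last by apply: leq_add.
by rewrite add0n (leq_trans (leq_pred _)) // (leq_trans hq) // leq_addl.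
Qed.

Lemma pihomog_linear_shift m (f : {mpoly K[n]} -> {mpoly K[m]}) e d p : linear f ->
    (forall k q, q \is k.-homog for mdeg -> f q \is (k + e).-homog for mdeg) ->
  pihomog mdeg d (f p) = if (e <= d)%N then f (pihomog mdeg (d - e) p) else 0.
Proof.
move=> lin_f; pose fL : {linear {mpoly K[n]} -> {mpoly K[m]}} :=
  HB.pack f (GRing.isLinear.Build K _ _ _ f lin_f).
rewrite -[f]/(fL : _ -> _); move: fL => {lin_f}f hf.
rewrite {1}(pihomog_partitionE (leqnn (msize p))) linear_sum [LHS]linear_sum /=.
have hom k : f (pihomog mdeg k p) \is (k + e).-homog for mdeg by apply/hf/pihomogP.
case: leqP => [led|ltd]; last first.
  rewrite big1 // => k _; apply: pihomog_ne0 (hom k).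
  by rewrite neq_ltn (leq_trans ltd (leq_addl _ _)) orbT.
have [lt|ge] := ltnP (d - e) (msize p).
  rewrite (bigD1 (Ordinal lt)) //= big1 ?addr0 => [|k nk].
    by apply: pihomog_dE; have := hom (d - e)%N; rewrite subnK.
  apply: pihomog_ne0 (hom k); apply: contraNneq nk => kd.
  by apply/eqP/val_inj; rewrite /= -kd addnK.
rewrite (pihomog_large (leqnn _) ge) linear0 big1 // => k _.
apply: pihomog_ne0 (hom k); apply: contraTneq (ltn_ord k) => kd.
by rewrite -leqNgt (leq_trans ge) // -kd addnK.
Qed.

Lemma msize_top_tail p :
  (msize (p - pihomog mdeg (msize p).-1 p) <= (msize p).-1)%N.
Proof.
have [->|p0] := eqVneq p 0; first by rewrite linear0 subr0 msize0.
have le : (msize p <= (msize p).-1.+1)%N by rewrite -mpolySpred.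
rewrite [X in (msize (X - _) <= _)%N](pihomog_partitionE le) big_ord_recr /= addrK.
by apply: msize_sum_leq => i _; apply: leq_trans (msize_homog (pihomogP _ _ _)) _.
Qed.

End Degree.

Section GradedIdeal.
Variables (K : fieldType) (T : finType) (Z : {fset {ffun T -> K}}).
Local Notation S := {mpoly K[#|T|]}.
Implicit Types (p q h : S).

Lemma vanishes_mul p q : vanishes_on Z q -> vanishes_on Z (p * q).
Proof. by move=> hq z Zz; rewrite /eval_at mevalM [X in _ * X]hq // mulr0. Qed.

Lemma vanishes_sum (J : Type) (s : seq J) (Q : pred J) (f : J -> S) :
  (forall j, Q j -> vanishes_on Z (f j)) -> vanishes_on Z (\sum_(j <- s | Q j) f j).
Proof.
move=> hf z Zz; rewrite /eval_at raddf_sum big1 // => j Qj; exact: hf.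
Qed.

Lemma gr_ideal_mul p q : q \in gr_ideal Z -> p * q \in gr_ideal Z.
Proof.
case/asboolP=> n [a [r [hr ->]]]; apply/asboolP; exists n, (fun i => p * a i), r.
by split=> //; rewrite mulr_sumr; apply: eq_bigr => i _; rewrite mulrA.
Qed.

(** Homogeneous elements of the associated graded ideal are leading forms, and
    nothing more: products with leading forms of degree at most d are completed
    by the lower terms of the same products. *)
Lemma gr_ideal_homogP d h : h \is d.-homog for mdeg ->
  (h \in gr_ideal Z) <-> (exists2 p, vanishes_on Z p & (msize (p - h) <= d)%N).
Proof.
move=> homh; split.
  case/asboolP=> n [a [q [topq hE]]].
  have /choice[P hP] : forall i, exists p : S,
      [/\ p != 0, vanishes_on Z p & q i = top_component p] by exact: topq.
  pose e i := (msize (P i)).-1.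
  have homq i : q i \is (e i).-homog for mdeg.
    by have [_ _ ->] := hP i; apply: pihomogP.
  pose b i := if (e i <= d)%N then pihomog mdeg (d - e i) (a i) else 0.
  have hb : h = \sum_i b i * q i.
    rewrite -[LHS](pihomog_dE homh) hE linear_sum; apply: eq_bigr => i _.
    rewrite [LHS](pihomog_linear_shift (f := fun r => r * q i) (e := e i)) /b.
    - by case: ifP; rewrite ?mul0r.
    - by move=> c r r'; rewrite mulrDl scalerAl.
    - by move=> k r hr; apply: dhomogM.
  exists (\sum_i b i * P i).
    by apply: vanishes_sum => i _; apply: vanishes_mul; have [] := hP i.
  rewrite hb -sumrB; apply: msize_sum_leq => i _; rewrite -mulrBr /b.
  case: (leqP (e i) d) => [led|_]; last by rewrite mul0r msize0.
  rewrite -[leqRHS](subnK led); apply: msize_mul_leq; first exact: msize_homog (pihomogP _ _ _).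
  by have [_ _ ->] := hP i; apply: msize_top_tail.
case=> p Zp hp; have [->|h0] := eqVneq h 0; first exact: rpred0.
have comp : pihomog mdeg d p = h.
  by rewrite -[p](subrK h) linearD /= (pihomog_large hp (leqnn d)) add0r pihomog_dE.
have sp : msize p = d.+1.
  apply/eqP; rewrite eqn_leq; apply/andP; split.
    rewrite -[p](subrK h); apply: msizeD_leq; first exact: leqW.
    exact: msize_homog.
  rewrite ltnNge; apply: contra h0 => le_p; apply/eqP.
  by rewrite -comp (pihomog_large le_p).
rewrite -[h]mul1r; apply: gr_ideal_gen; exists p; split=> //.
  by apply: contraNneq h0 => p0; rewrite -comp p0 linear0.
by rewrite /top_component sp.
Qed.

End GradedIdeal.

(** * Leading forms on the big locus *)

Section BigLocus.
Variables (K : fieldType) (I : finType) (M : {set signed_subset I}).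
Hypothesis comM : cond_oriented_matroid M.
Implicit Types (X Y W : signed_subset I) (A C F G P N : {set I}) (i : I).

Local Notation S := {mpoly K[#|{: I * sign}|]}.
Implicit Types (p q h : S).

Definition ev X p : K := eval_at (zpoint K X) p.

Lemma evB X p q : ev X (p - q) = ev X p - ev X q. Proof. exact: mevalB. Qed.
Lemma evM X p q : ev X (p * q) = ev X p * ev X q. Proof. exact: mevalM. Qed.
Lemma evZ X a p : ev X (a *: p) = a * ev X p. Proof. exact: mevalZ. Qed.
Lemma ev_sum X (J : Type) (s : seq J) (Q : pred J) (f : J -> S) :
  ev X (\sum_(j <- s | Q j) f j) = \sum_(j <- s | Q j) ev X (f j).
Proof. by rewrite /ev /eval_at raddf_sum. Qed.

Lemma big_locusP p : vanishes_on (big_locus K M) p <-> forall X, X \in M -> ev X p = 0.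
Proof.
split=> [h X MX|h z /imfsetP[X /= MX ->]]; last exact: h.
by apply: h; apply: in_imfset.
Qed.

Lemma big_sign (R : Type) (idx : R) (op : Monoid.com_law idx) (f : sign -> R) :
  \big[op/idx]_(s : sign) f s = op (f None) (op (f (Some true)) (f (Some false))).
Proof.
rewrite (bigD1 None) //= (bigD1 (Some true)) //= (bigD1 (Some false)) //= big1 ?Monoid.mulm1 //.
by case=> [[]|].
Qed.

Lemma ev_var X i s : ev X (var K (i, s)) = (X i == s)%:R.
Proof. by rewrite /ev /eval_at /var mevalXU enum_rankK zpointE. Qed.

(** On covectors the monomials are indicator functions, whatever the
    exponents. *)
Lemma poly_normal d p : (msize p <= d)%N -> normal_form M d (fun X => ev X p).
Proof.
move=> led.
pose f (m : 'X_{1..#|{: I * sign}|}) X := \prod_k (zpoint K X (enum_val k)) ^+ m k.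
apply: (@eq_normal _ _ _ _ (fun X => \sum_(m <- msupp p | m \in msupp p) p@_m * f m X)).
  move=> X _; rewrite /ev /eval_at mevalE [RHS]big_seq_cond.
  by apply: eq_bigl => m; rewrite andbT.
apply: normal_sum => m pm; apply: normalZ.
have {led pm} led : (mdeg m < d)%N by apply: leq_trans led; apply: msize_mdeg_lt.
pose V s := [set i | m (enum_rank (i, s)) != 0%N].
apply: (@eq_normal _ _ _ _ (cube K (V None) (V (Some true)) (V (Some false)))).
  move=> X MX; have cubeE : [&& V None \subset Flat X, V (Some true) \subset Pos X &
      V (Some false) \subset Neg X] = [forall t, (m (enum_rank t) != 0%N) ==> (X t.1 == t.2)].
    apply/and3P/forallP => [[/subsetP s0 /subsetP s1 /subsetP s2] [i [[]|]]|h].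
    - by apply/implyP=> hm; have := s1 i; rewrite !inE => ->.
    - by apply/implyP=> hm; have := s2 i; rewrite !inE => ->.
    - by apply/implyP=> hm; have := s0 i; rewrite !inE => ->.
    split; apply/subsetP=> i; rewrite !inE; [have := h (i, None) | have := h (i, Some true)
      | have := h (i, Some false)]; by move/implyP; apply.
  rewrite /cube cubeE /f; case: forallP => [h|/forallP]; last first.
    rewrite negb_forall => /existsP[t]; rewrite negb_imply => /andP[mt /negPf Xt].
    by rewrite (bigD1 (enum_rank t)) //= zpointE enum_rankK Xt expr0n (negPf mt) mul0r.
  rewrite big1 // => k _; rewrite zpointE; have := h (enum_val k); rewrite enum_valK.
  by case: (m k) => [|e]; rewrite ?expr0 //= => ->; rewrite expr1n.
apply: cube_normal => //; apply: leq_ltn_trans led; rewrite mdegE.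
rewrite (reindex (@enum_rank _)) /=; last exact/onW_bij/enum_rank_bij.
rewrite [leqRHS](_ : _ = \sum_i \sum_s m (enum_rank (i, s)))%N; last first.
  by rewrite pair_bigA; apply: eq_bigr => -[].
have cV s : #|V s| = (\sum_i (i \in V s))%N.
  by rewrite -sum1_card big_mkcond; apply: eq_bigr => i _; case: (i \in _).
rewrite !cV -!big_split; apply: leq_sum => i _ /=.
rewrite big_sign /= -addnA !inE.
by apply: leq_add; [|apply: leq_add]; case: (m _).
Qed.

(** This is what makes the graded pieces of the filtration by codimension visible:
    vanishing in codimension less than k restricts the flats in the normal form
    while its coefficients keep degrees complementary to the codimension. *)
Lemma normal_coeffs d k p : (msize p <= d)%N ->
    (forall X, X \in M -> (codim M (Flat X) < k)%N -> ev X p = 0) ->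
  exists c : {set I} -> {set I} -> K,
    (forall G C, c G C != 0 ->
       [/\ G \in flats M, nbc M G C, (codim M G + #|C| < d)%N & (k <= codim M G)%N]) /\
    forall X, X \in M -> ev X p = \sum_G \sum_C c G C * mon K G C X.
Proof.
move=> led van; have [c [hc cE]] := poly_normal led.
exists c; split=> // G C nz; have [flG nbcC lt_d] := hc G C nz; split=> //.
exact: (normal_support comM hc cE van nz).
Qed.

(** As functions on covectors zmon G and ymon C are the two factors of mon G C. *)
Definition zmon G : S := \prod_(i in zbasis M G) var K (i, None).
Definition ymon C : S := \prod_(i in C) var K (i, Some true).

Lemma var_homog (T : finType) (t : T) : var K t \is 1.-homog for mdeg.
Proof. by rewrite dhomogX /= mdeg1. Qed.

Lemma prod_homog (T : finType) (J : finType) (A : {set J}) (f : J -> T) :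
  \prod_(j in A) var K (f j) \is #|A|.-homog for mdeg.
Proof.
rewrite -sum1_card; elim/big_rec2: _ => [|j e q _ hq]; first exact: dhomog1.
by apply: dhomogM hq; apply: var_homog.
Qed.

Lemma zmon_homog G : zmon G \is (codim M G).-homog for mdeg.
Proof. exact: prod_homog. Qed.

Lemma ymon_homog C : ymon C \is #|C|.-homog for mdeg.
Proof. exact: prod_homog. Qed.

Lemma ev_prod X (A : {set I}) s :
  ev X (\prod_(i in A) var K (i, s)) = [forall i in A, X i == s]%:R.
Proof.
rewrite /ev /eval_at rmorph_prod /=.
case: forall_inP => [h|/forall_inP].
  by rewrite big1 // => i Ai; rewrite [LHS]ev_var h.
rewrite negb_forall_in => /exists_inP[i Ai /negPf Xi].
by rewrite (bigD1 i) //= [X in X * _]ev_var Xi mul0r.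
Qed.

Lemma ev_zmon X G : X \in M -> G \in flats M -> ev X (zmon G) = (G \subset Flat X)%:R.
Proof.
move=> MX flG; rewrite ev_prod -(zbasis_sub comM flG MX); congr (nat_of_bool _)%:R.
by apply/forall_inP/subsetP => h i Bi; have := h i Bi; rewrite inE.
Qed.

Lemma ev_ymon X C : ev X (ymon C) = (C \subset Pos X)%:R.
Proof.
rewrite ev_prod; congr (nat_of_bool _)%:R.
by apply/forall_inP/subsetP => h i Bi; have := h i Bi; rewrite inE.
Qed.

Lemma ev_mon X G C : X \in M -> G \in flats M -> ev X (zmon G * ymon C) = mon K G C X.
Proof. by move=> MX flG; rewrite evM ev_zmon // ev_ymon -natrM mulnb. Qed.

Lemma eq_on_grZ d p q : p \is d.-homog for mdeg -> q \is d.-homog for mdeg ->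
  (forall X, X \in M -> ev X p = ev X q) -> p - q \in gr_ideal (big_locus K M).
Proof.
move=> hp hq pq; apply/(gr_ideal_homogP _ (d := d)); first by rewrite rpredB.
by exists (p - q); rewrite ?subrr ?msize0 //; apply/big_locusP=> X MX; rewrite evB pq ?subrr.
Qed.

(** The combination consists of the terms of degree exactly d in the normal form
    of q: the other terms, as well as q - p, have degree less than d and do not
    contribute to the leading form. *)
Lemma leading_form_reduce d k p q : p \is d.-homog for mdeg -> (msize (q - p) <= d)%N ->
    (forall X, X \in M -> (codim M (Flat X) < k)%N -> ev X q = 0) ->
  exists c : {set I} -> {set I} -> K,
    (forall G C, c G C != 0 ->
       [/\ G \in flats M, nbc M G C, (codim M G + #|C| = d)%N & (k <= codim M G)%N]) /\
    p - \sum_G \sum_C c G C *: (zmon G * ymon C) \in gr_ideal (big_locus K M).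
Proof.
move=> homp lt_qp van.
have lt_q : (msize q <= d.+1)%N.
  by rewrite -[q](subrK p); apply: msizeD_leq; [exact: leqW | exact: msize_homog].
have [c [hc cE]] := normal_coeffs lt_q van.
pose c' G C := if (codim M G + #|C| == d)%N then c G C else 0.
have hom G C : zmon G * ymon C \is (codim M G + #|C|).-homog for mdeg.
  by apply: dhomogM; [exact: zmon_homog | exact: ymon_homog].
exists c'; split=> [G C|].
  rewrite /c'; case: (_ =P d) => [ed|]; last by rewrite eqxx.
  by case/hc.
apply/(gr_ideal_homogP _ (d := d)).
  apply: rpredB => //; apply: rpred_sum => G _; apply: rpred_sum => C _.
  rewrite /c'; case: eqP => [<-|_]; first by apply: rpredZ; apply: hom.
  by rewrite scale0r; apply: rpred0.
exists (q - \sum_G \sum_C c G C *: (zmon G * ymon C)).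
  apply/big_locusP=> X MX; rewrite evB cE // ev_sum -sumrB big1 // => G _.
  rewrite ev_sum -sumrB big1 // => C _; rewrite evZ.
  have [->|nz] := eqVneq (c G C) 0; first by rewrite !mul0r subrr.
  by have [flG _ _ _] := hc G C nz; rewrite ev_mon // subrr.
have -> : q - \sum_G \sum_C c G C *: (zmon G * ymon C) -
    (p - \sum_G \sum_C c' G C *: (zmon G * ymon C)) =
    (q - p) - \sum_G \sum_C (c G C - c' G C) *: (zmon G * ymon C).
  rewrite (_ : \sum_G \sum_C (c G C - c' G C) *: _ =
      \sum_G \sum_C c G C *: (zmon G * ymon C) -
      \sum_G \sum_C c' G C *: (zmon G * ymon C)); last first.
    rewrite -sumrB; apply: eq_bigr => G _; rewrite -sumrB; apply: eq_bigr => C _.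
    by rewrite scalerBl.
  by rewrite !opprB addrACA [RHS]addrACA [- _ - p]addrC.
apply: msizeB_leq => //; apply: msize_sum_leq => G _; apply: msize_sum_leq => C _.
have [nz|nz] := eqVneq (c G C) 0.
  by rewrite /c'; case: ifP; rewrite nz ?subrr scale0r msize0.
have [_ _ + _] := hc G C nz; rewrite ltnS leq_eqVlt /c'.
case: eqP => [_|_ /= ltd]; first by rewrite subrr scale0r msize0.
apply: leq_trans ltd; apply: leq_trans (msize_homog (hom G C)).
exact: mmeasureZ_le.
Qed.

End BigLocus.

(** * Substitutions of variables and symmetries *)

Section Substitution.
Variable K : fieldType.

Definition subst (T T' : finType) (f : T -> T') (p : {mpoly K[#|T|]}) : {mpoly K[#|T'|]} :=
  p \mPo [tuple var K (f (enum_val k)) | k < #|T|].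

Fact subst_linear (T T' : finType) (f : T -> T') : linear (subst f).
Proof. by move=> a p q; rewrite /subst linearP. Qed.
HB.instance Definition _ (T T' : finType) (f : T -> T') :=
  GRing.isLinear.Build K {mpoly K[#|T|]} {mpoly K[#|T'|]} _ (subst f) (subst_linear f).

Variables T T' : finType.
Implicit Types (f : T -> T').

Lemma substM f p q : subst f (p * q) = subst f p * subst f q.
Proof. exact: rmorphM. Qed.

Lemma subst1 f : subst f 1 = 1.
Proof. exact: rmorph1. Qed.

Lemma subst_prod f (J : finType) (A : {set J}) (p : J -> {mpoly K[#|T|]}) :
  subst f (\prod_(j in A) p j) = \prod_(j in A) subst f (p j).
Proof. exact: rmorph_prod. Qed.

Lemma subst_var f t : subst f (var K t) = var K (f t).
Proof. by rewrite /subst comp_mpolyXU -tnth_nth tnth_mktuple enum_rankK. Qed.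

Lemma subst_homog f d p : p \is d.-homog for mdeg -> subst f p \is d.-homog for mdeg.
Proof.
move=> /dhomogP hp; rewrite /subst comp_mpolyEX big_seq rpred_sum // => m mp.
have <- : (\sum_(k < #|T|) m k)%N = d by rewrite -(hp _ mp); apply/esym/mdegE.
apply: rpredZ; rewrite comp_mpolyX.
elim/big_rec2: _ => [|k e q _ hq]; first exact: dhomog1.
apply: dhomogM => //; rewrite tnth_mktuple -[X in ishomog1 X]mul1n.
by apply: dhomogMn; apply: var_homog.
Qed.

Lemma eq_subst f f' p : f =1 f' -> subst f p = subst f' p.
Proof.
move=> ff'; congr (_ \mPo _).
by apply: eq_from_tnth => k; rewrite !tnth_mktuple ff'.
Qed.

Lemma eval_subst f z p : eval_at z (subst f p) = eval_at [ffun t => z (f t)] p.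
Proof.
rewrite /eval_at comp_mpoly_meval; apply: meval_eq => k.
by rewrite tnth_mktuple mevalXU enum_rankK ffunE.
Qed.

End Substitution.

Lemma subst_comp (K : fieldType) (T T' T'' : finType) (f : T -> T') (g : T' -> T'') p :
  @subst K _ _ (g \o f) p = subst g (subst f p).
Proof.
rewrite (mpolyE p) (linear_sum (subst f)) (linear_sum (subst g)) linear_sum.
apply: eq_bigr => m _; rewrite /= /subst !comp_mpolyZ; congr (_ *: _).
rewrite !comp_mpolyX rmorph_prod /=; apply: eq_bigr => k _; rewrite rmorphXn /=.
congr (_ ^+ _); have := subst_var K g (f (enum_val k)).
by rewrite /subst !tnth_mktuple => <-.
Qed.


Section Symmetry.
Variables (K : fieldType) (I : finType) (M : {set signed_subset I}).
Hypothesis comM : cond_oriented_matroid M.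
Implicit Types (X Y W : signed_subset I) (A B C F G : {set I}) (i : I).
Local Notation GM := (subg_of (sAut_group M)).
Implicit Types (w v : GM).
Local Notation S := {mpoly K[#|{: I * sign}|]}.

Definition act w : {linear S -> S} := rename K (big_var_act w).

Lemma act_subst w p : act w p = subst (big_var_act w) p. Proof. by []. Qed.

Lemma act_mul w p q : act w (p * q) = act w p * act w q. Proof. exact: substM. Qed.

Lemma act_comp v w p : act (v * w)%g p = act v (act w p).
Proof. by rewrite -[RHS]subst_comp; apply: eq_subst => t; apply: big_var_actM. Qed.

Lemma act_one p : act 1%g p = p.
Proof. by rewrite -[RHS]rename_id; apply: eq_rename => t; apply: big_var_act1. Qed.

Lemma act_homog w d p : p \is d.-homog for mdeg -> act w p \is d.-homog for mdeg.
Proof. exact: subst_homog. Qed.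

Lemma act_gr w p : p \in gr_ideal (big_locus K M) -> act w p \in gr_ideal (big_locus K M).
Proof.
exact: gr_ideal_act (@big_var_act1 I M) (@big_var_actM I M) (@big_locus_stable K I M) w p.
Qed.

Lemma ev_act w X p : ev (sp_act (sgval w) X) (act w p) = ev X p.
Proof.
rewrite /ev eval_subst; congr (eval_at _ p); apply/ffunP=> -[i s].
rewrite !ffunE /= permK; congr (nat_of_bool _)%:R.
case: (X i) s => [a|] [b|] //=.
by apply/eqP/eqP => [[/addbI ->]|[->]].
Qed.

Lemma sp_act_in w X : X \in M -> sp_act (sgval w) X \in M.
Proof. by have /sAutP := subgP w; apply. Qed.

Lemma sp_actV w X : sp_act (sgval w) (sp_act (sgval w^-1%g) X) = X.
Proof. by rewrite -sp_actM mulgV sp_act1. Qed.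

Lemma Flat_act (w : signed_perm I) X : Flat (sp_act w X) = w.1 @: Flat X.
Proof.
apply/setP=> j; rewrite -[j](permKV w.1); set i := (_ j).
rewrite mem_imset; last exact: perm_inj.
by rewrite !inE sp_actE; case: (X i).
Qed.

Lemma imset_permM (v w : signed_perm I) F : (v * w)%g.1 @: F = v.1 @: (w.1 @: F).
Proof. by rewrite -imset_comp; apply: eq_imset => i; rewrite /= permM. Qed.

Lemma imset_perm1 F : (1%g : signed_perm I).1 @: F = F.
Proof. by apply/setP=> i; rewrite -[i in LHS]perm1 mem_imset //; apply: perm_inj. Qed.

Lemma imsetS_perm (w : signed_perm I) A B : (w.1 @: A \subset w.1 @: B) = (A \subset B).
Proof.
apply/idP/idP => [|sAB]; last exact: imsetS.
by move/(imsetS (w^-1)%g.1); rewrite -!imset_permM mulVg !imset_perm1.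
Qed.

Lemma act_flat w F : F \in flats M -> (sgval w).1 @: F \in flats M.
Proof. exact/sAut_flat/subgP. Qed.

Lemma cl_act w A : cl M ((sgval w).1 @: A) = (sgval w).1 @: cl M A.
Proof.
have sub (v : GM) B : (sgval v).1 @: cl M B \subset cl M ((sgval v).1 @: B).
  apply/subsetP=> _ /imsetP[i /clP cli ->]; apply/clP=> X MX vBX.
  pose Y := sp_act (sgval v^-1%g) X; have XE : X = sp_act (sgval v) Y by rewrite sp_actV.
  have BY : B \subset Flat Y by move: vBX; rewrite XE Flat_act imsetS_perm.
  by rewrite XE sp_actE cli // sp_act_in.
apply/eqP; rewrite eqEsubset sub andbT; have := sub (w^-1)%g ((sgval w).1 @: A).
rewrite -imset_permM mulVg imset_perm1 -(imsetS_perm (sgval w)).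
by rewrite -imset_permM mulgV imset_perm1.
Qed.

Lemma codim_act w F : F \in flats M -> codim M ((sgval w).1 @: F) = codim M F.
Proof.
have le v B : B \in flats M -> (codim M ((sgval v).1 @: B) <= codim M B)%N.
  move=> flB; have [sZ clZ _] := basicP comM flB (zbasis_basic comM flB).
  rewrite -[leqRHS](card_imset _ (@perm_inj _ (sgval v).1)).
  by apply: (codim_span comM (act_flat v flB)); rewrite ?imsetS // cl_act clZ.
move=> flF; apply/eqP; rewrite eqn_leq; apply/andP; split; first exact: le.
have := le (w^-1)%g _ (act_flat w flF).
by rewrite -imset_permM mulVg imset_perm1.
Qed.

(** Translating the chosen basic set of F gives a basic set of the translated flat,
    in general not the chosen one; both products have the same values. *)
Lemma act_zmon w F : F \in flats M ->
  act w (zmon K M F) - zmon K M ((sgval w).1 @: F) \in gr_ideal (big_locus K M).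
Proof.
move=> flF; have flwF := act_flat w flF; apply: (@eq_on_grZ _ _ _ (codim M F)).
- by apply: act_homog; apply: zmon_homog.
- by rewrite -(codim_act w flF); apply: zmon_homog.
move=> X MX; rewrite -(sp_actV w X).
have : sp_act (sgval w^-1%g) X \in M by apply: sp_act_in.
move: (sp_act _ X) => Y MY.
by rewrite ev_act !ev_zmon ?sp_act_in // Flat_act imsetS_perm.
Qed.

End Symmetry.

(** * The small locus of a contraction *)

Section SmallLocus.
Variables (K : fieldType) (I : finType) (M : {set signed_subset I}) (F : {set I}).
Hypothesis comM : cond_oriented_matroid M.
Implicit Types (X Y W : signed_subset I) (A B C G : {set I}) (i : I).
Local Notation GM := (subg_of (sAut_group M)).
Local Notation HM := (subg_of (sAut_stab_group M F)).
Local Notation J := {i | i \notin F}.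
Local Notation SF := {mpoly K[#|{: J * bool}|]}.
Implicit Types (p q : SF) (w : GM) (h : HM).

Definition emb : {linear SF -> {mpoly K[#|{: I * sign}|]}} :=
  subst (fun t : J * bool => (val t.1, Some t.2)).

Lemma embM p q : emb (p * q) = emb p * emb q. Proof. exact: substM. Qed.

Lemma emb_homog d p : p \is d.-homog for mdeg -> emb p \is d.-homog for mdeg.
Proof. exact: subst_homog. Qed.

Lemma ev_emb X p : ev X (emb p) = eval_at (ypoint K (restrict F X)) p.
Proof.
rewrite /ev eval_subst; congr (eval_at _ p).
by apply/ffunP=> -[j b]; rewrite !ffunE.
Qed.

Lemma small_locusP p : vanishes_on (small_locus K (contraction M F)) p <->
  forall X, X \in M -> Flat X = F -> ev X (emb p) = 0.
Proof.
split=> [hp X MX XF|hp z /imfsetP[Y /= /setIdP[/imsetP[X /setIdP[MX FX] ->] /forallP nz] ->]].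
  rewrite ev_emb; apply: hp; apply: in_imfset; rewrite /= inE; apply/andP; split.
    by apply: imset_f; rewrite inE MX XF subxx.
  apply/forallP=> -[i nFi]; rewrite restrictE /=; apply: contra nFi => Xi.
  by rewrite -XF inE.
rewrite -ev_emb; apply: hp => //; apply/eqP; rewrite eqEsubset FX andbT.
apply/subsetP=> i; apply: contraLR => nFi; rewrite inE.
by have := nz (exist _ i nFi); rewrite restrictE.
Qed.

Definition to_aut h : GM := subg (sAut_group M) (sgval h).

Lemma sgval_to_aut h : sgval (to_aut h) = sgval h.
Proof. by rewrite subgK //; apply: (subsetP (sAut_stab_sub M F)); apply: subgP. Qed.

Lemma to_aut_fix h : (sgval (to_aut h)).1 @: F = F.
Proof. by rewrite sgval_to_aut; have /setIdP[_ /eqP] := subgP h. Qed.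

Lemma emb_act h p : emb (rename K (small_var_act h) p) = act K (to_aut h) (emb p).
Proof.
rewrite act_subst -[LHS]subst_comp -[RHS]subst_comp; apply: eq_subst => -[j b].
by rewrite /big_var_act sgval_to_aut.
Qed.

Lemma emb_prod C (f : I -> I * bool) : (forall i, i \in C -> (f i).1 \notin F) ->
  exists2 r : SF, r \is #|C|.-homog for mdeg &
    emb r = \prod_(i in C) var K ((f i).1, Some (f i).2).
Proof.
move=> fC; rewrite -sum1_card.
elim/big_rec2: _ => [|i p e Ci [r hr er]]; first by exists 1; [exact: dhomog1 | exact: subst1].
exists (var K (exist _ (f i).1 (fC i Ci), (f i).2) * r).
  by apply: dhomogM hr; apply: var_homog.
by rewrite embM er; congr (_ * _); apply: subst_var.
Qed.

Lemma emb_act_ymon w C : [disjoint C & (sgval w).1 @: F] ->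
  exists2 r : SF, r \is #|C|.-homog for mdeg & act K w (emb r) = ymon K C.
Proof.
move=> dC; pose v := sgval w^-1%g.
have [i Ci|r hr er] := @emb_prod C (fun i => (v.1 i, v.2 i (+) true)).
  apply: contraFN (disjointFr dC Ci) => /= Fi; apply/imsetP; exists (v.1 i) => //.
  by rewrite /v [in RHS]/= permKV.
exists r => //; have -> : emb r = act K w^-1%g (ymon K C).
  rewrite er /ymon act_subst subst_prod; apply: eq_bigr => i _.
  by rewrite subst_var.
by rewrite -act_comp mulgV act_one.
Qed.

End SmallLocus.

(** * Filtered presentations and averaging *)

Lemma linear_inverse (K : fieldType) (U V : lmodType K) (f : {linear U -> V}) :
    injective f -> (forall v, exists u, f u = v) ->
  exists2 g : {linear V -> U}, cancel f g & cancel g f.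
Proof.
move=> injf surjf; have [g fg] := choice surjf.
have gf : cancel f g by move=> u; apply: injf; rewrite fg.
have lin_g : linear g by move=> a u v; apply: injf; rewrite linearP !fg.
pose gL : {linear V -> U} := HB.pack g (GRing.isLinear.Build K V U _ g lin_g).
by exists gL.
Qed.

Section Averaging.
Variables (K : fieldType) (G : finGroupType) (P W : gradedModule K G).

Definition equivariant (f : P -> W) := forall g x, f (gact P g x) = gact W g (f x).
Definition graded_map (f : P -> W) := forall d x, f (gcomp P d x) = gcomp W d (f x).

Variable t : {linear P -> W}.

Definition average_fun (x : P) : W :=
  (#|G|%:R)^-1 *: \sum_(g : G) gact W g (t (gact P g^-1%g x)).
Fact average_linear : linear average_fun.
Proof.
move=> a x y; rewrite /average_fun scalerA mulrC -scalerA -scalerDr; congr (_ *: _).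
by rewrite scaler_sumr -big_split; apply: eq_bigr => g _; rewrite !linearP.
Qed.
HB.instance Definition _ := GRing.isLinear.Build K P W _ average_fun average_linear.
Definition average : {linear P -> W} := average_fun.

Lemma average_equivariant : equivariant average.
Proof.
move=> h x; rewrite /average /= /average_fun linearZ; congr (_ *: _).
rewrite linear_sum (reindex_inj (mulgI h)); apply: eq_bigr => g _.
by rewrite -gactM invMg -gactM mulgKV gactM.
Qed.

Lemma average_graded : graded_map t -> graded_map average.
Proof.
move=> ht d x; rewrite /average /= /average_fun linearZ; congr (_ *: _).
by rewrite linear_sum; apply: eq_bigr => g _; rewrite -gcomp_act ht gcomp_act.
Qed.

End Averaging.

Section Presentation.
Variables (K : fieldType) (G : finGroupType) (P V W : gradedModule K G).
Variables (b : {linear P -> V}) (q : {linear P -> W}) (t : {linear W -> P}).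
Variables (Fil : nat -> P -> Prop) (n : nat).
Hypotheses (G_unit : (#|G|%:R : K) != 0) (bG : equivariant b) (qG : equivariant q).
Hypotheses (b_graded : graded_map b) (t_graded : graded_map t).
Hypotheses (tK : cancel t q) (b_surj : forall v, exists x, b x = v).
Hypotheses (Fil0 : forall x, Fil 0 x) (Fil_end : forall x, Fil n x -> x = 0).
Hypotheses (FilB : forall k x y, Fil k x -> Fil k y -> Fil k (x - y)).
Hypotheses (FilZ : forall k a x, Fil k x -> Fil k (a *: x)).
Hypotheses (FilG : forall k g x, Fil k x -> Fil k (gact P g x)).
Hypotheses (Fil_tq : forall k x, Fil k x -> Fil k (t (q x))).
Hypotheses (ker_q : forall k x, Fil k x -> q x = 0 -> exists2 y, Fil k.+1 y & b x = b y).
Hypotheses (ker_b : forall k x, Fil k x -> b x = 0 -> exists2 y, Fil k.+1 y & q x = q y).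

Let s := average t.

Let sK : cancel s q.
Proof.
move=> w; rewrite /s /average /= /average_fun linearZ linear_sum.
rewrite (eq_bigr (fun=> w)) => [|g _].
  by rewrite /= sumr_const -(scaler_nat _ w) scalerA mulVf ?scale1r.
by rewrite qG tK -gactM mulgV gact1.
Qed.

Let Fil_sum k (J : Type) (r : seq J) (f : J -> P) :
  Fil k 0 -> (forall j, Fil k (f j)) -> Fil k (\sum_(j <- r) f j).
Proof.
move=> F0 hf; elim/big_rec: _ => // j x _ Fx.
by rewrite -[x]opprK; apply: FilB (hf j) _; rewrite -[- x]sub0r; apply: FilB.
Qed.

Let Fil_sq k x : Fil k x -> Fil k (s (q x)).
Proof.
move=> Fx; have F0 : Fil k 0 by rewrite -(subrr x); apply: FilB.
apply: FilZ; apply: Fil_sum => // g; rewrite -qG; exact/FilG/Fil_tq/FilG.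
Qed.

(** If two quotients of a filtered module have the same kernel up to the next
    filtration step, then an equivariant section of the first, obtained by
    averaging, composed with the second is an isomorphism: both injectivity and
    surjectivity follow by moving one filtration step at a time. *)
Lemma graded_iso_of_presentation : graded_iso V W.
Proof.
have inj : injective (b \o s).
  move=> u v /eqP; rewrite -subr_eq0 -linearB => /eqP; set w := u - v => b0.
  suff w0 : w = 0 by apply/eqP; rewrite -subr_eq0 -/w w0.
  have step k : exists2 x, Fil k x & q x = w.
    elim: k => [|k [x Fx qx]]; first by exists (s w).
    have [|y Fy qy] := ker_b (Fil_sq Fx); first by rewrite qx.
    by exists y => //; rewrite -qy sK.
  by have [x /Fil_end-> <-] := step n; rewrite linear0.
have surj v : exists w, (b \o s) w = v.
  have img m k x : (m + k)%N = n -> Fil k x -> exists w, b (s w) = b x.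
    elim: m k x => [|m IHm] k x.
      by rewrite add0n => -> /Fil_end->; exists 0; rewrite !linear0.
    rewrite addSnnS => /IHm IH Fx.
    have [||y Fy by_] := ker_q (x := x - s (q x)) (k := k).
    - exact: FilB (Fil_sq Fx).
    - by rewrite linearB /= sK subrr.
    have [w bw] := IH y Fy; exists (w + q x).
    by rewrite !linearD /= bw -by_ linearB subrK.
  have [x <-] := b_surj v; exact: img (addn0 n) (Fil0 x).
have [f bsK fK] := linear_inverse (f := b \o s) inj surj.
have eq_inj g w : (b \o s) (gact W g w) = gact V g ((b \o s) w).
  by rewrite /= average_equivariant bG.
have gr_inj d w : (b \o s) (gcomp W d w) = gcomp V d ((b \o s) w).
  by rewrite /= average_graded // b_graded.
exists f; split.
- by exists (b \o s).
- by move=> g v; apply: inj; rewrite eq_inj !fK.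
- by move=> d v hv; apply: inj; rewrite gr_inj !fK.
Qed.

End Presentation.

(** * Induced modules of quotients *)

Lemma card_subg_of (gT : finGroupType) (H : {group gT}) : #|{: subg_of H}| = #|H|.
Proof. by rewrite -cardsT (card_isog (isog_subg H)). Qed.

Section InducedAverage.
Variables (K : fieldType) (gT : finGroupType) (G H : {group gT}).
Variable V : gradedModule K (subg_of H).
Hypotheses (sHG : H \subset G) (H_unit : (#|H|%:R : K) != 0).
Local Notation W := {ffun subg_of G -> gsort V}.
Implicit Types (w : W) (x g : subg_of G) (h : subg_of H) (v : V).

Definition incl h : subg_of G := subg G (sgval h).

Lemma sgval_incl h : sgval (incl h) = sgval h.
Proof. by rewrite subgK //; apply: (subsetP sHG); apply: subgP. Qed.

Lemma inclM h k : incl (h * k)%g = (incl h * incl k)%g.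
Proof. by apply: val_inj; rewrite /= !sgval_incl. Qed.

(** The projection of {ffun G -> V} onto the functions satisfying
    w (x * h) = h^-1 . w x; its kernel is the span of the relations that define
    the induced module, see ind_spanE. *)
Definition ind_avg_fun w : W :=
  [ffun x => (#|H|%:R)^-1 *: \sum_h gact V h (w (x * incl h)%g)].
Fact ind_avg_linear : linear ind_avg_fun.
Proof.
move=> a u w; apply/ffunP=> x; rewrite !ffunE scalerA mulrC -scalerA -scalerDr.
congr (_ *: _); rewrite scaler_sumr -big_split; apply: eq_bigr => h _.
by rewrite !ffunE linearP.
Qed.
HB.instance Definition _ := GRing.isLinear.Build K W W _ ind_avg_fun ind_avg_linear.
Definition ind_avg : {linear W -> W} := ind_avg_fun.

Lemma ind_avgE w x : ind_avg w x = (#|H|%:R)^-1 *: \sum_h gact V h (w (x * incl h)%g).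
Proof. exact: ffunE. Qed.

Lemma ind_avg_twist w x h : ind_avg w (x * incl h)%g = gact V h^-1%g (ind_avg w x).
Proof.
rewrite !ind_avgE linearZ; congr (_ *: _); rewrite linear_sum.
rewrite [RHS](reindex_inj (mulgI h)) /=; apply: eq_bigr => k _.
by rewrite -gactM mulKg inclM mulgA.
Qed.

Lemma ind_avg_rel w : w \in @ind_span K gT G H V -> ind_avg w = 0.
Proof.
case/asboolP=> n [a [r [hr ->]]]; rewrite linear_sum big1 // => i _; rewrite linearZ /=.
have [g [h [v ->]]] := hr i; rewrite -[RHS](scaler0 _ (a i)); congr (_ *: _).
rewrite linearB; apply/ffunP=> x; rewrite !ffunE; apply/eqP; rewrite subr_eq0; apply/eqP.
congr (_ *: _); rewrite (reindex_inj (mulIg h)) /=; apply: eq_bigr => k _.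
rewrite !ffunE inclM mulgA (inj_eq (mulIg _)) gactM.
by case: eqP => // _; rewrite !linear0.
Qed.

Lemma tens_sum w : w = \sum_x tens x (w x).
Proof.
apply/ffunP=> y; rewrite sum_ffunE (bigD1 y) //= ffunE eqxx big1 ?addr0 // => x nxy.
by rewrite ffunE eq_sym (negPf nxy).
Qed.

Lemma ind_avg_congr w : w - ind_avg w \in @ind_span K gT G H V.
Proof.
have -> : w - ind_avg w = (#|H|%:R)^-1 *: \sum_x \sum_h
    (tens (x * incl h)%g (w (x * incl h)%g) - tens x (gact V h (w (x * incl h)%g))).
  transitivity ((#|H|%:R)^-1 *: (\sum_(h : subg_of H) w -
      \sum_x \sum_h tens x (gact V h (w (x * incl h)%g)))).
    rewrite scalerBr; congr (_ - _).
      rewrite sumr_const card_subg_of.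
      by rewrite -(scaler_nat _ w) scalerA mulVf ?scale1r.
    rewrite [LHS]tens_sum scaler_sumr; apply: eq_bigr => x _; rewrite ind_avgE.
    apply/ffunP=> y; rewrite !ffunE sum_ffunE; case: eqP => [yx|nyx].
      by congr (_ *: _); apply: eq_bigr => h _; rewrite ffunE yx eqxx.
    by rewrite big1 ?scaler0 // => h _; rewrite ffunE; case: eqP.
  congr (_ *: _); under [RHS]eq_bigr do rewrite sumrB.
  rewrite sumrB; congr (_ - _); rewrite exchange_big; apply: eq_bigr => h _.
  by rewrite [LHS]tens_sum (reindex_inj (mulIg (incl h))).
apply: rpredZ; apply: rpred_sum => x _; apply: rpred_sum => h _; apply: mem_span.
by exists x, h, (w (x * incl h)%g).
Qed.

Lemma ind_spanE w : (w \in @ind_span K gT G H V) = (ind_avg w == 0).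
Proof.
apply/idP/eqP => [|w0]; first exact: ind_avg_rel.
by have := ind_avg_congr w; rewrite w0 subr0.
Qed.

End InducedAverage.

Section QuotientMap.
Local Open Scope quotient_scope.
Variables (K : fieldType) (G : finGroupType) (V : gradedModule K G).
Variables (S : {pred V}) (S_closed : submod_closed S).
Hypothesis Sact : forall g v, v \in S -> gact V g v \in S.
Hypothesis Scomp : forall d v, v \in S -> gcomp V d v \in S.
Local Notation Q := (Quotient.quot (submod_of S_closed)).

Definition gpi : {linear V -> gquot S_closed Sact Scomp} := (\pi_Q : V -> Q).

Lemma gpi_surj u : exists v, gpi v = u.
Proof. by elim/quotW: u => v; exists v. Qed.

Lemma gpi_eq0 v : gpi v = 0 <-> v \in S.
Proof.
rewrite -[v in v \in S]subr0; have := quot_eqP S_closed v 0.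
by rewrite linear0 => e; split => [h|/e //]; apply/e.
Qed.

Lemma gpi_act : equivariant gpi.
Proof. by move=> g v; rewrite [RHS]quot_act_pi. Qed.

Lemma gpi_comp : graded_map gpi.
Proof. by move=> d v; rewrite [RHS]quot_comp_pi. Qed.

End QuotientMap.

Section FunctionMap.
Variables (K : fieldType) (X : finType) (A B : lmodType K) (p : {linear A -> B}).

Definition ffun_map_fun (w : {ffun X -> A}) : {ffun X -> B} := [ffun x => p (w x)].
Fact ffun_map_linear : linear ffun_map_fun.
Proof. by move=> a u w; apply/ffunP=> x; rewrite !ffunE linearP. Qed.
HB.instance Definition _ :=
  GRing.isLinear.Build K {ffun X -> A} {ffun X -> B} _ ffun_map_fun ffun_map_linear.
Definition ffun_map : {linear {ffun X -> A} -> {ffun X -> B}} := ffun_map_fun.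

Lemma ffun_mapE w x : ffun_map w x = p (w x). Proof. exact: ffunE. Qed.

End FunctionMap.

Section InducedQuotient.
Variables (K : fieldType) (gT : finGroupType) (G H : {group gT}).
Hypotheses (sHG : H \subset G) (H_unit : (#|H|%:R : K) != 0).
Variables (V Q : gradedModule K (subg_of H)) (p : {linear V -> Q}).
Hypotheses (pG : equivariant p).
Variable c : nat.
Local Notation R := (gregular G (gshift V c)).
Local Notation W := (gInd G (gshift Q c)).

Definition ind_pi0 : {linear gregular G (gshift Q c) -> W} :=
  @gpi _ _ (gregular G (gshift Q c)) (@ind_span _ _ G H (gshift Q c))
    (span_submod_closed (@ind_rel _ _ G H (gshift Q c)))
    (@ind_act_stable _ _ G H (gshift Q c)) (@ind_comp_stable _ _ G H (gshift Q c)).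

Lemma ind_pi0_act : equivariant ind_pi0. Proof. exact: gpi_act. Qed.
Lemma ind_pi0_comp : graded_map ind_pi0. Proof. exact: gpi_comp. Qed.
Lemma ind_pi0_surj u : exists w, ind_pi0 w = u. Proof. exact: gpi_surj. Qed.
Lemma ind_pi0_eq0 w : ind_pi0 w = 0 <-> ind_avg G (gshift Q c) w = 0.
Proof.
by apply: iff_trans (gpi_eq0 _ _ _ w) _; rewrite ind_spanE //; split=> /eqP.
Qed.

Definition ind_quot_fun (w : R) : W := ind_pi0 (ffun_map _ p w).
Fact ind_quot_linear : linear ind_quot_fun.
Proof. by move=> a u w; rewrite /ind_quot_fun !linearP. Qed.
HB.instance Definition _ := GRing.isLinear.Build K R W _ ind_quot_fun ind_quot_linear.
Definition ind_quot : {linear R -> W} := ind_quot_fun.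

Lemma ind_quot_equivariant : equivariant ind_quot.
Proof.
move=> g w; rewrite /ind_quot /= /ind_quot_fun -ind_pi0_act; congr (ind_pi0 _).
by apply/ffunP=> x; rewrite !ffunE.
Qed.

Lemma ind_quot_eq0 w : ind_quot w = 0 <-> forall x, p (ind_avg G V w x) = 0.
Proof.
have E : ind_avg G (gshift Q c) (ffun_map _ p w) = ffun_map _ p (ind_avg G V w).
  apply/ffunP=> x; rewrite ffun_mapE [LHS]ind_avgE [in RHS]ind_avgE linearZ /=; congr (_ *: _).
  by rewrite linear_sum; apply: eq_bigr => h _; rewrite ffun_mapE pG.
split=> [/ind_pi0_eq0|pw].
  by rewrite E => /ffunP pw x; have := pw x; rewrite ffun_mapE => ->; rewrite ffunE.
by apply/ind_pi0_eq0; rewrite E; apply/ffunP=> x; rewrite ffun_mapE pw ffunE.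
Qed.

Variable s : {linear Q -> V}.
Hypotheses (sK : cancel s p) (s_graded : graded_map s).

(* Any representative will do: ind_avg kills the relations, so the lift is
   linear. *)
Let lift (u : W) : gregular G (gshift Q c) :=
  ind_avg G (gshift Q c) (sval (cid (ind_pi0_surj u))).

Let liftE w : lift (ind_pi0 w) = ind_avg G (gshift Q c) w.
Proof.
rewrite /lift; case: cid => v /= /eqP; rewrite -subr_eq0 -linearB => /eqP/ind_pi0_eq0/eqP.
by rewrite linearB subr_eq0 => /eqP.
Qed.

Let ind_pi0K u : ind_pi0 (lift u) = u.
Proof.
rewrite -[RHS](svalP (cid (ind_pi0_surj u))) /lift; set w := sval _.
apply/eqP; rewrite eq_sym -subr_eq0 -linearB; apply/eqP.
by apply/ind_pi0_eq0/ind_avg_rel => //; apply: ind_avg_congr.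
Qed.

Definition ind_section_fun (u : W) : R := ffun_map _ s (lift u).
Fact ind_section_linear : linear ind_section_fun.
Proof.
move=> a u v; have [[u' <-] [v' <-]] := (ind_pi0_surj u, ind_pi0_surj v).
by rewrite /ind_section_fun -linearP !liftE !linearP.
Qed.
HB.instance Definition _ := GRing.isLinear.Build K W R _ ind_section_fun ind_section_linear.
Definition ind_section : {linear W -> R} := ind_section_fun.

Lemma ind_sectionK : cancel ind_section ind_quot.
Proof.
move=> u; rewrite /ind_quot /= /ind_quot_fun -[RHS]ind_pi0K; congr (ind_pi0 _).
by apply/ffunP=> x; rewrite !ffun_mapE sK.
Qed.

Lemma ind_section_graded : graded_map ind_section.
Proof.
move=> d u; have [u' <-] := ind_pi0_surj u; rewrite -ind_pi0_comp.
rewrite /ind_section /= /ind_section_fun !liftE; apply/ffunP=> x.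
rewrite [RHS]ffunE !ffun_mapE !ind_avgE /shift_comp.
transitivity (s (shift_comp Q c d ((#|H|%:R)^-1 *: \sum_h gact Q h (u' (x * incl G h)%g)))).
  congr (s _); rewrite [RHS]linearZ; congr (_ *: _).
  rewrite [RHS]linear_sum; apply: eq_bigr => h _.
  by rewrite ffunE shift_comp_act.
rewrite [RHS]/= /shift_comp; case: (d < c)%N => /=; first by rewrite linear0.
by rewrite s_graded.
Qed.

End InducedQuotient.

(** * Bases of the small quotients *)

Section SmallBasis.
Variables (K : fieldType) (I : finType) (M : {set signed_subset I}) (F : {set I}).
Hypothesis comM : cond_oriented_matroid M.
Hypothesis flF : F \in flats M.
Implicit Types (X Y W : signed_subset I) (A B C G : {set I}) (i : I).
Local Notation J := {i | i \notin F}.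
Local Notation SF := {mpoly K[#|{: J * bool}|]}.
Local Notation grY := (gr_ideal (small_locus K (contraction M F))).
Implicit Types (p u : SF).

Lemma emb_small_ymon C : [disjoint C & F] ->
  exists2 r : SF, r \is #|C|.-homog for mdeg & emb K F r = ymon K C.
Proof.
move=> dC; apply: (@emb_prod K I F C (fun i => (i, true))) => i Ci /=.
by rewrite (disjointFr dC).
Qed.

(** The product zmon F * u vanishes at covectors whose flat does not contain F, so
    its normal form involves only flats of codimension at least that of F; among
    these, F alone is contained in F. *)
Lemma flat_coeffs d u : (msize u <= d)%N ->
  exists c : {set I} -> K, (forall C, c C != 0 -> nbc M F C /\ (#|C| < d)%N) /\
    forall X, X \in M -> Flat X = F -> ev X (emb K F u) = \sum_C c C * (C \subset Pos X)%:R.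
Proof.
move=> led; pose p := zmon K M F * emb K F u.
have lep : (msize p <= codim M F + d)%N.
  apply: msize_mul_leq; first exact: msize_homog (zmon_homog _ _ _).
  rewrite (pihomog_partitionE led) linear_sum; apply: msize_sum_leq => i _.
  by apply: leq_trans (msize_homog (emb_homog (pihomogP _ _ _))) _.
have evp X : X \in M -> ev X p = (F \subset Flat X)%:R * ev X (emb K F u).
  by move=> MX; rewrite evM ev_zmon.
have [X MX ltX|c [hc cE]] := normal_coeffs comM (k := codim M F) lep.
  rewrite evp //; have [sFX|_] := boolP (F \subset Flat X); last by rewrite mul0r.
  have flX : Flat X \in flats M by apply: imset_f.
  by have := leq_trans ltX (codim_mono comM flF flX sFX); rewrite ltnn.
exists (c F); split=> [C nz|X MX XF].
  by have [_ nbcC + _] := hc F C nz; rewrite ltn_add2l.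
have := cE X MX; rewrite evp // XF subxx mul1r => ->.
rewrite (bigD1 F) //= [X in _ + X]big1 ?addr0 => [|G nGF]; last first.
  rewrite big1 // => C _; have [->|nz] := eqVneq (c G C) 0; first by rewrite mul0r.
  rewrite /mon XF; have [sGF|_] := boolP (G \subset F); last by rewrite mulr0.
  have [flG _ _ le] := hc G C nz; have pG : G \proper F by rewrite properEneq nGF.
  by have := leq_ltn_trans le (codim_proper comM flG flF pG); rewrite ltnn.
by apply: eq_bigr => C _; rewrite /mon XF subxx.
Qed.

Local Notation B := {C : {set I} | nbc M F C}.

Lemma nbc_disjoint (C : B) : [disjoint val C & F].
Proof. by have /andP[] := valP C. Qed.

Definition ybar (C : B) : SF := s2val (cid2 (emb_small_ymon (nbc_disjoint C))).

Lemma ybar_homog (C : B) : ybar C \is #|val C|.-homog for mdeg.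
Proof. exact: s2valP (cid2 (emb_small_ymon (nbc_disjoint C))). Qed.

Lemma emb_ybar (C : B) : emb K F (ybar C) = ymon K (val C).
Proof. exact: s2valP' (cid2 (emb_small_ymon (nbc_disjoint C))). Qed.

Definition ycomb_fun (c : {ffun B -> K^o}) : SF := \sum_C c C *: ybar C.
Fact ycomb_linear : linear ycomb_fun.
Proof.
move=> a c c'; rewrite /ycomb_fun scaler_sumr -big_split; apply: eq_bigr => C _.
by rewrite !ffunE scalerDl scalerA.
Qed.
HB.instance Definition _ := GRing.isLinear.Build K {ffun B -> K^o} SF _ ycomb_fun ycomb_linear.
Definition ycomb : {linear {ffun B -> K^o} -> SF} := ycomb_fun.

Definition deg_part d (c : {ffun B -> K^o}) : {ffun B -> K^o} :=
  [ffun C : B => if #|val C| == d then c C else 0].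

Lemma ycomb_comp d c : pihomog mdeg d (ycomb c) = ycomb (deg_part d c).
Proof.
rewrite /ycomb /= /ycomb_fun linear_sum; apply: eq_bigr => C _; rewrite linearZ ffunE /=.
have [<-|ne] := eqVneq; first by rewrite pihomog_dE ?ybar_homog.
by rewrite (pihomog_ne0 ne (ybar_homog C)) scaler0 scale0r.
Qed.

Lemma ev_ycomb X c :
  ev X (emb K F (ycomb c)) = \sum_(C : B) c C * (val C \subset Pos X)%:R.
Proof.
rewrite /ycomb /= /ycomb_fun linear_sum ev_sum; apply: eq_bigr => C _.
by rewrite linearZ evZ emb_ybar ev_ymon.
Qed.

Lemma sum_nbc (c : {set I} -> K) X : (forall C, c C != 0 -> nbc M F C) ->
  \sum_C c C * (C \subset Pos X)%:R = \sum_(C : B) c (val C) * (val C \subset Pos X)%:R.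
Proof.
move=> hc; rewrite (bigID (nbc M F)) /= [X in _ + X]big1 ?addr0 => [|C nC]; last first.
  by have [->|/hc] := eqVneq (c C) 0; rewrite ?mul0r // (negPf nC).
rewrite (reindex_omap (val : B -> {set I}) insub) => [|C nC]; last by rewrite insubT.
by apply: eq_bigl => C; rewrite valK eqxx andbT (valP C).
Qed.

(** A homogeneous relation of degree d modulo the graded ideal would equate, as
    functions on the covectors with flat F, a combination of nbc monomials of
    degree d with one of smaller degree, against nbc_independent. *)
Lemma ycomb_gr c : ycomb c \in grY -> c = 0.
Proof.
move=> gr; apply/ffunP=> C0; rewrite ffunE; set d := #|val C0|.
have grd : pihomog mdeg d (ycomb c) \in grY.
  exact: (@gr_ideal_comp _ _ _ _ _ (@small_var_act1 I M F) (@small_var_actM I M F)).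
have [p /small_locusP vp lep] := iffLR (gr_ideal_homogP _ (pihomogP _ d _)) grd.
rewrite ycomb_comp in lep; have [b [hb bE]] := flat_coeffs lep.
pose e C := b C + oapp (fun C' : B => deg_part d c C') 0 (insub C).
have e0 : forall C, e C = 0.
  apply: (nbc_independent comM flF) => [C|X MX XF].
    rewrite /e; case: insubP => [//|_] /=; rewrite addr0; by case/hb.
  have hsum : \sum_C b C * (C \subset Pos X)%:R =
      - \sum_(C : B) deg_part d c C * (val C \subset Pos X)%:R.
    by rewrite -bE // linearB evB vp // sub0r ev_ycomb.
  rewrite /e; under eq_bigr do rewrite mulrDl.
  rewrite big_split /= hsum addrC; apply/eqP; rewrite subr_eq0; apply/eqP.
  rewrite sum_nbc => [|C]; last by case: insubP => //=; rewrite eqxx.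
  by apply: eq_bigr => C _; rewrite valK.
have := e0 (val C0); rewrite /e valK /= ffunE eqxx.
have [->|/hb[_]] := eqVneq (b (val C0)) 0; first by rewrite add0r.
by rewrite ltnn.
Qed.

Lemma ycomb_span p : exists c, p - ycomb c \in grY.
Proof.
have hom d : exists c, pihomog mdeg d p - ycomb c \in grY.
  have [b [hb bE]] := flat_coeffs (msize_homog (pihomogP mdeg d p)).
  exists [ffun C : B => if #|val C| == d then b (val C) else 0].
  set c := finfun _.
  have cE : c = deg_part d [ffun C : B => b (val C)] by apply/ffunP=> C; rewrite !ffunE.
  apply/(gr_ideal_homogP _ (d := d)).
    by rewrite rpredB ?pihomogP // cE -ycomb_comp pihomogP.
  exists (pihomog mdeg d p - ycomb [ffun C : B => b (val C)]).
    apply/small_locusP=> X MX XF; rewrite linearB evB bE // ev_ycomb.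
    rewrite sum_nbc => [|C /hb[] //]; rewrite -sumrB big1 // => C _.
    by rewrite ffunE subrr.
  rewrite opprB addrC addrA subrK -linearB; apply: msize_sum_leq => C _.
  rewrite !ffunE; have [_|ne] := eqVneq #|val C| d; first by rewrite subrr scale0r msize0.
  have [->|/hb[_ le]] := eqVneq (b (val C)) 0; first by rewrite subrr scale0r msize0.
  rewrite sub0r; apply: leq_trans (mmeasureZ_le _ _ _) _.
  apply: leq_trans (msize_homog (ybar_homog C)) _.
  by rewrite ltn_neqAle ne -ltnS.
have [c hc] := choice hom.
exists (\sum_(d < msize p) c d).
rewrite {1}(pihomog_partitionE (leqnn (msize p))) (linear_sum ycomb) -sumrB.
by apply: rpred_sum => d _; apply: hc.
Qed.

End SmallBasis.

Section SmallQuotient.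
Variables (K : fieldType) (I : finType) (M : {set signed_subset I}) (F : {set I}).
Hypothesis comM : cond_oriented_matroid M.
Hypothesis flF : F \in flats M.

Definition polyF : gradedModule K (subg_of (sAut_stab_group M F)) :=
  gpoly K (@small_var_act1 I M F) (@small_var_actM I M F).

Definition piY : {linear polyF -> RY K M F} := @gpi _ _ polyF _ _ _ _.

Lemma piY_eq0 (p : polyF) : piY p = 0 <-> p \in gr_ideal (small_locus K (contraction M F)).
Proof. exact: gpi_eq0. Qed.

Lemma piY_act : equivariant piY. Proof. exact: gpi_act. Qed.
Lemma piY_comp : graded_map piY. Proof. exact: gpi_comp. Qed.

(** The nbc basis provides a graded linear section, in general not an
    equivariant one. *)
Lemma piY_section : exists2 s : {linear RY K M F -> polyF}, cancel s piY & graded_map s.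
Proof.
pose E : {linear _ -> RY K M F} := piY \o (ycomb K M F).
have injE : injective E.
  move=> c c' /eqP; rewrite -subr_eq0 -linearB => /eqP/piY_eq0/ycomb_gr h.
  by apply/eqP; rewrite -subr_eq0 h.
have surjE u : exists c, E c = u.
  have [p <-] : exists p, piY p = u by apply: gpi_surj.
  have [c hc] := ycomb_span comM flF p; exists c.
  by apply/eqP; rewrite eq_sym -subr_eq0 -linearB; apply/eqP/piY_eq0.
have [g gE Eg] := linear_inverse injE surjE.
exists (ycomb K M F \o g) => [u|d u]; first exact: Eg.
have gc : g (gcomp (RY K M F) d u) = deg_part d (g u).
  apply: (can_inj gE); rewrite Eg -[in LHS](Eg u) -piY_comp.
  by congr (piY _); apply: ycomb_comp.
transitivity (ycomb K M F (deg_part d (g u))); first by rewrite -gc.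
by rewrite -ycomb_comp.
Qed.

End SmallQuotient.

(** * The filtered presentation of the big quotient *)

Section DirectSumMap.
Variables (K : fieldType) (J : finType) (A B : J -> lmodType K).
Variable f : forall j, {linear A j -> B j}.

Definition dsum_hom_fun (v : dsum_type A) : dsum_type B := [ffun j => f j (v j)].
Fact dsum_hom_linear : linear dsum_hom_fun.
Proof. by move=> a u v; apply/ffunP=> j; rewrite !ffunE linearP. Qed.
HB.instance Definition _ :=
  GRing.isLinear.Build K (dsum_type A) (dsum_type B) _ dsum_hom_fun dsum_hom_linear.
Definition dsum_hom : {linear dsum_type A -> dsum_type B} := dsum_hom_fun.

Lemma dsum_homE v j : dsum_hom v j = f j (v j). Proof. exact: ffunE. Qed.

Definition dsum_inj j (a : A j) : dsum_type A :=
  [ffun i => dfwith (fun i => 0 : A i) a i].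

Lemma dsum_inj_in j (a : A j) : dsum_inj a j = a.
Proof. by rewrite ffunE dfwith_in. Qed.

Lemma dsum_inj_out j (a : A j) i : i != j -> dsum_inj a i = 0.
Proof. by move=> ij; rewrite ffunE dfwith_out // eq_sym. Qed.

End DirectSumMap.

Section Assembly.
Variables (K : fieldType) (I : finType) (M : {set signed_subset I}) (T : {set {set I}}).
Hypothesis comM : cond_oriented_matroid M.
Hypothesis cardAut : (#|sAut M|%:R : K) != 0.
Hypothesis reprT : is_transversal T (flat_orbits M) (flats M).
Local Notation GM := (subg_of (sAut_group M)).
Local Notation HM F := (subg_of (sAut_stab_group M F)).
Local Notation S := {mpoly K[#|{: I * sign}|]}.
Local Notation grZ := (gr_ideal (big_locus K M)).
Local Notation polyF := (polyF K M).
Local Notation TF := {F : {set I} | F \in T}.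
Implicit Types (X Y : signed_subset I) (F G C : {set I}) (w g : GM).

Local Notation R F := (gregular (sAut_group M) (gshift (polyF F) (codim M F))).
Local Notation P := (gdsum (fun F : TF => R (val F))).
Local Notation W := (gdsum (fun F : TF =>
       gInd (sAut_group M) (gshift (RY K M (val F)) (codim M (val F))))).
Local Notation bigS := (gpoly K (@big_var_act1 I M) (@big_var_actM I M)).

Lemma T_flat F : F \in T -> F \in flats M.
Proof. by have /and3P[_ /subsetP sT _] := reprT; apply: sT. Qed.

Lemma T_repr G : G \in flats M -> exists2 F, F \in T & exists w, (sgval w).1 @: F = G.
Proof.
move=> flG; have /and3P[_ _ /forall_inP tr] := reprT.
have := tr _ (imset_f (fun F => [set w.1 @: F | w : signed_perm I in sAut M]) flG).
case/cards1P=> F /setP/(_ F); rewrite !inE eqxx => /andP[TF /imsetP[w Aw FE]].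
exists F => //; exists (subg (sAut_group M) w^-1%g).
by rewrite subgK ?groupV // FE -imset_permM mulVg imset_perm1.
Qed.

Lemma T_uniq F F' w w' : F \in T -> F' \in T ->
  (sgval w).1 @: F = (sgval w').1 @: F' -> F = F'.
Proof.
move=> TF TF' e; have /and3P[_ _ /forall_inP tr] := reprT.
have := tr _ (imset_f (fun F => [set w.1 @: F | w : signed_perm I in sAut M]) (T_flat TF)).
have orbF : F \in [set w.1 @: F | w : signed_perm I in sAut M].
  by apply/imsetP; exists 1%g; rewrite ?group1 // imset_perm1.
have orbF' : F' \in [set w.1 @: F | w : signed_perm I in sAut M].
  apply/imsetP; exists (sgval (w'^-1 * w)%g); first exact: subgP.
  by rewrite imset_permM e -imset_permM mulVg imset_perm1.
case/cards1P=> F0 /setP E; have := E F; have := E F'.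
by rewrite !inE TF TF' orbF orbF' => /esym/eqP-> /esym/eqP->.
Qed.

(** The map from the functions on the group to polynomials that sends the tensor
    of g and r to g . (zmon F * r); it raises degrees by the codimension of F. *)
Definition place_fun F (v : R F) : S := \sum_g act K g (zmon K M F * emb K F (v g)).
Fact place_linear F : linear (@place_fun F).
Proof.
move=> a u v; rewrite /place_fun scaler_sumr -big_split; apply: eq_bigr => g _.
by rewrite !ffunE linearP mulrDr -scalerAr linearP.
Qed.
HB.instance Definition _ F :=
  GRing.isLinear.Build K (R F) S _ (@place_fun F) (@place_linear F).
Definition place F : {linear R F -> S} := @place_fun F.

Lemma placeE F (v : R F) : place F v = \sum_g act K g (zmon K M F * emb K F (v g)).
Proof. by []. Qed.

Lemma place_act F g (v : R F) : place F (gact (R F) g v) = act K g (place F v).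
Proof.
rewrite !placeE [RHS]linear_sum (reindex_inj (mulgI g)) /=.
by apply: eq_bigr => h _; rewrite ffunE mulKg act_comp.
Qed.

Lemma place_comp F d (v : R F) : place F (gcomp (R F) d v) = pihomog mdeg d (place F v).
Proof.
rewrite !placeE linear_sum; apply: eq_bigr => g _; rewrite ffunE /= /shift_comp.
rewrite [RHS](pihomog_linear_shift (f := fun r => act K g (zmon K M F * emb K F r))
                (e := codim M F)); first 1 last.
- by move=> a r r'; rewrite linearP mulrDr -scalerAr linearP.
- move=> k r hr; apply: act_homog; rewrite addnC.
  by apply: dhomogM; [apply: zmon_homog | apply: emb_homog].
by case: ltnP => _ //=; rewrite linear0 mulr0 linear0.
Qed.

Lemma place_tens F g (r : polyF F) :
  place F (tens (V := gshift (polyF F) (codim M F)) g r) = act K g (zmon K M F * emb K F r).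
Proof.
rewrite placeE (bigD1 g) //= ffunE eqxx big1 ?addr0 // => h nhg.
by rewrite ffunE (negPf nhg) linear0 mulr0 linear0.
Qed.

(** Modulo the graded ideal, act g (zmon F) depends on the flat g F only, so that
    the elements of the stabilizer of F may be moved across. *)
Lemma place_rel F (v : R F) : F \in flats M ->
  v \in @ind_span K _ (sAut_group M) _ (gshift (polyF F) (codim M F)) -> place F v \in grZ.
Proof.
move=> flF /asboolP[n [a [r [hr ->]]]]; rewrite linear_sum rpred_sum // => i _.
rewrite linearZ rpredZ //=; have [g [h [u ->]]] := hr i.
rewrite linearB !place_tens act_comp -linearB.
have -> : emb K F (gact (gshift (polyF F) (codim M F)) h u) = act K (to_aut h) (emb K F u).
  exact: emb_act.
apply: act_gr; rewrite act_mul -mulrBl mulrC; apply: gr_ideal_mul.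
by have := act_zmon K comM (to_aut h) flF; rewrite to_aut_fix.
Qed.

Lemma stab_unit F : (#|sAut_stab M F|%:R : K) != 0.
Proof.
apply: contraNneq cardAut => h0; have /dvdnP[k ->] := cardSg (sAut_stab_sub M F).
by rewrite natrM h0 mulr0.
Qed.

Local Notation avg F := (ind_avg (sAut_group M) (gshift (polyF F) (codim M F))).

Lemma place_avg F (v : R F) : F \in flats M -> place F v - place F (avg F v) \in grZ.
Proof.
move=> flF; rewrite -linearB; apply: place_rel => //; apply: ind_avg_congr.
- exact: stab_unit.
Qed.

Definition present_fun (x : P) : S := \sum_(F : TF) place (val F) (x F).
Fact present_linear : linear present_fun.
Proof.
move=> a u v; rewrite /present_fun scaler_sumr -big_split; apply: eq_bigr => F _.
by rewrite !ffunE linearP.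
Qed.
HB.instance Definition _ := GRing.isLinear.Build K P S _ present_fun present_linear.
Definition present : {linear P -> S} := present_fun.

Lemma P_actE g (x : P) (F : TF) : gact P g x F = gact (R (val F)) g (x F).
Proof. exact: ffunE. Qed.

Lemma P_compE d (x : P) (F : TF) : gcomp P d x F = gcomp (R (val F)) d (x F).
Proof. exact: ffunE. Qed.

Lemma presentE x : present x = \sum_(F : TF) place (val F) (x F).
Proof. by []. Qed.

Lemma presentD x y : present (x + y) = present x + present y.
Proof. exact: linearD. Qed.

Lemma presentZ a x : present (a *: x) = a *: present x.
Proof. exact: linearZ. Qed.

Lemma present0 : present 0 = 0.
Proof. exact: linear0. Qed.

Lemma present_act g x : present (gact P g x) = act K g (present x).
Proof.
rewrite !presentE [RHS]linear_sum; apply: eq_bigr => F _.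
by rewrite P_actE; apply: place_act.
Qed.

Lemma present_comp d x : present (gcomp P d x) = pihomog mdeg d (present x).
Proof.
rewrite !presentE [RHS]linear_sum; apply: eq_bigr => F _.
by rewrite P_compE; apply: place_comp.
Qed.

Definition Fil k (x : P) := forall F : TF, (codim M (val F) < k)%N -> x F = 0.

Lemma FilB k x y : Fil k x -> Fil k y -> Fil k (x - y).
Proof. by move=> hx hy F lt_k; rewrite !ffunE hx // hy // subr0. Qed.

Lemma Fil0x k : Fil k 0. Proof. by move=> F _; rewrite ffunE. Qed.

Lemma FilD k x y : Fil k x -> Fil k y -> Fil k (x + y).
Proof. by move=> hx hy F lt_k; rewrite !ffunE hx // hy // addr0. Qed.

Lemma FilZ k a x : Fil k x -> Fil k (a *: x).
Proof. by move=> hx F lt_k; rewrite !ffunE hx // scaler0. Qed.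

Lemma FilG k g x : Fil k x -> Fil k (gact P g x).
Proof. by move=> hx F lt_k; rewrite P_actE hx // linear0. Qed.

Lemma FilW k l x : (l <= k)%N -> Fil k x -> Fil l x.
Proof. by move=> lk hx F lt_l; apply: hx; apply: leq_trans lk. Qed.

(** The image of step k of the filtration in the big quotient, pulled back to
    polynomials. *)
Definition reach k (p : S) := exists2 y, Fil k y & p - present y \in grZ.

Lemma reachD k p p' : reach k p -> reach k p' -> reach k (p + p').
Proof.
move=> [y hy gy] [y' hy' gy']; exists (y + y'); first exact: FilD.
rewrite presentD opprD addrACA; exact: rpredD gy gy'.
Qed.

Lemma reachZ k a p : reach k p -> reach k (a *: p).
Proof.
move=> [y hy gy]; exists (a *: y); first exact: FilZ.
rewrite presentZ -scalerBr; exact: rpredZ gy.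
Qed.

Lemma reach_gr k p : p \in grZ -> reach k p.
Proof. by move=> gp; exists 0; [exact: Fil0x | rewrite present0 subr0]. Qed.

Lemma reach_sum k (J : Type) (r : seq J) (Q : pred J) (f : J -> S) :
  (forall j, Q j -> reach k (f j)) -> reach k (\sum_(j <- r | Q j) f j).
Proof.
move=> hf; elim/big_rec: _ => [|j p Qj hp]; first by apply: reach_gr; apply: rpred0.
exact: reachD (hf j Qj) hp.
Qed.

Lemma reach_act k g p : reach k p -> reach k (act K g p).
Proof.
move=> [y hy gy]; exists (gact P g y); first exact: FilG.
rewrite present_act -linearB; exact: act_gr gy.
Qed.

Lemma reachW k l p : (l <= k)%N -> reach k p -> reach l p.
Proof. by move=> lk [y hy gy]; exists y; [exact: FilW hy | exact: gy]. Qed.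

(** Transport to the representative F of the orbit of G. *)
Lemma reach_mon k G C : G \in flats M -> nbc M G C -> (k <= codim M G)%N ->
  reach k (zmon K M G * ymon K C).
Proof.
move=> flG /andP[dCG _] le_k; have [F inT [w wF]] := T_repr flG.
have flF := T_flat inT.
have [r _ hr] : exists2 r, r \is #|C|.-homog for mdeg & act K w (emb K F r) = ymon K C.
  by apply: emb_act_ymon; rewrite wF.
pose F' : TF := exist _ F inT.
pose y : P := dsum_inj (A := fun F : TF => R (val F)) (j := F')
  (tens (V := gshift (polyF F) (codim M F)) w r).
exists y.
  move=> E; have [->|ne] := eqVneq E F'; last by rewrite /y dsum_inj_out.
  by move=> /= lt_k; have := leq_trans lt_k le_k; rewrite -wF codim_act // ltnn.
have -> : present y = act K w (zmon K M F * emb K F r).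
  rewrite presentE (bigD1 F') //= [X in _ + X]big1 ?addr0.
    by rewrite /y dsum_inj_in place_tens.
  by move=> E ne; rewrite /y dsum_inj_out // linear0.
rewrite act_mul hr -mulrBl mulrC; apply: gr_ideal_mul.
by rewrite -opprB rpredN -wF; apply: act_zmon.
Qed.

Lemma reach_leading d k p q : p \is d.-homog for mdeg -> (msize (q - p) <= d)%N ->
    (forall X, X \in M -> (codim M (Flat X) < k)%N -> ev X q = 0) ->
  reach k p.
Proof.
move=> hp lt_qp van; have [c [hc gc]] := leading_form_reduce comM hp lt_qp van.
rewrite -[p](subrK (\sum_G \sum_C c G C *: (zmon K M G * ymon K C))).
apply: reachD; first exact: reach_gr.
apply: reach_sum => G _; apply: reach_sum => C _.
have [->|nz] := eqVneq (c G C) 0; first by rewrite scale0r; apply: reach_gr; apply: rpred0.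
by have [flG nbcC _ le_k] := hc G C nz; apply/reachZ/reach_mon.
Qed.

Lemma reach_all p : reach 0 p.
Proof.
rewrite (pihomog_partitionE (leqnn (msize p))); apply: reach_sum => d _.
apply: (@reach_leading d _ _ (pihomog mdeg d p)) => //; first exact: pihomogP.
by rewrite subrr msize0.
Qed.

(** The leading form of a polynomial vanishing on the covectors with flat F becomes,
    once multiplied by zmon F, the leading form of a polynomial vanishing in all
    codimensions up to that of F; its normal form lives on larger flats. *)
Lemma reach_small F r : F \in flats M ->
  r \in gr_ideal (small_locus K (contraction M F)) ->
  reach (codim M F).+1 (zmon K M F * emb K F r).
Proof.
move=> flF gr; rewrite (pihomog_partitionE (leqnn (msize r))) linear_sum mulr_sumr.
apply: reach_sum => d _.
have grd : pihomog mdeg d r \in gr_ideal (small_locus K (contraction M F)).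
  exact: (@gr_ideal_comp _ _ _ _ _ (@small_var_act1 I M F) (@small_var_actM I M F)).
have [p /small_locusP vp lep] := iffLR (gr_ideal_homogP _ (pihomogP _ d _)) grd.
apply: (@reach_leading (codim M F + d) _ _ (zmon K M F * emb K F p)).
- by apply: dhomogM; [exact: zmon_homog | apply: emb_homog; exact: pihomogP].
- rewrite -mulrBr -linearB; apply: msize_mul_leq; first exact: msize_homog (zmon_homog _ _ _).
  rewrite (pihomog_partitionE lep) linear_sum; apply: msize_sum_leq => i _.
  by apply: leq_trans (msize_homog (emb_homog (pihomogP _ _ _))) _.
move=> X MX; rewrite ltnS evM ev_zmon // => ltX.
have [sFX|_] := boolP (F \subset Flat X); last by rewrite mul0r.
rewrite vp ?mulr0 //; apply/eqP; apply: contraTT ltX => ne; rewrite -ltnNge.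
by apply: codim_proper => //; [apply: imset_f | rewrite properEneq eq_sym ne].
Qed.

Definition piZ : {linear bigS -> RZ K M} := @gpi _ _ bigS _ _ _ _.

Lemma piZ_eq0 (p : bigS) : piZ p = 0 <-> p \in grZ. Proof. exact: gpi_eq0. Qed.

Lemma piZ_act : equivariant piZ. Proof. exact: gpi_act. Qed.
Lemma piZ_comp : graded_map piZ. Proof. exact: gpi_comp. Qed.

Definition to_big : {linear P -> RZ K M} := piZ \o present.

Lemma to_big_equivariant : equivariant to_big.
Proof. by move=> g x; rewrite /to_big /= present_act; apply: piZ_act. Qed.

Lemma to_big_graded : graded_map to_big.
Proof. by move=> d x; rewrite /to_big /= present_comp; apply: piZ_comp. Qed.

Lemma to_big_surj u : exists x, to_big x = u.
Proof.
have [p <-] : exists p, piZ p = u by apply: gpi_surj.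
have [y _ gy] := reach_all p; exists y; apply/eqP; rewrite eq_sym -subr_eq0.
by rewrite /to_big /= -linearB; apply/eqP/piZ_eq0.
Qed.

Definition to_sum : {linear P -> W} :=
  dsum_hom (fun F : TF => ind_quot (sAut_group M) (piY K M (val F)) (codim M (val F))).

Lemma to_sumE x (F : TF) :
  to_sum x F = ind_quot (sAut_group M) (piY K M (val F)) (codim M (val F)) (x F).
Proof. exact: dsum_homE. Qed.

Lemma W_actE g (u : W) (F : TF) : gact W g u F =
  gact (gInd (sAut_group M) (gshift (RY K M (val F)) (codim M (val F)))) g (u F).
Proof. exact: ffunE. Qed.

Lemma W_compE d (u : W) (F : TF) : gcomp W d u F =
  gcomp (gInd (sAut_group M) (gshift (RY K M (val F)) (codim M (val F)))) d (u F).
Proof. exact: ffunE. Qed.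

Lemma to_sum_equivariant : equivariant to_sum.
Proof.
by move=> g x; apply/ffunP=> F; rewrite W_actE !to_sumE P_actE ind_quot_equivariant.
Qed.

Lemma to_sum_eq0 (x : P) (F : TF) : to_sum x F = 0 <->
  forall g, avg (val F) (x F) g \in gr_ideal (small_locus K (contraction M (val F))).
Proof.
rewrite to_sumE.
have := @ind_quot_eq0 K _ _ _ (sAut_stab_sub M (val F)) (stab_unit (val F)) _ _ _
  (@piY_act K I M (val F)) (codim M (val F)) (x F).
move=> e; split=> [/e h g|h]; first exact/piY_eq0/h.
by apply/e => g; apply/piY_eq0/h.
Qed.

(** Modulo the graded ideal, averaging x does not change the polynomial that it
    presents (place_avg), and the blocks of the average are in the graded ideals
    of the contractions, where reach_small applies. *)
Lemma ker_to_sum k x : Fil k x -> to_sum x = 0 ->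
  exists2 y, Fil k.+1 y & to_big x = to_big y.
Proof.
move=> Fx qx; suff [y Fy gy] : reach k.+1 (present x).
  exists y; first exact: Fy.
  apply/eqP; rewrite -subr_eq0 /to_big /= -linearB.
  exact/eqP/piZ_eq0.
rewrite presentE; apply: reach_sum => F _.
have flF : val F \in flats M by apply: T_flat; apply: valP.
have [lt_k|le_k] := ltnP (codim M (val F)) k.
  by rewrite Fx // linear0; apply: reach_gr; apply: rpred0.
rewrite -[place _ _](subrK (place (val F) (avg (val F) (x F)))).
apply: reachD; first by apply: reach_gr; apply: place_avg.
have qF : to_sum x F = 0 by rewrite qx ffunE.
rewrite placeE; apply: reach_sum => g _; apply: reach_act.
apply: (@reachW (codim M (val F)).+1); first exact: le_k.
exact: reach_small flF (iffLR (to_sum_eq0 x F) qF g).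
Qed.

Lemma same_flat F g g0 : (sgval g).1 @: F = (sgval g0).1 @: F ->
  exists h : HM F, g = (g0 * to_aut h)%g.
Proof.
move=> e; have hS : sgval (g0^-1 * g)%g \in sAut_stab M F.
  apply/setIdP; split; first exact: subgP.
  apply/eqP; rewrite -[sgval _]/((sgval g0)^-1 * sgval g)%g.
  by rewrite imset_permM e -imset_permM mulVg imset_perm1.
exists (subg (sAut_stab_group M F) (sgval (g0^-1 * g)%g)).
by apply: val_inj; rewrite /= sgval_to_aut subgK //= mulKVg.
Qed.

Lemma card_orbit_flat F g0 :
  #|[set g : GM | (sgval g).1 @: F == (sgval g0).1 @: F]| = #|sAut_stab M F|.
Proof.
rewrite -(card_subg_of (sAut_stab_group M F)).
rewrite -(card_imset (f := fun h : HM F => (g0 * to_aut h)%g)); last first.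
  move=> h k /mulgI e; apply: val_inj.
  by have := congr1 sgval e; rewrite !sgval_to_aut.
apply: eq_card => g; rewrite inE; apply/eqP/imsetP => [e|[h _ ->]]; last first.
  by rewrite imset_permM to_aut_fix.
by have [h gE] := same_flat e; exists h.
Qed.

Lemma ev_present X (x : P) : X \in M -> ev X (present x) =
  \sum_(F : TF) \sum_(g : GM) ((sgval g).1 @: val F \subset Flat X)%:R *
     ev (sp_act (sgval g^-1%g) X) (emb K (val F) (x F g)).
Proof.
move=> MX; rewrite presentE ev_sum; apply: eq_bigr => F _.
rewrite placeE ev_sum; apply: eq_bigr => g _; rewrite -{1}(sp_actV g X) ev_act evM.
have MY : sp_act (sgval g^-1%g) X \in M by apply: sp_act_in.
rewrite ev_zmon //; last by apply: T_flat; apply: valP.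
by rewrite -(imsetS_perm (sgval g)) -Flat_act sp_actV.
Qed.

Lemma codim_eq_sub F G : F \in flats M -> G \in flats M -> F \subset G ->
  (codim M G <= codim M F)%N -> F = G.
Proof.
move=> flF flG sFG le; apply/eqP; apply: contraTT le => ne; rewrite -ltnNge.
by apply: codim_proper => //; rewrite properEneq ne.
Qed.

Lemma ev_present_small k (x : P) X : Fil k x -> X \in M -> (codim M (Flat X) < k)%N ->
  ev X (present x) = 0.
Proof.
move=> Fx MX ltX; rewrite ev_present // big1 // => F _; rewrite big1 // => g _.
have flF : val F \in flats M by apply: T_flat; apply: valP.
have [lt_k|le_k] := ltnP (codim M (val F)) k.
  by rewrite Fx // ffunE linear0 /ev /eval_at meval0 mulr0.
have [sFX|_] := boolP (_ \subset _); last by rewrite mul0r.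
have flX : Flat X \in flats M by apply: imset_f.
have := leq_ltn_trans (codim_mono comM (act_flat g flF) flX sFX) ltX.
by rewrite codim_act // ltnNge le_k.
Qed.

(** At a covector whose flat is the translate of F by g0, only the summands
    indexed by F and by the coset of g0 survive; for an averaged element they
    all agree. *)
Lemma ev_present_flat k (x : P) (F : TF) g0 X : Fil k x -> codim M (val F) = k ->
    (forall h : HM (val F), gact (polyF (val F)) h (x F (g0 * to_aut h)%g) = x F g0) ->
    X \in M -> Flat X = (sgval g0).1 @: val F ->
  ev X (present x) = #|sAut_stab M (val F)|%:R *
    ev (sp_act (sgval g0^-1%g) X) (emb K (val F) (x F g0)).
Proof.
move=> Fx cF twist MX XF; have flF : val F \in flats M by apply: T_flat; apply: valP.
have flX : Flat X \in flats M by apply: imset_f.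
rewrite ev_present // (bigD1 F) //= [X in _ + X]big1 ?addr0 => [|E neE]; last first.
  rewrite big1 // => g _; have flE : val E \in flats M by apply: T_flat; apply: valP.
  have [lt_k|le_k] := ltnP (codim M (val E)) k.
    by rewrite Fx // ffunE linear0 /ev /eval_at meval0 mulr0.
  have [sEX|_] := boolP (_ \subset _); last by rewrite mul0r.
  have e : (sgval g).1 @: val E = Flat X.
    apply: (codim_eq_sub (act_flat g flE) flX sEX).
    by rewrite XF (codim_act comM g0 flF) (codim_act comM g flE) cF.
  case/eqP: neE; apply: val_inj; apply: (@T_uniq _ _ g g0 (valP E) (valP F)).
  by rewrite e XF.
have -> : #|sAut_stab M (val F)|%:R =
    \sum_(g : GM | (sgval g).1 @: val F == (sgval g0).1 @: val F) 1 :> K.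
  rewrite -(card_orbit_flat (val F) g0) -sum1_card natr_sum.
  by apply: eq_bigl => g; rewrite inE.
rewrite (bigID (fun g : GM => (sgval g).1 @: val F == (sgval g0).1 @: val F)) /=.
rewrite [X in _ + X]big1 ?addr0 => [|g neg]; last first.
  have [sFX|_] := boolP (_ \subset _); last by rewrite mul0r.
  case/eqP: neg; rewrite -XF; apply: (codim_eq_sub (act_flat g flF) flX sFX).
  by rewrite XF (codim_act comM g0 flF) (codim_act comM g flF).
rewrite mulr_suml; apply: eq_bigr => g /eqP e.
rewrite XF e subxx mul1r mul1r; have [h gE] := same_flat e.
rewrite -[in RHS](twist h) -gE emb_act.
have -> : sp_act (sgval g0^-1%g) X = sp_act (sgval (to_aut h)) (sp_act (sgval g^-1%g) X).
  by rewrite -!sp_actM gE; congr (sp_act _ X); rewrite /= invMg mulKVg.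
by rewrite ev_act.
Qed.

(** A homogeneous element of the graded ideal takes the same values as some
    polynomial u of smaller degree. Read off on the covectors with flat g0 F, the
    normal form of u has smaller degree than the block of e at F and g0, and the
    same values up to the order of the stabilizer of F; so this block lies in the
    graded ideal of the contraction. *)
Lemma present_avg_gr k (e : P) : Fil k e -> present e \in grZ ->
    (forall (F : TF) g (h : HM (val F)),
       gact (polyF (val F)) h (e F (g * to_aut h)%g) = e F g) ->
  forall (F : TF) g0, codim M (val F) = k ->
    e F g0 \in gr_ideal (small_locus K (contraction M (val F))).
Proof.
move=> Fe ge twist F g0 cF; have flF : val F \in flats M by apply: T_flat; apply: valP.
set r := e F g0; pose rS : {mpoly K[#|{: {i | i \notin val F} * bool}|]} := r.
suff hom m : pihomog mdeg m rS \in gr_ideal (small_locus K (contraction M (val F))).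
  rewrite [X in X \in _](pihomog_partitionE (leqnn (msize rS))).
  by apply: rpred_sum => m _; apply: hom.
pose e' := gcomp P (m + k) e.
have e'E (E : TF) g : e' E g = shift_comp (polyF (val E)) (codim M (val E)) (m + k) (e E g).
  by rewrite /e' P_compE; apply: ffunE.
have e'F g : e' F g = gcomp (polyF (val F)) m (e F g).
  by rewrite e'E /shift_comp cF ltnNge leq_addl addnK.
have Fe' : Fil k e' by move=> E lt_k; rewrite /e' P_compE Fe // linear0.
have twist' (h : HM (val F)) : gact (polyF (val F)) h (e' F (g0 * to_aut h)%g) = e' F g0.
  by rewrite !e'F -gcomp_act twist.
have hE : present e' = pihomog mdeg (m + k) (present e) by apply: present_comp.
have gh : pihomog mdeg (m + k) (present e) \in grZ.
  exact: (@gr_ideal_comp _ _ _ _ _ (@big_var_act1 I M) (@big_var_actM I M)).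
have [p /big_locusP vp lep] := iffLR (gr_ideal_homogP _ (pihomogP _ (m + k) _)) gh.
rewrite -hE in lep; pose u := present e' - p.
have leu : (msize u <= m + k)%N by rewrite -mmeasureN opprB.
have evu X : X \in M -> ev X u = ev X (present e').
  by move=> MX; rewrite evB vp // subr0.
have [X MX ltX|c [hc cE]] := normal_coeffs comM (k := k) leu.
  by rewrite evu //; apply: ev_present_small Fe' MX ltX.
set G := (sgval g0).1 @: val F; have flG : G \in flats M by apply: act_flat.
have cG : codim M G = k by rewrite codim_act.
have /choice[y hy] (C : {set I}) : exists yC : {mpoly K[#|{: {i | i \notin val F} * bool}|]},
    c G C != 0 -> yC \is #|C|.-homog for mdeg /\
      act K g0 (emb K (val F) yC) = ymon K C.
  have [_|nz] := eqVneq (c G C) 0; first by exists 0.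
  have [_ /andP[dCG _] _ _] := hc G C nz.
  by have [yC hom actC] := emb_act_ymon K dCG; exists yC.
apply/(gr_ideal_homogP _ (pihomogP _ m _)).
pose n : K := #|sAut_stab M (val F)|%:R; have n0 : n != 0 by apply: stab_unit.
exists (pihomog mdeg m rS - n^-1 *: \sum_C c G C *: y C); last first.
  rewrite addrC addKr mmeasureN; apply: leq_trans (mmeasureZ_le _ _ _) _.
  apply: msize_sum_leq => C _; have [->|nz] := eqVneq (c G C) 0; first by rewrite scale0r msize0.
  have [homC _] := hy C nz; apply: leq_trans (mmeasureZ_le _ _ _) _.
  apply: leq_trans (msize_homog homC) _.
  by have [_ _ + _] := hc G C nz; rewrite cG addnC ltn_add2r.
apply/small_locusP=> Y MY YF; pose X := sp_act (sgval g0) Y.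
have MX : X \in M by apply: sp_act_in.
have XF : Flat X = G by rewrite /X Flat_act YF.
have YE : sp_act (sgval g0^-1%g) X = Y by rewrite /X -sp_actM mulVg sp_act1.
have := ev_present_flat Fe' cF twist' MX XF; rewrite -evu // cE // YE e'F -/n => E.
rewrite linearB evB; apply/eqP; rewrite subr_eq0; apply/eqP; apply: (mulfI n0).
rewrite -[LHS]E linearZ evZ mulVKf // linear_sum ev_sum.
rewrite (bigD1 G) //= [X in _ + X]big1 ?addr0 => [|G' neG]; last first.
  rewrite big1 // => C _; have [->|nz] := eqVneq (c G' C) 0; first by rewrite mul0r.
  rewrite /mon XF; have [sG'G|_] := boolP (G' \subset G); last by rewrite mulr0.
  have [flG' _ _ le_k] := hc G' C nz; case/eqP: neG.
  by apply: (codim_eq_sub flG' flG sG'G); rewrite cG.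
apply: eq_bigr => C _; rewrite linearZ evZ /mon XF subxx /=.
have [->|nz] := eqVneq (c G C) 0; first by rewrite !mul0r.
by have [_ actC] := hy C nz; rewrite -(ev_act g0) -/X actC ev_ymon.
Qed.

Lemma ker_to_big k x : Fil k x -> to_big x = 0 ->
  exists2 y, Fil k.+1 y & to_sum x = to_sum y.
Proof.
move=> Fx bx; have gx : present x \in grZ by apply/piZ_eq0.
pose e : P := [ffun F => avg (val F) (x F)].
have eE (F : TF) : e F = avg (val F) (x F) by apply: ffunE.
have Fe : Fil k e by move=> F lt_k; rewrite eE Fx // linear0.
have ge : present e \in grZ.
  rewrite -[present e](subKr (present x)); apply: rpredB => //.
  rewrite !presentE -sumrB; apply: rpred_sum => F _; rewrite eE.
  by apply: place_avg; apply: T_flat; apply: valP.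
have twist (F : TF) g (h : HM (val F)) :
    gact (polyF (val F)) h (e F (g * to_aut h)%g) = e F g.
  rewrite eE [X in gact _ _ X](ind_avg_twist (sAut_stab_sub M (val F))).
  by rewrite -[gact (gshift _ _) _ _]/(gact (polyF (val F)) _ _) -gactM mulgV gact1.
(* Dropping the blocks of codimension k does not change the image in the sum. *)
pose y : P := [ffun F => if codim M (val F) == k then 0 else x F].
have yE (F : TF) : y F = if codim M (val F) == k then 0 else x F by apply: ffunE.
exists y => [F|].
  by rewrite ltnS leq_eqVlt yE; case: eqP => //= _; apply: Fx.
apply/ffunP=> F; rewrite [RHS]to_sumE yE; case: eqP => [cF|_]; last exact: to_sumE.
rewrite linear0; apply/to_sum_eq0 => g; rewrite -eE.
exact: present_avg_gr Fe ge twist F g cF.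
Qed.

Lemma big_quotient_iso : graded_iso (RZ K M) W.
Proof.
have flT (F : TF) : val F \in flats M by apply: T_flat; apply: valP.
pose s (F : TF) := s2val (cid2 (piY_section K comM (flT F))).
have sK (F : TF) : cancel (s F) (piY K M (val F)).
  exact: s2valP (cid2 (piY_section K comM (flT F))).
have s_graded (F : TF) : graded_map (s F).
  exact: s2valP' (cid2 (piY_section K comM (flT F))).
pose t : {linear W -> P} := dsum_hom (fun F : TF =>
  ind_section (sAut_stab_sub M (val F)) (stab_unit (val F)) (codim M (val F)) (s F)).
have tE (F : TF) u : t u F = ind_section (sAut_stab_sub M (val F)) (stab_unit (val F))
    (codim M (val F)) (s F) (u F) by apply: dsum_homE.
have t_graded : graded_map t.
  move=> d u; apply/ffunP=> F; rewrite P_compE [LHS]tE W_compE (tE F u).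
  exact: ind_section_graded (s_graded F) d (u F).
have tK : cancel t to_sum.
  move=> u; apply/ffunP=> F; rewrite to_sumE tE.
  exact: ind_sectionK (sK F) (u F).
have G_unit : (#|GM|%:R : K) != 0 by rewrite card_subg_of.
apply: (graded_iso_of_presentation (b := to_big) (q := to_sum) (t := t)
          (Fil := Fil) (n := #|I|.+1)).
- exact: G_unit.
- exact: to_big_equivariant.
- exact: to_sum_equivariant.
- exact: to_big_graded.
- exact: t_graded.
- exact: tK.
- exact: to_big_surj.
- by move=> x F; rewrite ltn0.
- move=> x Fx; apply/ffunP=> F; rewrite Fx ?ffunE // ltnS.
  exact: max_card.
- exact: FilB.
- exact: FilZ.
- exact: FilG.
- by move=> k x Fx F lt_k; rewrite tE to_sumE Fx // !linear0.
- exact: ker_to_sum.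
- exact: ker_to_big.
Qed.

End Assembly.

Theorem theorem4p18 (K : fieldType) (I : finType)
    (M : {set signed_subset I}) (T : {set {set I}})
    (comM : cond_oriented_matroid M)
    (cardAut : (#|sAut M|%:R : K) \is a GRing.unit)
    (reprT : is_transversal T (flat_orbits M) (flats M)) :
  graded_iso (RZ K M)
    (gdsum (fun F : {F : {set I} | F \in T} =>
       gInd (sAut_group M) (gshift (RY K M (val F)) (codim M (val F))))).
Proof.
by apply: big_quotient_iso => //; rewrite -unitfE.
Qed.
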